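(* Let $n\in\mathbb{Z}_{>0}$ and $u_1,\dots,u_\ell\in\overline{K}$. Set $\mathbf{v}_i:=(0,\dots,0,(-1)^nu_i)^{\mathrm{tr}}\in\mathcal{V}_n$ for $1\le i\le \ell$, and fix an $\mathbb{F}_q$-linear lift $\mathrm{Li}_{\mathcal{K},n}^\circ:\mathbb{C}_\infty\to\mathbb{C}_\infty$ of $\overset{\rightarrow}{\mathrm{Li}_{\mathcal{K},n}}:\mathbb{C}_\infty\to\mathbb{C}_\infty/A$. Then: (1) For every $u\in\overline{K}$ there exist $m\in\mathbb{Z}_{>0}$, $c\in\overline{K}$, $a_1,\dots,a_m\in A$ and $f_1,\dots,f_m\in\overline{K}$ with $|f_j|_\infty<q^n$ for all $j$, such that in $\mathbb{C}_\infty/A$ $$\overset{\rightarrow}{\mathrm{Li}_{\mathcal{K},n}}(u)=c+\sum_{j=1}^m a_j\overset{\rightarrow}{\mathrm{Li}_{\mathcal{K},n}}(f_j)=c+\sum_{j=1}^m a_j\left(\sum_{i\geq 1}\frac{f_j^{q^i}}{(\theta^{q^i}-\theta)^n}\right).$$ (2) $\dim_K\mathrm{Span}_K\{1,\mathrm{Li}_{\mathcal{K},n}^\circ(u_1),\dots,\mathrm{Li}_{\mathcal{K},n}^\circ(u_\ell)\}\geq\mathrm{rank}_{\mathbb{F}_q[t]}\mathrm{Span}_{\mathbb{F}_q[t]}\{\mathbf{v}_1,\dots,\mathbf{v}_\ell\}+1$. (3) $\mathrm{rank}_{\mathbb{F}_q[t]}\mathrm{Span}_{\mathbb{F}_q[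t]}\{\mathbf{v}_1,\dots,\mathbf{v}_\ell\}+1\geq\dim_{\overline{K}}\mathrm{Span}_{\overline{K}}\{1,\mathrm{Li}_{\mathcal{K},n}^\circ(u_1),\dots,\mathrm{Li}_{\mathcal{K},n}^\circ(u_\ell)\}$.
   Context: $\mathbb{F}_q$ is the finite field with $q$ elements, $A=\mathbb{F}_q[\theta]$, $K=\mathbb{F}_q(\theta)$, $|\cdot|_\infty$ is the non-Archimedean absolute value on $K$ with $|\theta|_\infty=q$, $K_\infty=\mathbb{F}_q((1/\theta))$, $\mathbb{C}_\infty$ is the completion of an algebraic closure of $K_\infty$, and $\overline{K}$ is the algebraic closure of $K$ in $\mathbb{C}_\infty$. $\mathbb{T}=\{\sum_{i\ge0} a_it^i\in\mathbb{C}_\infty[[t]] : |a_i|_\infty\to0\}$ and $\mathbb{T}_\theta=\{\sum_{i\ge0} a_it^i\in\mathbb{C}_\infty[[t]] : |a_i\theta^i|_\infty\to0\}\subset\mathbb{T}$. For $f=\sum a_it^i$, $f^{(-1)}:=\sum a_i^{1/q}t^i$. The map $\wp:\mathbb{T}\to\mathbb{T}$, $\wp(f)=f^{(-1)}-f$, is surjective with kernel $\mathbb{F}_q[t]$, so it induces $\wp^{-1}:\mathbb{T}\to\mathbb{T}/\mathbb{F}_q[t]$. Since $t-\theta$ is a unit of $\mathbb{T}$, for $u\in\mathbb{C}_\infty$ and $n\ge0$ one sets $\overset{\rightarrow}{\mathscr{L}_{u,n}}:=\wp^{-1}\big((-1)^nu/(t-\theta)^n\big)\in\mathbb{T}/\mathbb{F}_q[t]$;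 this class lies in $\mathbb{T}_\theta/\mathbb{F}_q[t]$, so it can be evaluated at $t=\theta$. The analytically continued $n$-th Kochubei polylogarithm is the $\mathbb{F}_q$-linear map $$\overset{\rightarrow}{\mathrm{Li}_{\mathcal{K},n}}:\mathbb{C}_\infty\to\mathbb{C}_\infty/A,\qquad u\mapsto \overset{\rightarrow}{\mathscr{L}_{u,n}}\big|_{t=\theta}.$$ $\mathbb{C}_\infty/A$ is an $A$-module by scalar multiplication, and elements of $\mathbb{C}_\infty$ are also regarded as elements of $\mathbb{C}_\infty/A$. A lift of $\overset{\rightarrow}{\mathrm{Li}_{\mathcal{K},n}}$ is a map $\mathbb{C}_\infty\to\mathbb{C}_\infty$ whose composition with $\mathbb{C}_\infty\to\mathbb{C}_\infty/A$ is $\overset{\rightarrow}{\mathrm{Li}_{\mathcal{K},n}}$. $\mathcal{V}_n:=\mathrm{Mat}_{n\times1}(\overline{K})$ with the $\mathbb{F}_q[t]$-module structure in which elements of $\mathbb{F}_q$ act by scalars and $t$ acts as left multiplication by the $n\times n$ matrix $[t]_n$ with $\theta$ on the diagonal, $1$ on the superdiagonal, and $0$ elsewhere. $\mathrm{Span}_{\mathbb{F}_q[t]}$ denotes the $\mathbb{F}_q[t]$-submodule of $\mathcal{V}_n$ generated by the given elements, and $\mathrm{rank}_{\mathbb{F}_q[t]}$ the maximal number of $\mathbb{F}_q[t]$-linearly independent elements. *)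

(* Defs.v *)
(* MathComp / MathComp-Analysis *)
From HB Require Import structures.
From mathcomp Require Import all_boot all_order all_algebra.
From mathcomp Require Import generic_quotient ring_quotient.
From mathcomp Require Import boolp classical_sets reals topology normedtype.
From mathcomp Require Import sequences.

Set Implicit Arguments.
Unset Strict Implicit.
Unset Printing Implicit Defensive.

Import Order.TTheory GRing.Theory Num.Theory.
Import numFieldNormedType.Exports.

Local Open Scope classical_set_scope.
Local Open Scope ring_scope.
Local Open Scope quotient_scope.

Section LinearAlgebra.
Variables (S : nzRingType) (M : lmodType S).

Definition lin_comb (s : seq M) (c : 'I_(size s) -> S) : M :=
  \sum_(i < size s) c i *: s`_i.
Arguments lin_comb : clear implicits.

Definition lin_span (s : seq M) : set M := [set x | exists c, x = lin_comb s c].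

Definition lin_indep (s : seq M) : Prop :=
  forall c : 'I_(size s) -> S, lin_comb s c = 0 -> forall i, c i = 0.

Definition is_basis (V : set M) (b : seq M) : Prop :=
  lin_indep b /\ lin_span b = V.

(* Cardinality of a basis; [0] when [V] has no finite basis. *)
Definition lin_dim (V : set M) : nat :=
  xget 0%N [set d | exists b, is_basis V b /\ size b = d].

(* Maximal number of linearly independent elements of [V]; [0] when there is
   no such maximum. *)
Definition lin_rank (V : set M) : nat :=
  let indep_size r := exists s : seq M,
    [/\ {in s, forall x, V x}, lin_indep s & size s = r] in
  xget 0%N [set r | indep_size r /\ forall r', indep_size r' -> (r' <= r)%N].

End LinearAlgebra.

Section ScalarRestriction.
Variables (S : nzRingType) (E : nzRingType) (phi : {rmorphism S -> E}).

(* [E] as a left [S]-module through [phi]. *)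
Definition restrict_scalars & {rmorphism S -> E} : Type := E.

HB.instance Definition _ := GRing.Zmodule.on (restrict_scalars phi).

Let scale (a : S) (x : restrict_scalars phi) : restrict_scalars phi :=
  phi a * (x : E).

Fact restrict_scaleA a b x : scale a (scale b x) = scale (a * b) x.
Proof. by rewrite /scale rmorphM mulrA. Qed.
Fact restrict_scale1 : left_id 1 scale.
Proof. by move=> x; rewrite /scale rmorph1 mul1r. Qed.
Fact restrict_scaleDr : right_distributive scale +%R.
Proof. by move=> a x y; rewrite /scale mulrDr. Qed.
Fact restrict_scaleDl x : {morph scale^~ x : a b / a + b}.
Proof. by move=> a b; rewrite /scale rmorphD mulrDl. Qed.

HB.instance Definition _ := GRing.Zmodule_isLmodule.Build S (restrict_scalars phi)
  restrict_scaleA restrict_scale1 restrict_scaleDr restrict_scaleDl.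

End ScalarRestriction.

Definition algebraic_over (E : fieldType) (k : {pred E}) (x : E) : Prop :=
  exists p : {poly E}, [/\ p != 0, p \is a polyOver k & root p x].

Section ValuedField.
Variables (F : finFieldType) (R : realType) (E : fieldType).
Variables (iota : {rmorphism F -> E}) (theta : E) (abs : E -> R).

Definition converges_to (u : nat -> E) (x : E) : Prop :=
  (fun k => abs (u k - x)) @ \oo --> (0 : R).

Definition cauchy_sequence (u : nat -> E) : Prop :=
  forall e : R, 0 < e ->
    exists N, forall i j, (N <= i)%N -> (N <= j)%N -> abs (u i - u j) < e.

Record nonarchimedean_abs : Prop := NonarchimedeanAbs {
  abs_ge0 : forall x, 0 <= abs x;
  abs_eq0 : forall x, abs x = 0 <-> x = 0;
  absM : forall x y, abs (x * y) = abs x * abs y;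
  absD : forall x y, abs (x + y) <= Num.max (abs x) (abs y) }.

(* Laurent series in [1 / theta] over [F]. *)
Definition laurent_pred : {pred E} := fun x =>
  `[< exists (N : nat) (a : nat -> F),
        converges_to (series (fun i => iota (a i) * theta ^+ N / theta ^+ i)) x >].

Definition laurent_alg_pred : {pred E} := fun x => `[< algebraic_over laurent_pred x >].

(* [E] is the completion of an algebraic closure of F((1/theta)): the closure
   is the set [laurent_alg_pred] of elements of [E] algebraic over
   F((1/theta)).  Such [(E, iota, theta, abs)] are unique up to isometric
   isomorphism; [abs_theta] and the ultrametric axioms determine [abs] on
   F(theta). *)
Record completed_algebraic_closure : Prop := CompletedAlgebraicClosure {
  abs_na : nonarchimedean_abs;
  abs_theta : abs theta = #|F|%:R;
  abs_complete : forall u, cauchy_sequence u -> exists x, converges_to u x;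
  laurent_alg_closed : forall p : {poly E}, p \is a polyOver laurent_alg_pred ->
    (1 < size p)%N -> exists2 x, x \in laurent_alg_pred & root p x;
  laurent_alg_dense : forall x (e : R), 0 < e ->
    exists2 y, y \in laurent_alg_pred & abs (x - y) < e }.

End ValuedField.

Record Cinfty (F : finFieldType) (R : realType) := MkCinfty {
  Cinfty_sort :> fieldType;
  Fq_to_C : {rmorphism F -> Cinfty_sort};
  theta : Cinfty_sort;
  abs : Cinfty_sort -> R;
  CinftyP : completed_algebraic_closure Fq_to_C theta abs }.

Arguments Fq_to_C {F R} c.
Arguments theta {F R} c.
Arguments abs {F R} c _.

Section Subfields.
Variables (F : finFieldType) (R : realType) (C : Cinfty F R).

(* The inclusion of [A = F[theta]], with [A] represented by [{poly F}]. *)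
Definition A_to_C (a : {poly F}) : C := (map_poly (Fq_to_C C) a).[theta C].

Fact A_to_C_zmod_morphism : zmod_morphism A_to_C.
Proof. by move=> a b; rewrite /A_to_C rmorphB hornerD hornerN. Qed.
Fact A_to_C_monoid_morphism : monoid_morphism A_to_C.
Proof.
split=> [|a b]; first by rewrite /A_to_C rmorph1 hornerC.
by rewrite /A_to_C rmorphM hornerM.
Qed.
HB.instance Definition _ :=
  GRing.isZmodMorphism.Build {poly F} C A_to_C A_to_C_zmod_morphism.
HB.instance Definition _ :=
  GRing.isMonoidMorphism.Build {poly F} C A_to_C A_to_C_monoid_morphism.

Definition A_pred : {pred C} := fun x => `[< exists a, x = A_to_C a >].

Fact A_pred_zmod_closed : zmod_closed A_pred.
Proof.
split=> [|x y /asboolP[a ->] /asboolP[b ->]]; apply/asboolP.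
  by exists 0; rewrite rmorph0.
by exists (a - b); rewrite rmorphB.
Qed.
HB.instance Definition _ := GRing.isZmodClosed.Build C A_pred A_pred_zmod_closed.

Definition K_pred : {pred C} := fun x =>
  `[< exists a b, A_to_C b != 0 /\ x = A_to_C a / A_to_C b >].

Fact K_pred_divring_closed : divring_closed K_pred.
Proof.
split=> [|x y|x y].
- by apply/asboolP; exists 1, 1; rewrite rmorph1 oner_neq0 divr1.
- move=> /asboolP[a [b [b0 ->]]] /asboolP[c [d [d0 ->]]]; apply/asboolP.
  exists (a * d - c * b), (b * d); rewrite rmorphB !rmorphM mulf_neq0 //.
  by split=> //; rewrite -(mulNr _ (A_to_C d)^-1) addf_div // mulNr.
move=> /asboolP[a [b [b0 ->]]] /asboolP[c [d [d0 ->]]]; apply/asboolP.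
have [c0|c0] := eqVneq (A_to_C c) 0.
  by exists 0, 1; rewrite c0 rmorph0 rmorph1 !mul0r invr0 mulr0 oner_neq0.
exists (a * d), (b * c); rewrite !rmorphM mulf_neq0 //; split=> //.
by rewrite invf_div mulf_div.
Qed.
HB.instance Definition _ :=
  GRing.isDivringClosed.Build C K_pred K_pred_divring_closed.

Record K : predArgType := MkK { K_val : C; K_valP : K_val \in K_pred }.
HB.instance Definition _ := [isSub for K_val].
HB.instance Definition _ := [Choice of K by <:].
HB.instance Definition _ := [SubChoice_isSubComUnitRing of K by <:].
HB.instance Definition _ := [SubComUnitRing_isSubIntegralDomain of K by <:].
HB.instance Definition _ := [SubIntegralDomain_isSubField of K by <:].

Fact K_val_zmod_morphism : zmod_morphism (K_val : K -> C).
Proof. by move=> x y; rewrite -[LHS]/(val (x - y)) rmorphB. Qed.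
Fact K_val_monoid_morphism : monoid_morphism (K_val : K -> C).
Proof.
by split=> [|x y]; [exact: (rmorph1 val)|rewrite -[LHS]/(val (x * y)) rmorphM].
Qed.
HB.instance Definition _ :=
  GRing.isZmodMorphism.Build K C K_val K_val_zmod_morphism.
HB.instance Definition _ :=
  GRing.isMonoidMorphism.Build K C K_val K_val_monoid_morphism.

Definition Kbar_pred : {pred C} := fun x => `[< algebraic_over K_pred x >].

Fact algebraic_over_KE x :
  algebraic_over K_pred x <-> algebraicOver (K_val : K -> C) x.
Proof.
split=> [[p [p0 /polyOverP pK rpx]]|[p p0 rpx]]; last first.
  exists (map_poly (K_val : K -> C) p); split=> //.
    by rewrite map_poly_eq0.
  by apply/polyOverP => i; rewrite coef_map /= K_valP.
pose r : {poly K} := \poly_(i < size p) MkK (pK i).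
have rE : map_poly (K_val : K -> C) r = p.
  apply/polyP => i; rewrite coef_map_id0 // coef_poly.
  by case: ltnP => //= /(nth_default 0) ->.
exists r; last by rewrite rE.
by apply: contra_neq p0 => r0; rewrite -rE r0 map_poly0.
Qed.

Fact Kbar_pred_divring_closed : divring_closed Kbar_pred.
Proof.
split=> [|x y|x y].
- by apply/asboolP/algebraic_over_KE; apply: algebraic1.
- move=> /asboolP/algebraic_over_KE xK /asboolP/algebraic_over_KE yK.
  by apply/asboolP/algebraic_over_KE; apply: algebraic_sub.
move=> /asboolP/algebraic_over_KE xK /asboolP/algebraic_over_KE yK.
by apply/asboolP/algebraic_over_KE; apply: algebraic_div.
Qed.
HB.instance Definition _ :=
  GRing.isDivringClosed.Build C Kbar_pred Kbar_pred_divring_closed.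

Record Kbar : predArgType := MkKbar { Kbar_val :> C; Kbar_valP : Kbar_val \in Kbar_pred }.
HB.instance Definition _ := [isSub for Kbar_val].
HB.instance Definition _ := [Choice of Kbar by <:].
HB.instance Definition _ := [SubChoice_isSubComUnitRing of Kbar by <:].
HB.instance Definition _ := [SubComUnitRing_isSubIntegralDomain of Kbar by <:].
HB.instance Definition _ := [SubIntegralDomain_isSubField of Kbar by <:].

Fact Kbar_val_zmod_morphism : zmod_morphism (Kbar_val : Kbar -> C).
Proof. by move=> x y; rewrite -[LHS]/(val (x - y)) rmorphB. Qed.
Fact Kbar_val_monoid_morphism : monoid_morphism (Kbar_val : Kbar -> C).
Proof.
by split=> [|x y]; [exact: (rmorph1 val)|rewrite -[LHS]/(val (x * y)) rmorphM].
Qed.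
HB.instance Definition _ :=
  GRing.isZmodMorphism.Build Kbar C Kbar_val Kbar_val_zmod_morphism.
HB.instance Definition _ :=
  GRing.isMonoidMorphism.Build Kbar C Kbar_val Kbar_val_monoid_morphism.

Fact K_pred_Kbar x : x \in K_pred -> x \in Kbar_pred.
Proof.
move=> xK; apply/asboolP/algebraic_over_KE.
by rewrite -[x]/(K_val (MkK xK)); apply: algebraic_id.
Qed.

Fact A_to_C_Kbar a : A_to_C a \in Kbar_pred.
Proof.
by apply/K_pred_Kbar/asboolP; exists a, 1; rewrite rmorph1 oner_neq0 divr1.
Qed.

Definition A_to_Kbar (a : {poly F}) : Kbar := MkKbar (A_to_C_Kbar a).

Fact A_to_Kbar_zmod_morphism : zmod_morphism A_to_Kbar.
Proof. by move=> a b; apply: val_inj; rewrite /= rmorphB. Qed.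
Fact A_to_Kbar_monoid_morphism : monoid_morphism A_to_Kbar.
Proof. by split=> [|a b]; apply: val_inj; rewrite /= ?rmorph1 ?rmorphM. Qed.
HB.instance Definition _ :=
  GRing.isZmodMorphism.Build {poly F} Kbar A_to_Kbar A_to_Kbar_zmod_morphism.
HB.instance Definition _ :=
  GRing.isMonoidMorphism.Build {poly F} Kbar A_to_Kbar A_to_Kbar_monoid_morphism.

(* [C] as a vector space over [K] and over [Kbar]. *)
Definition C_over_K : lmodType K := restrict_scalars (K_val : K -> C).
Definition C_over_Kbar : lmodType Kbar :=
  restrict_scalars (Kbar_val : Kbar -> C).

Definition C_mod_A : Type := Quotient.quot A_pred.
HB.instance Definition _ := GRing.Zmodule.on C_mod_A.

Definition mod_A (x : C) : C_mod_A := \pi_(Quotient.quot A_pred) x.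

Let scale (a : {poly F}) (X : C_mod_A) : C_mod_A :=
  mod_A (A_to_C a * repr (X : Quotient.quot A_pred)).

Fact mod_A_eq x y : mod_A x = mod_A y <-> x - y \in A_pred.
Proof. by rewrite Quotient.idealrBE; split=> /eqP. Qed.

Fact mod_A_D x y : mod_A (x + y) = mod_A x + mod_A y.
Proof. by rewrite /mod_A raddfD. Qed.

Fact mod_A_repr (X : C_mod_A) : mod_A (repr (X : Quotient.quot A_pred)) = X.
Proof. exact: reprK. Qed.

Fact mod_A_scale a x : mod_A (A_to_C a * x) = scale a (mod_A x).
Proof.
apply/mod_A_eq; rewrite -mulrBr.
have /mod_A_eq/asboolP[b ->] : mod_A x = mod_A (repr (mod_A x : Quotient.quot A_pred)).
  by rewrite mod_A_repr.
by apply/asboolP; exists (a * b); rewrite rmorphM.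
Qed.

Fact C_mod_A_scaleA a b X : scale a (scale b X) = scale (a * b) X.
Proof. by rewrite -[X]mod_A_repr -!mod_A_scale mulrA rmorphM. Qed.
Fact C_mod_A_scale1 : left_id 1 scale.
Proof. by move=> X; rewrite -[X]mod_A_repr -mod_A_scale rmorph1 mul1r. Qed.
Fact C_mod_A_scaleDr : right_distributive scale +%R.
Proof.
move=> a X Y; rewrite -[X]mod_A_repr -[Y]mod_A_repr.
by rewrite -mod_A_D -!mod_A_scale -mod_A_D mulrDr.
Qed.
Fact C_mod_A_scaleDl X : {morph scale^~ X : a b / a + b}.
Proof.
by move=> a b; rewrite -[X]mod_A_repr -!mod_A_scale -mod_A_D rmorphD mulrDl.
Qed.

HB.instance Definition _ := GRing.Zmodule_isLmodule.Build {poly F} C_mod_A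
  C_mod_A_scaleA C_mod_A_scale1 C_mod_A_scaleDr C_mod_A_scaleDl.

End Subfields.

Section TModule.
Variables (F : finFieldType) (R : realType) (C : Cinfty F R) (n : nat).

Definition t_matrix : 'M[Kbar C]_n :=
  \matrix_(i, j) (if j == i then A_to_Kbar C 'X
                  else if j == i.+1 :> nat then 1 else 0).

(* Column vectors over [Kbar], with the [F[t]]-module structure in which [t]
   acts by [t_matrix]. *)
Definition Vn : Type := 'cV[Kbar C]_n.
HB.instance Definition _ := GRing.Zmodule.on Vn.

Let t_act (v : Vn) : Vn := t_matrix *m v.

Let scale (a : {poly F}) (v : Vn) : Vn :=
  \sum_(i < size a) A_to_Kbar C (a`_i)%:P *: (iter i t_act v : 'cV_n).

Fact Vn_scale_wide N (a : {poly F}) v : (size a <= N)%N ->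
  scale a v = \sum_(i < N) A_to_Kbar C (a`_i)%:P *: (iter i t_act v : 'cV_n).
Proof.
move=> aN; rewrite /scale (big_ord_widen _
  (fun i => A_to_Kbar C (a`_i)%:P *: (iter i t_act v : 'cV_n)) aN).
rewrite big_mkcond /=; apply: eq_bigr => i _; case: ltnP => // ai.
by rewrite nth_default // rmorph0 scale0r.
Qed.

Fact Vn_scaleDl v : {morph scale^~ v : a b / a + b}.
Proof.
move=> a b; pose N := maxn (size a) (size b).
rewrite !(@Vn_scale_wide N) ?leq_maxl ?leq_maxr ?size_polyD //.
rewrite -big_split /=; apply: eq_bigr => i _.
by rewrite coefD !rmorphD scalerDl.
Qed.

Fact Vn_scaleDr : right_distributive scale +%R.
Proof.
move=> a v w; rewrite /scale -big_split /=; apply: eq_bigr => i _.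
rewrite -scalerDr; congr (_ *: _); elim: (i : nat) => //= k ->.
by rewrite /t_act mulmxDr.
Qed.

Fact Vn_scaleC c v : scale c%:P v = A_to_Kbar C c%:P *: (v : 'cV_n).
Proof.
rewrite (@Vn_scale_wide 1) ?size_polyC; last by case: (c != 0).
by rewrite big_ord1 coefC.
Qed.

Fact Vn_scale1 : left_id 1 scale.
Proof. by move=> v; rewrite -polyC1 Vn_scaleC rmorph1 scale1r. Qed.

Fact Vn_scaleMX (a : {poly F}) v : scale (a * 'X) v = scale a (t_act v).
Proof.
rewrite (@Vn_scale_wide (size a).+1 (a * 'X)); last first.
  by rewrite (leq_trans (size_polyMleq _ _)) // size_polyX addn2.
rewrite big_ord_recl coefMX /= rmorph0 scale0r add0r.
by apply: eq_bigr => i _; rewrite coefMX /= -iterSr.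
Qed.

Fact Vn_t_act_scale (a : {poly F}) v : t_act (scale a v) = scale a (t_act v).
Proof.
rewrite /t_act mulmx_sumr; apply: eq_bigr => i _.
by rewrite -scalemxAr; congr (_ *: _); rewrite -[LHS]iterS -iterSr.
Qed.

Fact Vn_scaleZ c (a : {poly F}) v :
  scale (c%:P * a) v = A_to_Kbar C c%:P *: (scale a v : 'cV_n).
Proof.
rewrite (@Vn_scale_wide (size a)); last first.
  by rewrite mul_polyC size_scale_leq.
rewrite scaler_sumr; apply: eq_bigr => i _.
by rewrite coefCM polyCM rmorphM scalerA.
Qed.

Fact Vn_scaleA a b v : scale a (scale b v) = scale (a * b) v.
Proof.
elim/poly_ind: a b v => [|a c IH] b v.
  by rewrite mul0r -[LHS]addr0 /scale size_poly0 !big_ord0 addr0.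
rewrite mulrDl !Vn_scaleDl Vn_scaleMX Vn_scaleC Vn_scaleZ; congr (_ + _).
by rewrite Vn_t_act_scale IH mulrAC Vn_scaleMX.
Qed.

HB.instance Definition _ := GRing.Zmodule_isLmodule.Build {poly F} Vn
  Vn_scaleA Vn_scale1 Vn_scaleDr Vn_scaleDl.

Definition last_entry (x : Kbar C) : Vn :=
  \col_(i < n) (if i.+1 == n then x else 0).

End TModule.

Section Polylogarithm.
Variables (F : finFieldType) (R : realType) (C : Cinfty F R).
Local Notation q := #|F|.

(* Formal power series over [C], as coefficient sequences. *)
Definition pseries : Type := nat -> C.

Definition ps_const (c : C) : pseries := fun i => if i == 0%N then c else 0.
Definition ps_mul (f g : pseries) : pseries :=
  fun k => \sum_(i < k.+1) f i * g (k - i)%N.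
Definition ps_exp (f : pseries) (m : nat) : pseries :=
  iter m (ps_mul f) (ps_const 1).
Definition ps_inv (f : pseries) : pseries :=
  xget (ps_const 0) [set g | ps_mul f g = ps_const 1].

Definition t_minus_theta : pseries :=
  fun i => if i == 0%N then - theta C else if i == 1%N then 1 else 0.

Definition tate : set pseries :=
  [set f | (fun i => abs C (f i)) @ \oo --> (0 : R)].
Definition tate_theta : set pseries :=
  [set f | (fun i => abs C (f i * theta C ^+ i)) @ \oo --> (0 : R)].

Definition q_root (x : C) : C := xget 0 [set y | y ^+ q = x].
Definition wp (f : pseries) : pseries := fun i => q_root (f i) - f i.

(* An element of T / F[t] is represented by the corresponding coset of F[t]
   in T: [wp^-1 g] is the whole fibre of [wp] over [g]. *)
Definition wp_inv (g : pseries) : set pseries := [set f | tate f /\ wp f = g].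

Definition L_class (n : nat) (u : C) : set pseries :=
  wp_inv (ps_mul (ps_const ((-1) ^+ n * u)) (ps_inv (ps_exp t_minus_theta n))).

Definition is_sum (a : nat -> C) (s : C) : Prop :=
  converges_to (abs C) (series a) s.

Definition eval_theta (f : pseries) : C :=
  xget 0 [set s | is_sum (fun i => f i * theta C ^+ i) s].

(* Two members of [L_class n u] differ by an element of F[t], whose value at
   [theta] lies in A: the choice of a representative is immaterial. *)
Definition Li (n : nat) (u : C) : C_mod_A C :=
  mod_A (eval_theta (xget (ps_const 0) (L_class n u `&` tate_theta))).

Definition Fq_linear (f : C -> C) : Prop :=
  forall (c : F) (x y : C),
    f (Fq_to_C C c * x + y) = Fq_to_C C c * f x + f y.

Definition is_lift (f : C -> C) (g : C -> C_mod_A C) : Prop :=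
  forall x, mod_A (f x) = g x.

End Polylogarithm.

(* Main.v *)
(** If the power series [g] satisfies [wp g = h / (t - theta)^n], then modulo
    [Kbar[t]] and [F[t]] the series [g] depends only on [h] modulo
    [(t - theta)^n], that is, on an element of [Kbar[t] / (t - theta)^n], which
    is [Vn].  The relation [theta^n = - \sum_(k >= 1) (...) t^k theta^(n-k)] in
    this quotient lowers absolute values, so [h] may be taken with coefficients
    of absolute value [< q^n]; then [g = \sum_(i >= 1) (h / (t - theta)^n)^(i)],
    where [^(i)] raises coefficients to the power [q^i].  Parts (1) and (3)
    follow.

    Part (2) requires [g(theta)] to be transcendental over [K] when [h(theta)]
    is nonzero, which is proved by Mahler's method.  Let [d] be the degree of a
    finite extension of [K] containing the coefficients of [h] and [g(theta)].
    Siegel's lemma over [F] gives polynomials [P_k] in [t], whose coefficients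
    have degree about [D] in [theta], such that all the coefficients of
    [E = \sum_(k <= kap) P_k g^k] are at most [q^-V], where [V / D] is as large
    as desired if [kap] is.  As [g] has infinitely many poles, [E <> 0], and
    [y_M = E^(M)(theta)] is nonzero for [M] large.  By the functional equation
    [y_M] is a polynomial in [g(theta)] and known algebraic numbers; its size is
    at most about [q^(- V q^M)] but, by Liouville's inequality, at least about
    [q^(- c D q^M)] with [c] depending only on [d], a contradiction. *)

Require Import Defs.
From HB Require Import structures.
From mathcomp Require Import all_boot all_order all_algebra.
From mathcomp Require Import all_fingroup all_solvable all_field.
From mathcomp Require Import ring zify.
From mathcomp Require Import boolp classical_sets reals topology normedtype.
From mathcomp Require Import sequences.

Set Implicit Arguments.
Unset Strict Implicit.
Unset Printing Implicit Defensive.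

Import Order.TTheory GRing.Theory Num.Theory.
Import numFieldNormedType.Exports.
Local Open Scope ring_scope.

(** In the usual form of Mahler's method the point of evaluation moves. Here a twist acts on the
    coefficients and leaves the point [theta] fixed, so the quantity to control is the largest
    coefficient of [E], not an order of vanishing. As the coefficients of [E] decay geometrically,
    only finitely many of them have to be forced down.

    The coefficients of [g] are Artin-Schreier roots and need not lie in one finite extension of
    [K], so a dimension count does not apply to them directly. It is run on the truncations of
    [\sum_(i >= 1) (h / (t - theta)^n)^(i)], whose coefficients do lie in one finite extension and
    which are as close to [g] as desired.

    Elements of [Kbar] may be inseparable over [K]. Heights are therefore read from matrices of
    multiplication with entries in [F[theta]] instead of conjugates, and Liouville's inequality
    rests on the fact that a nonzero determinant in [F[theta]] has absolute value at least 1. *)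

(** * Linear algebra over an integral domain *)

Lemma row_kernel (S : idomainType) (m k : nat) (M : 'M[S]_(m, k)) :
  (k < m)%N -> exists2 c : 'rV[S]_m, c != 0 & c *m M = 0.
Proof.
elim: k m M => [|k IH] m M km.
  case: m M km => [//|m] M _; exists (const_mx 1); last first.
    by apply/matrixP=> i; case.
  by apply/eqP => /matrixP/(_ 0 0)/eqP; rewrite !mxE oner_eq0.
case: (pickP (fun i => M i ord0 != 0)) => [i0 Mi0|M0]; last first.
  have [|c c0 cM] := IH m (\matrix_(i, j) M i (lift ord0 j)); first exact: ltnW.
  exists c => //; apply/matrixP => i j; rewrite !mxE.
  case: (unliftP ord0 j) => [j' ->|->].
    move/matrixP/(_ i j'): cM; rewrite !mxE => E; rewrite -[RHS]E.
    by apply: eq_bigr => l _; rewrite !mxE.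
  by rewrite big1 // => l _; move/negbFE/eqP: (M0 l) => ->; rewrite mulr0.
case: m M km i0 Mi0 => [//|m] M; rewrite ltnS => km i0 Mi0.
pose a := M i0 ord0.
(* Fraction-free elimination: every other row times the pivot [a], minus its first entry times the
   pivot row. *)
pose N := \matrix_(i < m, j < k)
  (a * M (lift i0 i) (lift ord0 j) - M (lift i0 i) ord0 * M i0 (lift ord0 j)).
have [c c0 cN] := IH m N km.
pose e := \row_j (if unlift i0 j is Some i then a * c 0 i
                  else - \sum_i c 0 i * M (lift i0 i) ord0).
have e_lift i : e 0 (lift i0 i) = a * c 0 i by rewrite mxE liftK.
have e_i0 : e 0 i0 = - \sum_i c 0 i * M (lift i0 i) ord0 by rewrite mxE unlift_none.
exists e.
  apply: contra_neq c0 => e0; apply/matrixP => i j; rewrite ord1 !mxE.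
  have /eqP := e_lift j; rewrite e0 mxE eq_sym mulf_eq0 (negPf Mi0) /=.
  by move/eqP.
apply/matrixP => i j; rewrite ord1 !mxE (bigD1_ord i0) //=.
under eq_bigr do rewrite e_lift.
rewrite e_i0; case: (unliftP ord0 j) => [j' ->|->].
  move/matrixP/(_ 0 j'): cN; rewrite !mxE => E; rewrite -[RHS]E.
  rewrite mulNr mulr_suml -sumrN -big_split /=; apply: eq_bigr => l _.
  by rewrite !mxE; ring.
rewrite mulNr mulr_suml -sumrN -big_split big1 //= => l _.
by rewrite /a; ring.
Qed.

Section LinearAlgebra.
Variables (S : idomainType) (M : lmodType S).
Implicit Types (s t : seq M) (a : S).

Lemma lin_spanP s (x : M) :
  lin_span s x <-> exists c : nat -> S, x = \sum_(i < size s) c i *: s`_i.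
Proof.
split=> [[c ->]|[c ->]]; last by exists (fun i => c i).
exists (fun i => if insub i is Some i' then c i' else 0).
by apply: eq_bigr => i _; rewrite valK.
Qed.

Lemma lin_span0 s : lin_span s 0.
Proof. by exists (fun=> 0); rewrite /lin_comb big1 // => i _; rewrite scale0r. Qed.

Lemma lin_spanD s x y : lin_span s x -> lin_span s y -> lin_span s (x + y).
Proof.
move=> [c ->] [d ->]; exists (fun i => c i + d i).
by rewrite /lin_comb -big_split /=; apply: eq_bigr => i _; rewrite scalerDl.
Qed.

Lemma lin_spanZ s a x : lin_span s x -> lin_span s (a *: x).
Proof.
move=> [c ->]; exists (fun i => a * c i).
by rewrite /lin_comb scaler_sumr; apply: eq_bigr => i _; rewrite scalerA.
Qed.

Lemma lin_span_sum s (I : Type) (r : seq I) (P : pred I) (f : I -> M) :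
  (forall i, P i -> lin_span s (f i)) -> lin_span s (\sum_(i <- r | P i) f i).
Proof.
by move=> Ps; apply: big_ind => //; [exact: lin_span0|exact: lin_spanD].
Qed.

Lemma mem_lin_span s (x : M) : x \in s -> lin_span s x.
Proof.
move=> xs; exists (fun i => (nat_of_ord i == index x s)%:R).
have ix : (index x s < size s)%N by rewrite index_mem.
rewrite /lin_comb (bigD1 (Ordinal ix)) //= eqxx scale1r nth_index // big1 ?addr0 //.
by move=> i /negPf ne; move: ne; rewrite -val_eqE /= => ->; rewrite scale0r.
Qed.

Lemma lin_span_sub s t x :
  {in s, forall y, lin_span t y} -> lin_span s x -> lin_span t x.
Proof.
move=> st [c ->]; apply: lin_span_sum => i _; apply: lin_spanZ.
by apply: st; apply: mem_nth.
Qed.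

Lemma lin_indep_size s t :
  {in s, forall x, lin_span t x} -> lin_indep s -> (size s <= size t)%N.
Proof.
move=> st ind; rewrite leqNgt; apply/negP => lt_ts.
have cP (i : 'I_(size s)) : exists c : 'I_(size t) -> S, s`_i = lin_comb c.
  by apply: st; rewrite mem_nth.
have [c cE] := choice cP.
have [e e0 eM] := row_kernel (\matrix_(i, j) c i j) lt_ts.
case/eqP: e0; apply/matrixP => i j; rewrite ord1 mxE.
apply: (ind (fun i => e 0 i)).
rewrite /lin_comb; under eq_bigr do rewrite cE /lin_comb scaler_sumr.
rewrite exchange_big big1 //= => k _.
move/matrixP/(_ 0 k): eM; rewrite !mxE => E; rewrite -[RHS](scale0r t`_k) -[in RHS]E.
rewrite scaler_suml; apply: eq_bigr => l _.
by rewrite scalerA mxE.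
Qed.

Lemma lin_indep_cons x s : lin_indep s ->
  (forall a, lin_span s (a *: x) -> a = 0) -> lin_indep (x :: s).
Proof.
move=> ind xs c /= cx.
pose d := fun i : 'I_(size s) => c (lift ord0 i).
have cx' : c ord0 *: x + lin_comb d = 0.
  by move: cx; rewrite /lin_comb big_ord_recl.
have c0 : c ord0 = 0.
  apply: xs; exists (fun i => - d i); apply/eqP.
  rewrite /lin_comb -subr_eq0 -sumrN; apply/eqP; rewrite -[RHS]cx'.
  by congr (_ + _); apply: eq_bigr => i _; rewrite scaleNr opprK.
move: cx'; rewrite c0 scale0r add0r => /ind dE i.
by case: (unliftP ord0 i) => [j ->|->]; [exact: dE|].
Qed.

(** Greedy choice: [x] is added exactly when no nonzero multiple of [f x] lies in the span so far.
    The subfamily is taken among the indices, so that the same [u'] can index vectors and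
    polylogarithm values alike. *)
Lemma max_indep (T : eqType) (f : T -> M) (u : seq T) :
  exists u' : seq T, [/\ {subset u' <= u}, lin_indep [seq f x | x <- u'] &
    {in u, forall x, exists2 a, a != 0 & lin_span [seq f y | y <- u'] (a *: f x)}].
Proof.
elim: u => [|x u [u' [u'u ind tor]]].
  by exists [::]; split=> // c _ [].
have [[a [a0 ax]]|nx] := pselect (exists a, a != 0 /\ lin_span [seq f y | y <- u'] (a *: f x)).
  exists u'; split=> // [y /u'u yu|y]; first by rewrite inE yu orbT.
  by rewrite inE => /predU1P[->|/tor//]; exists a.
exists (x :: u'); split.
- by move=> y; rewrite !inE => /predU1P[->|/u'u->]; rewrite ?eqxx ?orbT.
- rewrite map_cons; apply: lin_indep_cons => // a ax.
  by apply/eqP/negP => /negP a0; apply: nx; exists a.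
move=> y; rewrite inE => /predU1P[->|/tor[a a0 ay]].
  by exists 1; rewrite ?oner_eq0 // scale1r; apply: mem_lin_span; rewrite mem_head.
exists a => //; apply: lin_span_sub ay => z zu; apply: mem_lin_span.
by rewrite inE zu orbT.
Qed.

(** [P x] is stable under multiples, so the product of the individual multipliers serves all of [u];
    in the applications it is a common denominator. *)
Lemma common_multiplier (T : eqType) (P : T -> S -> Prop) (u : seq T) :
  (forall x a b, P x a -> P x (b * a)) ->
  {in u, forall x, exists2 a, a != 0 & P x a} ->
  exists2 a, a != 0 & {in u, forall x, P x a}.
Proof.
move=> PM; elim: u => [|x u IH] H; first by exists 1; rewrite ?oner_eq0.
have [y yu|a a0 aP] := IH; first by apply: H; rewrite inE yu orbT.
have [b b0 bP] := H x (mem_head _ _).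
exists (a * b); rewrite ?mulf_neq0 // => y; rewrite inE => /predU1P[->|yu].
  exact: PM.
by rewrite mulrC; apply: PM; apply: aP.
Qed.

(** One [a <> 0] carries the whole span of [s] into that of [t], and an independent family stays
    independent when multiplied by [a], so none has more than [size t] elements. *)
Lemma lin_rankE s t : {in t, forall x, lin_span s x} -> lin_indep t ->
  {in s, forall x, exists2 a, a != 0 & lin_span t (a *: x)} ->
  lin_rank (lin_span s) = size t.
Proof.
move=> ts ind tor.
have [a a0 aP] : exists2 a, a != 0 & {in s, forall x, lin_span t (a *: x)}.
  by apply: common_multiplier => // x a b; rewrite -scalerA; apply: lin_spanZ.
have aP' x : lin_span s x -> lin_span t (a *: x).
  move=> [c ->]; rewrite scaler_sumr; apply: lin_span_sum => i _.
  by rewrite scalerA mulrC -scalerA; apply: lin_spanZ; apply: aP; apply: mem_nth.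
have ub r : (exists s' : seq M,
    [/\ {in s', forall x, lin_span s x}, lin_indep s' & size s' = r]) -> (r <= size t)%N.
  move=> [s' [s's ind' <-]].
  rewrite -(size_map (fun x => a *: x)); apply: lin_indep_size.
    by move=> _ /mapP[x xs' ->]; apply: aP'; apply: s's.
  have szE := size_map (fun x => a *: x) s'.
  move=> c; rewrite /lin_comb => c0 i.
  have := ind' (fun j => a * c (cast_ord (esym szE) j)).
  have -> : lin_comb (fun j => a * c (cast_ord (esym szE) j)) = 0.
    rewrite /lin_comb -[RHS]c0 (reindex (cast_ord szE)) /=; last first.
      by exists (cast_ord (esym szE)) => ? _; apply: val_inj.
    apply: eq_bigr => j _; rewrite (nth_map 0) -?szE //.
    by rewrite mulrC -scalerA cast_ordK.
  move=> /(_ erefl (cast_ord szE i)) /eqP; rewrite cast_ordK mulf_eq0 (negPf a0) /=.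
  by move/eqP.
rewrite /lin_rank; case: xgetP => [r -> [rP rmax]|/(_ (size t))].
  by apply/eqP; rewrite eqn_leq ub // rmax //; exists t.
by case; split=> [|r]; [exists t|exact: ub].
Qed.

End LinearAlgebra.

Lemma lin_dimE (S : fieldType) (M : lmodType S) (s : seq M) :
  exists b, is_basis (lin_span s) b /\ lin_dim (lin_span s) = size b.
Proof.
have [b [bs ind tor]] := max_indep id s; rewrite map_id in ind tor.
have bas : is_basis (lin_span s) b.
  split=> //; apply/seteqP; split=> x; apply: lin_span_sub => y /=.
    by move/bs; apply: mem_lin_span.
  by move/tor=> [a a0 /(lin_spanZ a^-1)]; rewrite scalerA mulVf // scale1r.
exists b; split=> //; rewrite /lin_dim.
case: xgetP => [d -> [b' [[ind' sp'] <-]]|/(_ (size b))].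
  case: bas => _ sp; apply/eqP; rewrite eqn_leq !lin_indep_size //.
    by move=> x xb; rewrite sp' -sp; apply: mem_lin_span.
  by move=> x xb; rewrite sp -sp'; apply: mem_lin_span.
by case; exists b.
Qed.

(** * Formal power series, twists, and inverses of linear factors *)

Section PowerSeriesRing.
Variable S : comNzRingType.

(** [ps C] is convertible to [pseries], and its product to [ps_mul]; facts about the latter are
    obtained in this ring by conversion. *)
Definition ps : Type := nat -> S.
HB.instance Definition _ := gen_eqMixin ps.
HB.instance Definition _ := gen_choiceMixin ps.
Implicit Types f g h : ps.

Let add f g : ps := fun k => f k + g k.
Let opp f : ps := fun k => - f k.
Let zero : ps := fun=> 0.
Let one : ps := fun k => (k == 0%N)%:R.
Let mul f g : ps := fun k => \sum_(i < k.+1) f i * g (k - i)%N.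

Fact ps_addA : associative add.
Proof. by move=> f g h; apply/funext => k; rewrite /add addrA. Qed.
Fact ps_addC : commutative add.
Proof. by move=> f g; apply/funext => k; rewrite /add addrC. Qed.
Fact ps_add0 : left_id zero add.
Proof. by move=> f; apply/funext => k; rewrite /add add0r. Qed.
Fact ps_addN : left_inverse zero opp add.
Proof. by move=> f; apply/funext => k; rewrite /add addNr. Qed.
HB.instance Definition _ :=
  GRing.isZmodule.Build ps ps_addA ps_addC ps_add0 ps_addN.

Definition ps_trunc (N : nat) f : {poly S} := \poly_(i < N) f i.

(** A coefficient of index [k] involves only degrees up to [k], so associativity and commutativity
    are inherited from polynomials. *)
Fact ps_mul_trunc N f g k : (k < N)%N ->
  mul f g k = (ps_trunc N f * ps_trunc N g)`_k.
Proof.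
move=> kN; rewrite coefM; apply: eq_bigr => i _.
by rewrite !coef_poly !(leq_ltn_trans _ kN) ?leq_subr // -ltnS.
Qed.

Fact ps_mulA : associative mul.
Proof.
move=> f g h; apply/funext => k.
transitivity ((ps_trunc k.+1 f * (ps_trunc k.+1 g * ps_trunc k.+1 h))`_k).
  rewrite coefM -[LHS]/(\sum_(i < k.+1) f i * mul g h (k - i)%N).
  apply: eq_bigr => i _.
  by rewrite coef_poly ltn_ord (@ps_mul_trunc k.+1) // ltnS leq_subr.
rewrite mulrA coefM -[RHS]/(\sum_(i < k.+1) mul f g i * h (k - i)%N).
apply: eq_bigr => i _.
by rewrite [(ps_trunc _ h)`__]coef_poly ltnS leq_subr (@ps_mul_trunc k.+1).
Qed.

Fact ps_mulC : commutative mul.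
Proof.
by move=> f g; apply/funext => k; rewrite !(@ps_mul_trunc k.+1) // mulrC.
Qed.

Fact ps_mul1 : left_id one mul.
Proof.
move=> f; apply/funext => k; rewrite /mul big_ord_recl /one mul1r subn0.
by rewrite big1 ?addr0 // => i _; rewrite mul0r.
Qed.

Fact ps_mulDl : left_distributive mul add.
Proof.
move=> f g h; apply/funext => k; rewrite /mul /add -big_split.
by apply: eq_bigr => i _; rewrite mulrDl.
Qed.

Fact ps_one_neq0 : one != zero.
Proof.
by apply/eqP => /(congr1 (@^~ 0%N)) /eqP; rewrite /one /zero oner_eq0.
Qed.

HB.instance Definition _ := GRing.Zmodule_isComNzRing.Build ps
  ps_mulA ps_mulC ps_mul1 ps_mulDl ps_one_neq0.

Lemma psD f g k : (f + g) k = f k + g k. Proof. by []. Qed.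
Lemma psB f g k : (f - g) k = f k - g k. Proof. by []. Qed.
Lemma ps1 k : (1 : ps) k = (k == 0%N)%:R. Proof. by []. Qed.
Lemma psM f g k : (f * g) k = \sum_(i < k.+1) f i * g (k - i)%N.
Proof. by []. Qed.
Lemma ps_sum (I : Type) (r : seq I) (P : pred I) (F : I -> ps) k :
  (\sum_(i <- r | P i) F i) k = \sum_(i <- r | P i) F i k.
Proof. by elim/big_rec2: _ => // i x y _ <-. Qed.

Lemma ps_mulE N f g k : (k < N)%N ->
  (f * g) k = (ps_trunc N f * ps_trunc N g)`_k.
Proof. exact: ps_mul_trunc. Qed.

Definition poly_ps (p : {poly S}) : ps := fun i => p`_i.

Fact poly_ps_zmod_morphism : zmod_morphism poly_ps.
Proof. by move=> p r; apply/funext => k; rewrite /poly_ps coefB. Qed.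
Fact poly_ps_monoid_morphism : monoid_morphism poly_ps.
Proof.
split=> [|p r]; apply/funext => k; first by rewrite /poly_ps coef1.
by rewrite /poly_ps coefM.
Qed.
HB.instance Definition _ :=
  GRing.isZmodMorphism.Build {poly S} ps poly_ps poly_ps_zmod_morphism.
HB.instance Definition _ :=
  GRing.isMonoidMorphism.Build {poly S} ps poly_ps poly_ps_monoid_morphism.

Lemma ps_CM c f k : (poly_ps c%:P * f) k = c * f k.
Proof.
rewrite psM big_ord_recl subn0 /poly_ps coefC big1 ?addr0 // => i _.
by rewrite coefC mul0r.
Qed.

Lemma ps_XM f k : (poly_ps 'X * f) k = if k is k'.+1 then f k' else 0.
Proof.
case: k => [|k]; first by rewrite psM big_ord1 /poly_ps coefX mul0r.
rewrite psM 2!big_ord_recl /poly_ps !coefX mul0r add0r mul1r subn1 big1 ?addr0 //.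
by move=> i _; rewrite coefX mul0r.
Qed.

End PowerSeriesRing.

Arguments poly_ps {S}.

Section Twist.
Variables (S S' : comNzRingType) (phi : {rmorphism S -> S'}).

(** For [phi = frob M] this is the twist [^(M)]: coefficients are raised to the power [q ^ M] and
    [t] is fixed. *)
Definition ps_map (f : ps S) : ps S' := fun k => phi (f k).

Fact ps_map_zmod_morphism : zmod_morphism ps_map.
Proof. by move=> f g; apply/funext => k; rewrite /ps_map psB rmorphB. Qed.
Fact ps_map_monoid_morphism : monoid_morphism ps_map.
Proof.
split=> [|f g]; apply/funext => k.
  by rewrite /ps_map ps1 rmorph_nat.
by rewrite /ps_map psM rmorph_sum; apply: eq_bigr => i _; rewrite rmorphM.
Qed.
HB.instance Definition _ :=
  GRing.isZmodMorphism.Build (ps S) (ps S') ps_map ps_map_zmod_morphism.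
HB.instance Definition _ :=
  GRing.isMonoidMorphism.Build (ps S) (ps S') ps_map ps_map_monoid_morphism.

Lemma ps_map_poly p : ps_map (poly_ps p) = poly_ps (map_poly phi p).
Proof. by apply/funext => k; rewrite /ps_map /poly_ps coef_map. Qed.

End Twist.

Section InverseLinear.
Variable E : fieldType.

(* The expansion of [1 / (t - a)] at [t = 0]. *)
Definition inv_lin (a : E) : ps E := fun k => - a^-1 ^+ k.+1.

Lemma mul_inv_lin a : a != 0 -> poly_ps ('X - a%:P) * inv_lin a = 1.
Proof.
move=> a0; apply/funext => k; rewrite raddfB mulrBl psB ps_XM ps_CM ps1 /inv_lin.
case: k => [|k]; first by rewrite mulrN mulfV // sub0r opprK.
by rewrite mulrN opprK [in a * _]exprS mulrA mulfV // mul1r addNr.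
Qed.

Lemma mul_inv_linX a n : a != 0 ->
  poly_ps (('X - a%:P) ^+ n) * inv_lin a ^+ n = 1.
Proof. by move=> a0; rewrite rmorphXn -exprMn mul_inv_lin // expr1n. Qed.

Lemma inv_lin_map (phi : {rmorphism E -> E}) a :
  ps_map phi (inv_lin a) = inv_lin (phi a).
Proof.
by apply/funext => k; rewrite /ps_map /inv_lin rmorphN rmorphXn fmorphV.
Qed.

End InverseLinear.

(** * Growth and decay of real powers *)

Section RealPowers.
Variable R : realType.

Lemma expr_small (x e : R) : 0 <= x < 1 -> 0 < e ->
  exists N, forall m, (N <= m)%N -> x ^+ m < e.
Proof.
move=> /andP[x0 x1] e0.
have /cvgrPdist_lt/(_ e e0)[N _ NP] := @cvg_expr R x ltac:(by rewrite ger0_norm).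
by exists N => m /NP /=; rewrite sub0r normrN ger0_norm // exprn_ge0.
Qed.

Lemma expr_unbounded (x B : R) : 1 < x -> exists N, forall m, (N <= m)%N -> B < x ^+ m.
Proof.
move=> x1; have x0 := lt_trans ltr01 x1.
have y01 : 0 <= x^-1 < 1 by rewrite invr_ge0 ltW //= invf_lt1.
have B0 : 0 < Num.max 1 B by rewrite lt_max ltr01.
have B1 : 0 < (Num.max 1 B)^-1 by rewrite invr_gt0.
have [N NP] := expr_small y01 B1; exists N => m /NP.
rewrite exprVn ltf_pV2 ?posrE ?exprn_gt0 //; apply: le_lt_trans.
by rewrite le_max lexx orbT.
Qed.

End RealPowers.

(** * The valued field [C] and its Frobenius maps *)

Section Cinfty_field.
Variables (F : finFieldType) (R : realType) (C : Cinfty F R).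
Local Notation q := #|F|.
Local Notation Q := (#|F|%:R : R).
Local Notation N := (abs C).
Local Notation th := (theta C).
Local Notation iota := (Fq_to_C C).
Implicit Types x y z : C.

Let na := abs_na (CinftyP C).

Lemma q_gt1 : (1 < q)%N. Proof. exact: finNzRing_gt1. Qed.
Lemma q_gt0 : (0 < q)%N. Proof. exact: ltnW q_gt1. Qed.
Lemma Q_gt1 : 1 < Q. Proof. by rewrite ltr1n q_gt1. Qed.
Lemma Q_gt0 : 0 < Q. Proof. by rewrite ltr0n q_gt0. Qed.
Lemma QX_gt0 n : 0 < Q ^+ n. Proof. exact/exprn_gt0/Q_gt0. Qed.
Lemma QX_ge1 n : 1 <= Q ^+ n. Proof. exact/exprn_ege1/ltW/Q_gt1. Qed.
Lemma qX_gt0 M : (0 < q ^ M)%N. Proof. by rewrite expn_gt0 q_gt0. Qed.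
Lemma ler_QX m n : (m <= n)%N -> Q ^+ m <= Q ^+ n.
Proof. by move=> mn; apply: ler_weXn2l => //; apply/ltW/Q_gt1. Qed.

Lemma ltn_qX M : (M < q ^ M)%N.
Proof. exact: ltn_expl q_gt1. Qed.

Lemma cabs_ge0 x : 0 <= N x. Proof. exact: (abs_ge0 na). Qed.
Lemma cabs_eq0P x : N x = 0 <-> x = 0. Proof. exact: (abs_eq0 na). Qed.
Lemma cabs0 : N 0 = 0. Proof. exact/cabs_eq0P. Qed.
Lemma cabsM x y : N (x * y) = N x * N y. Proof. exact: (absM na). Qed.
Lemma cabs_gt0 x : (0 < N x) = (x != 0).
Proof.
rewrite lt_neqAle cabs_ge0 andbT eq_sym; congr (~~ _).
by apply/eqP/eqP => /cabs_eq0P.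
Qed.
Lemma cabs1 : N 1 = 1.
Proof.
have n1 : N 1 != 0 by rewrite gt_eqF // cabs_gt0 oner_eq0.
by apply: (mulfI n1); rewrite -cabsM !mulr1.
Qed.
Lemma cabsX x n : N (x ^+ n) = N x ^+ n.
Proof. by elim: n => [|n IH]; rewrite ?cabs1 // !exprS cabsM IH. Qed.
Lemma cabs_unity x n : (0 < n)%N -> x ^+ n = 1 -> N x = 1.
Proof.
move=> n0 xn; apply/eqP; rewrite -(@pexpr_eq1 _ (N x) n) ?cabs_ge0 //.
by rewrite -cabsX xn cabs1.
Qed.
Lemma cabsN x : N (- x) = N x.
Proof.
by rewrite -mulN1r cabsM (@cabs_unity _ 2) ?mul1r // sqrrN expr1n.
Qed.
Lemma cabsV x : N x^-1 = (N x)^-1.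
Proof.
have [->|x0] := eqVneq x 0; first by rewrite invr0 cabs0 invr0.
have Nx : N x != 0 by rewrite gt_eqF // cabs_gt0.
by apply: (mulfI Nx); rewrite -cabsM !mulfV // cabs1.
Qed.
Lemma cabsB x y : N (x - y) = N (y - x).
Proof. by rewrite -cabsN opprB. Qed.

Lemma cabsD_le B x y : N x <= B -> N y <= B -> N (x + y) <= B.
Proof.
by move=> xB yB; apply: (le_trans (absD na _ _)); rewrite ge_max xB.
Qed.
Lemma cabsD_lt B x y : N x < B -> N y < B -> N (x + y) < B.
Proof.
by move=> xB yB; apply: (le_lt_trans (absD na _ _)); rewrite gt_max xB.
Qed.
Lemma cabs_sum_le B (I : Type) (r : seq I) (P : pred I) (f : I -> C) : 0 <= B ->
  (forall i, P i -> N (f i) <= B) -> N (\sum_(i <- r | P i) f i) <= B.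
Proof.
by move=> B0 fB; elim/big_ind: _ => [|x y|//]; [rewrite cabs0|apply: cabsD_le].
Qed.
Lemma cabs_sum_lt B (I : Type) (r : seq I) (P : pred I) (f : I -> C) : 0 < B ->
  (forall i, P i -> N (f i) < B) -> N (\sum_(i <- r | P i) f i) < B.
Proof.
by move=> B0 fB; elim/big_ind: _ => [|x y|//]; [rewrite cabs0|apply: cabsD_lt].
Qed.
Lemma cabsD_eq x y : N y < N x -> N (x + y) = N x.
Proof.
move=> yx; apply/eqP; rewrite eq_le; apply/andP; split.
  by apply: cabsD_le => //; apply: ltW.
rewrite leNgt; apply/negP => xyx.
have := cabsD_lt xyx (_ : N (- y) < N x); rewrite cabsN addrK ltxx.
by move=> /(_ yx).
Qed.

Lemma cabs_Fq (c : F) : c != 0 -> N (iota c) = 1.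
Proof.
move=> c0; have q1 : (0 < q.-1)%N by rewrite -ltnS prednK ?q_gt1 ?q_gt0.
apply: (cabs_unity q1); rewrite -rmorphXn -[RHS](rmorph1 iota); congr (iota _).
by apply: (mulfI c0); rewrite -exprS prednK ?q_gt0 // expf_card mulr1.
Qed.
Lemma cabs_Fq_le (c : F) : N (iota c) <= 1.
Proof.
by have [->|/cabs_Fq->//] := eqVneq c 0; rewrite rmorph0 cabs0 ler01.
Qed.

Lemma cabs_th : N th = Q. Proof. exact: (abs_theta (CinftyP C)). Qed.
Lemma th_neq0 : th != 0. Proof. by rewrite -cabs_gt0 cabs_th Q_gt0. Qed.
Lemma cabs_thX m : N (th ^+ m) = Q ^+ m. Proof. by rewrite cabsX cabs_th. Qed.

Lemma A_to_CE (a : {poly F}) : A_to_C C a = \sum_(i < size a) iota a`_i * th ^+ i.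
Proof.
rewrite /A_to_C horner_coef size_map_poly.
by apply: eq_bigr => i _; rewrite coef_map.
Qed.
Lemma A_to_CC c : A_to_C C c%:P = iota c.
Proof. by rewrite /A_to_C map_polyC hornerC. Qed.
Lemma A_to_CX : A_to_C C 'X = th.
Proof. by rewrite /A_to_C map_polyX hornerX. Qed.

Lemma cabs_A (a : {poly F}) : a != 0 -> N (A_to_C C a) = Q ^+ (size a).-1.
Proof.
move=> a0; rewrite A_to_CE.
have : (0 < size a)%N by rewrite size_poly_gt0.
case E: (size a) => [//|s] _; rewrite big_ord_recr /= addrC.
have l0 : a`_s != 0 by have := a0; rewrite -lead_coef_eq0 lead_coefE E.
have top : N (iota a`_s * th ^+ s) = Q ^+ s by rewrite cabsM cabs_Fq // mul1r cabs_thX.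
rewrite cabsD_eq top //; apply: cabs_sum_lt => [|i _]; first exact: QX_gt0.
rewrite cabsM cabs_thX (@le_lt_trans _ _ (Q ^+ i)) //.
  by rewrite ler_piMl ?cabs_Fq_le ?exprn_ge0 ?ler0n.
by rewrite ltr_eXn2l ?Q_gt1.
Qed.
Lemma cabs_A_le (a : {poly F}) H : (size a <= H.+1)%N -> N (A_to_C C a) <= Q ^+ H.
Proof.
move=> aH; have [->|a0] := eqVneq a 0; first by rewrite rmorph0 cabs0 exprn_ge0 ?ler0n.
by rewrite cabs_A //; apply: ler_QX; case: (size a) aH.
Qed.
Lemma A_to_C_eq0 (a : {poly F}) : (A_to_C C a == 0) = (a == 0).
Proof.
apply/eqP/eqP => [|->]; last exact: rmorph0.
apply: contra_eq => a0; rewrite -cabs_gt0 cabs_A //; exact: QX_gt0.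
Qed.
Lemma cabs_A_ge1 (a : {poly F}) : a != 0 -> 1 <= N (A_to_C C a).
Proof. by move=> a0; rewrite cabs_A //; apply: QX_ge1. Qed.

(** The additive group of [F] is elementary abelian, so [q] is a power of the characteristic; this
    makes [frob] additive. *)
Lemma q_pchar : [pchar C].-nat q.
Proof.
have [p p_pr pF] := finPcharP F.
have pC : p \in [pchar C] by apply: rmorph_pchar iota _ pF.
have /abelem_pgroup := fin_ring_pchar_abelem pF; rewrite /pgroup cardsT.
by apply: sub_in_pnat => r _ /=; rewrite inE => /eqP ->.
Qed.
Lemma qX_pchar M : [pchar C].-nat (q ^ M)%N.
Proof. by rewrite pnatX q_pchar. Qed.

Definition frob (M : nat) (x : C) : C := x ^+ (q ^ M).

Fact frob_zmod_morphism M : zmod_morphism (frob M).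
Proof.
move=> x y; rewrite /frob exprDn_pchar ?qX_pchar //; congr (_ + _).
have /eqP := exprDn_pchar y (- y) (qX_pchar M).
by rewrite subrr expr0n gtn_eqF ?qX_gt0 // eq_sym addrC addr_eq0 => /eqP.
Qed.
Fact frob_monoid_morphism M : monoid_morphism (frob M).
Proof. by split=> [|x y]; rewrite /frob ?expr1n ?exprMn. Qed.
HB.instance Definition _ M :=
  GRing.isZmodMorphism.Build C C (frob M) (frob_zmod_morphism M).
HB.instance Definition _ M :=
  GRing.isMonoidMorphism.Build C C (frob M) (frob_monoid_morphism M).

Lemma frobE M x : frob M x = x ^+ (q ^ M). Proof. by []. Qed.
Lemma frob_inj M : injective (frob M). Proof. exact: fmorph_inj. Qed.
Lemma cabs_frob M x : N (frob M x) = N x ^+ (q ^ M). Proof. exact: cabsX. Qed.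
Lemma frobD M M' x : frob (M + M') x = frob M (frob M' x).
Proof. by rewrite !frobE -exprM expnD mulnC. Qed.
Lemma frob0 x : frob 0 x = x. Proof. exact: expr1. Qed.
Lemma frob1 x : frob 1 x = x ^+ q. Proof. by rewrite frobE expn1. Qed.
Lemma frob_Fq M c : frob M (iota c) = iota c.
Proof.
elim: M => [|M IH]; first exact: frob0.
by rewrite -addn1 frobD frob1 -rmorphXn expf_card.
Qed.

(** [X^q - X] is the product of the [X - c] over [c] in [F], and its image in [C] vanishes at
    [x]. *)
Lemma frob1_fixed x : x ^+ q = x -> exists c, x = iota c.
Proof.
move=> xq; have := congr1 (fun p => (map_poly iota p).[x]) (finField_genPoly F).
rewrite /= rmorphB /= map_polyXn map_polyX hornerD hornerN hornerXn hornerX xq subrr.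
rewrite rmorph_prod horner_prod => /esym/eqP/prodf_eq0[c _].
by rewrite /= map_polyXsubC hornerXsubC subr_eq0 => /eqP ->; exists c.
Qed.

Lemma q_root_uniq x y : y ^+ q = x -> q_root x = y.
Proof.
rewrite -frob1 => yx; apply: (@frob_inj 1); rewrite yx /q_root frob1.
by case: xgetP => [z -> //|/(_ y)]; rewrite /= -frob1.
Qed.

Lemma converges_toP (u : nat -> C) x :
  converges_to N u x <->
  forall e : R, 0 < e -> exists K, forall k, (K <= k)%N -> N (u k - x) < e.
Proof.
split=> [/cvgrPdist_lt H e e0|H].
  have [K _ KP] := H e e0; exists K => k /KP /=.
  by rewrite sub0r normrN ger0_norm ?cabs_ge0.
apply/cvgrPdist_lt => e /H[K KP]; exists K => // k /= /KP.
by rewrite sub0r normrN ger0_norm ?cabs_ge0.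
Qed.

Lemma cabs_small0 x : (forall e : R, 0 < e -> N x < e) -> x = 0.
Proof.
move=> H; apply/eqP; apply/negPn/negP; rewrite -cabs_gt0 => x0.
by have := H _ x0; rewrite ltxx.
Qed.

Lemma converges_to_uniq u x y :
  converges_to N u x -> converges_to N u y -> x = y.
Proof.
move=> /converges_toP ux /converges_toP uy; apply/eqP; rewrite -subr_eq0; apply/eqP.
apply: cabs_small0 => e e0; have [K1 H1] := ux e e0; have [K2 H2] := uy e e0.
have -> : x - y = (x - u (maxn K1 K2)) + (u (maxn K1 K2) - y) by ring.
by apply: cabsD_lt; rewrite ?H2 ?leq_maxr // cabsB H1 ?leq_maxl.
Qed.

Lemma converges_to_le u x B :
  converges_to N u x -> (forall k, N (u k) <= B) -> N x <= B.
Proof.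
move=> /converges_toP ux uB; rewrite leNgt; apply/negP => Bx.
have [K KP] : exists K, forall k, (K <= k)%N -> N (u k - x) < N x.
  by apply: ux; apply: le_lt_trans Bx; apply: le_trans (uB 0%N); apply: cabs_ge0.
have := KP K (leqnn K); rewrite cabsB.
have /cabsD_eq : N (- u K) < N x by rewrite cabsN (le_lt_trans (uB K)).
by move=> ->; rewrite ltxx.
Qed.

End Cinfty_field.

(** * Summation and evaluation of power series *)

Section Evaluation.
Variables (F : finFieldType) (R : realType) (C : Cinfty F R).
Local Notation q := #|F|.
Local Notation Q := (#|F|%:R : R).
Local Notation N := (abs C).
Local Notation th := (theta C).
Local Notation iota := (Fq_to_C C).
Implicit Types (x y s : C) (a b : nat -> C) (f g : ps C).

Definition tends0 (a : nat -> C) :=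
  forall e : R, 0 < e -> exists K, forall k, (K <= k)%N -> N (a k) < e.

Lemma is_sumP a s : is_sum a s <-> forall e : R, 0 < e ->
  exists K, forall m, (K <= m)%N -> N (\sum_(i < m) a i - s) < e.
Proof.
rewrite /is_sum; split=> [/converges_toP H e /H[K KP]|H].
  by exists K => m /KP; rewrite seriesEord.
by apply/converges_toP => e /H[K KP]; exists K => m /KP; rewrite seriesEord.
Qed.

Lemma is_sum_uniq a s s' : is_sum a s -> is_sum a s' -> s = s'.
Proof. exact: converges_to_uniq. Qed.

(** In an ultrametric field a block of terms is bounded by its largest one, so terms tending to 0
    already give a Cauchy sequence. *)
Lemma tends0_is_sum a : tends0 a -> exists s, is_sum a s.
Proof.
move=> a0; apply: (abs_complete (CinftyP C)) => e /a0[K KP].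
have H i j : (K <= i)%N -> (i <= j)%N -> N (series a j - series a i) < e.
  move=> Ki ij; rewrite !seriesEnat /= (@big_cat_nat _ _ _ i 0 j) //=.
  rewrite addrAC subrr add0r big_nat_cond.
  apply: cabs_sum_lt => [|k /andP[/andP[ik _] _]]; last exact/KP/(leq_trans Ki).
  by apply: le_lt_trans (KP K (leqnn K)); apply: cabs_ge0.
exists K => i j Ki Kj; have [ij|/ltnW ji] := leqP i j; last exact: H.
by rewrite cabsB; apply: H.
Qed.

Lemma is_sum_tends0 a s : is_sum a s -> tends0 a.
Proof.
move=> /is_sumP H e /H[K KP]; exists K => k Kk.
have -> : a k = (\sum_(i < k.+1) a i - s) - (\sum_(i < k) a i - s).
  by rewrite big_ord_recr /=; ring.
by apply: cabsD_lt; rewrite ?cabsN KP // (leq_trans Kk).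
Qed.

Lemma tends0_bounded a : tends0 a -> exists2 B, 0 < B & forall k, N (a k) <= B.
Proof.
move=> /(_ _ ltr01)[K KP].
exists (1 + \sum_(i < K) N (a i)).
  by rewrite ltr_pwDl ?ltr01 // sumr_ge0 // => i _; apply: cabs_ge0.
move=> k; have [Kk|kK] := leqP K k.
  by rewrite (le_trans (ltW (KP k Kk))) // lerDl sumr_ge0 // => i _; apply: cabs_ge0.
rewrite (bigD1 (Ordinal kK)) //= addrCA lerDl addr_ge0 ?ler01 //.
by rewrite sumr_ge0 // => i _; apply: cabs_ge0.
Qed.

Lemma is_sum_le a s B : is_sum a s -> (forall k, N (a k) <= B) -> N s <= B.
Proof.
move=> H aB; apply: (converges_to_le H) => k; rewrite seriesEord.
by apply: cabs_sum_le => //; apply: le_trans (aB 0%N); apply: cabs_ge0.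
Qed.

Lemma is_sum_finite a K : (forall k, (K <= k)%N -> a k = 0) ->
  is_sum a (\sum_(i < K) a i).
Proof.
move=> a0; apply/is_sumP => e e0; exists K => m Km.
rewrite -(big_mkord predT) -(big_mkord predT) (@big_cat_nat _ _ _ K 0 m) //=.
by rewrite addrAC subrr add0r big_nat big1 ?cabs0 // => i /andP[/a0].
Qed.

Lemma is_sumD a b s t : is_sum a s -> is_sum b t -> is_sum (fun k => a k + b k) (s + t).
Proof.
move=> /is_sumP H1 /is_sumP H2; apply/is_sumP => e e0.
have [K1 P1] := H1 e e0; have [K2 P2] := H2 e e0.
exists (maxn K1 K2) => m; rewrite geq_max => /andP[/P1 h1 /P2 h2].
by rewrite big_split /= opprD addrACA; apply: cabsD_lt.
Qed.

Lemma is_sum_frob M a s : is_sum a s -> is_sum (fun k => frob M (a k)) (frob M s).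
Proof.
move=> /is_sumP H; apply/is_sumP => e e0.
(* Below 1, raising to the power [q ^ M] does not increase the absolute value. *)
have e1 : 0 < Num.min e 1 by rewrite lt_min e0 ltr01.
have [K KP] := H _ e1; exists K => m /KP Hm.
rewrite -rmorph_sum -rmorphB cabs_frob.
have [h1 h2] : N (\sum_(i < m) a i - s) < e /\ N (\sum_(i < m) a i - s) < 1.
  by move: Hm; rewrite lt_min => /andP.
apply: le_lt_trans h1; rewrite -[leRHS]expr1; apply: ler_wiXn2l => //.
- exact: cabs_ge0.
- exact: ltW.
exact: qX_gt0.
Qed.

(** The truncations [al] and [be] are polynomials evaluated at 1. Their product differs from the
    partial sum of [f * g] by coefficients of index at least [m > 2 * K], where one of the two
    factors has index at least [K] and is small. *)
Lemma is_sum_psM (f g : ps C) s t : is_sum f s -> is_sum g t ->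
  is_sum (f * g : ps C) (s * t).
Proof.
move=> Hf Hg; apply/is_sumP => e e0.
have [B1 B10 fB] := tends0_bounded (is_sum_tends0 Hf).
have [B2 B20 gB] := tends0_bounded (is_sum_tends0 Hg).
pose B := B1 + B2; have B0 : 0 < B by rewrite addr_gt0.
have fB' k : N (f k) <= B by rewrite (le_trans (fB k)) // lerDl ltW.
have gB' k : N (g k) <= B by rewrite (le_trans (gB k)) // lerDr ltW.
have sB : N s <= B := is_sum_le Hf fB'.
have eB : 0 < e / B by rewrite divr_gt0.
have [K1 P1] := is_sum_tends0 Hf eB; have [K2 P2] := is_sum_tends0 Hg eB.
have /is_sumP/(_ _ eB)[K3 P3] := Hf; have /is_sumP/(_ _ eB)[K4 P4] := Hg.
pose K := (K1 + K2 + K3 + K4)%N.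
have small x y : N x < e / B -> N y <= B -> N (x * y) < e.
  move=> xe yB; rewrite cabsM; apply: (@le_lt_trans _ _ (N x * B)).
    by rewrite ler_wpM2l ?cabs_ge0.
  by rewrite -ltr_pdivlMr.
have small' x y : N x <= B -> N y < e / B -> N (x * y) < e.
  by move=> xB ye; rewrite mulrC; apply: small.
exists (K.*2).+1 => m Km; rewrite -(big_mkord predT).
pose al := ps_trunc m f; pose be := ps_trunc m g.
have alE : al.[1] = \sum_(i < m) f i.
  by rewrite horner_poly; apply: eq_bigr => i _; rewrite expr1n mulr1.
have beE : be.[1] = \sum_(i < m) g i.
  by rewrite horner_poly; apply: eq_bigr => i _; rewrite expr1n mulr1.
have prod_small k : (K.*2 <= k)%N -> N (al * be)`_k < e.
  move=> Kk; rewrite coefM; apply: cabs_sum_lt => // i _.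
  have trunc_le (h : ps C) D j : 0 <= D -> N (h j) <= D -> N (ps_trunc m h)`_j <= D.
    by move=> D0 hD; rewrite coef_poly; case: ifP => // _; rewrite cabs0.
  have trunc_lt (h : ps C) D j : 0 < D -> N (h j) < D -> N (ps_trunc m h)`_j < D.
    by move=> D0 hD; rewrite coef_poly; case: ifP => // _; rewrite cabs0.
  have [Ki|iK] := leqP K i.
    by apply: small; [apply: trunc_lt => //; apply: P1|apply: trunc_le => //; apply: ltW];
       rewrite /K in Ki; lia.
  apply: small'; [by apply: trunc_le => //; apply: ltW|apply: trunc_lt => //; apply: P2].
  by rewrite /K in Kk iK; lia.
have fgE : \sum_(0 <= i < m) (f * g : ps C) i = \sum_(0 <= i < m) (al * be)`_i.
  by rewrite big_nat [RHS]big_nat; apply: eq_bigr => i /andP[_ im]; rewrite (ps_mulE _ _ im).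
have abE : (al * be).[1] = \sum_(0 <= i < m + m) (al * be)`_i.
  rewrite (@horner_coef_wide _ (m + m)) ?big_mkord.
    by apply: eq_bigr => i _; rewrite expr1n mulr1.
  rewrite (leq_trans (size_polyMleq _ _)) // (@leq_trans (size al + size be)) ?leq_pred //.
  by rewrite leq_add ?size_poly.
have -> : \sum_(0 <= i < m) (f * g : ps C) i - s * t =
    - (\sum_(m <= i < m + m) (al * be)`_i) +
    ((\sum_(i < m) f i - s) * \sum_(i < m) g i + s * (\sum_(i < m) g i - t)).
  have : al.[1] * be.[1] = \sum_(0 <= i < m) (f * g : ps C) i +
      \sum_(m <= i < m + m) (al * be)`_i.
    by rewrite -hornerM abE fgE -big_cat_nat ?leq_addr.
  by rewrite alE beE => E; ring: E.
apply: cabsD_lt.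
  rewrite cabsN big_nat_cond; apply: cabs_sum_lt => // i /andP[/andP[mi _] _].
  by apply: prod_small; lia.
apply: cabsD_lt.
  apply: small; first by apply: P3; rewrite /K in Km; lia.
  by apply: cabs_sum_le => //; apply: ltW.
by apply: small' => //; apply: P4; rewrite /K in Km; lia.
Qed.

Definition evalto x f s := is_sum (fun j => f j * x ^+ j) s.

(** The substitution of [x t] for [t]: a ring homomorphism that reduces evaluation at [x] to
    summation. *)
Definition ps_dil x f : ps C := fun j => f j * x ^+ j.

Lemma ps_dilM x f g : ps_dil x (f * g) = ps_dil x f * ps_dil x g.
Proof.
apply/funext => k; rewrite /ps_dil !psM mulr_suml; apply: eq_bigr => i _.
have -> : x ^+ k = x ^+ i * x ^+ (k - i) by rewrite -exprD subnKC // -ltnS.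
by ring.
Qed.

Lemma evalto_uniq x f s s' : evalto x f s -> evalto x f s' -> s = s'.
Proof. exact: is_sum_uniq. Qed.

Lemma evaltoD x f g s t : evalto x f s -> evalto x g t -> evalto x (f + g) (s + t).
Proof.
move=> H1 H2; have := is_sumD H1 H2; rewrite /evalto; congr is_sum.
by apply/funext => k; rewrite psD mulrDl.
Qed.

Lemma evaltoM x f g s t : evalto x f s -> evalto x g t -> evalto x (f * g) (s * t).
Proof.
move=> H1 H2; rewrite /evalto -[X in is_sum X]/(ps_dil x (f * g)) ps_dilM.
exact: is_sum_psM.
Qed.

Lemma evalto_poly x p : evalto x (poly_ps p) p.[x].
Proof.
rewrite horner_coef; apply: (@is_sum_finite (fun k => p`_k * x ^+ k)) => k /(nth_default 0) ->.
exact: mul0r.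
Qed.

Lemma evalto0 x : evalto x 0 0.
Proof. by have := evalto_poly x 0; rewrite rmorph0 horner0. Qed.
Lemma evalto1 x : evalto x 1 1.
Proof. by have := evalto_poly x 1; rewrite rmorph1 hornerC. Qed.

Lemma evaltoN x f s : evalto x f s -> evalto x (- f) (- s).
Proof.
move=> /(evaltoM (evalto_poly x (-1))).
by rewrite rmorphN rmorph1 hornerN hornerC !mulN1r.
Qed.

Lemma evaltoB x f g s t : evalto x f s -> evalto x g t -> evalto x (f - g) (s - t).
Proof. by move=> H1 /evaltoN; apply: evaltoD. Qed.

Lemma evaltoX x f s k : evalto x f s -> evalto x (f ^+ k) (s ^+ k).
Proof.
by move=> H; elim: k => [|k IH]; [exact: evalto1|rewrite !exprS; apply: evaltoM].
Qed.

Lemma evalto_sum x (I : Type) (r : seq I) (P : pred I) (f : I -> ps C) (s : I -> C) :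
  (forall i, P i -> evalto x (f i) (s i)) ->
  evalto x (\sum_(i <- r | P i) f i) (\sum_(i <- r | P i) s i).
Proof. by move=> H; apply: big_ind2 => // [|*]; [exact: evalto0|exact: evaltoD]. Qed.

Lemma evalto_frob M x f s :
  evalto x f s -> evalto (frob M x) (ps_map (frob M) f) (frob M s).
Proof.
move=> /(is_sum_frob M); rewrite /evalto; congr is_sum.
by apply/funext => k; rewrite rmorphM rmorphXn.
Qed.

(** Only convergence needs an estimate; the value then follows by evaluating
    [(t - a) * inv_lin a = 1]. *)
Lemma evalto_inv_lin x (a : C) n : a != 0 -> N x < N a ->
  evalto x (inv_lin a ^+ n) ((x - a)^-1 ^+ n).
Proof.
move=> a0 xa; apply: evaltoX.
have lim0 : tends0 (fun j => inv_lin a j * x ^+ j).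
  move=> e e0; have Na : 0 < N a by rewrite cabs_gt0.
  have r01 : 0 <= N x / N a < 1.
    by rewrite divr_ge0 ?cabs_ge0 //= ltr_pdivrMr // mul1r.
  have [K KP] := expr_small r01 (mulr_gt0 e0 Na).
  exists K => k /KP; rewrite /inv_lin cabsM cabsN !cabsX cabsV => H.
  have -> : (N a)^-1 ^+ k.+1 * N x ^+ k = (N x / N a) ^+ k / N a.
    by rewrite exprS exprMn; ring.
  by rewrite ltr_pdivrMr.
have [s Hs] := tends0_is_sum lim0.
have := evaltoM (evalto_poly x ('X - a%:P)) Hs; rewrite mul_inv_lin //.
move=> /(evalto_uniq (evalto1 x)); rewrite hornerXsubC => E.
have xa0 : x - a != 0 by apply: contra_eq_neq E => ->; rewrite mul0r oner_eq0.
by rewrite -[(x - a)^-1]mulr1 E mulKf.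
Qed.

End Evaluation.

(** * The Artin-Schreier equation [z = (z + y)^q] *)

Section ArtinSchreier.
Variables (F : finFieldType) (R : realType) (C : Cinfty F R).
Local Notation q := #|F|.
Local Notation Q := (#|F|%:R : R).
Local Notation N := (abs C).
Local Notation th := (theta C).
Local Notation iota := (Fq_to_C C).
Implicit Types (x y z s : C) (f g Y : ps C).

(** For [|y| < 1] the series [\sum_(i >= 1) y^(q^i)] is the small solution of [z = (z + y)^q];
    outside this disc the value is the default 0. *)
Definition AS y : C := xget 0 [set z | is_sum (fun i => frob i.+1 y) z].

Lemma AS_sum y : N y < 1 -> is_sum (fun i => frob i.+1 y) (AS y).
Proof.
move=> y1; rewrite /AS; case: xgetP => [z -> //|].
have [|s Hs] := @tends0_is_sum _ _ _ (fun i => frob i.+1 y); last by move/(_ s).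
move=> e e0; have [K KP] := expr_small (R := R) (x := N y) ltac:(by rewrite cabs_ge0) e0.
exists K => k Kk; rewrite cabs_frob; apply: KP.
by rewrite (leq_trans Kk) // ltnW // (leq_trans _ (ltn_qX F k.+1)).
Qed.

Lemma AS_step y : N y < 1 -> AS y = frob 1 y + frob 1 (AS y).
Proof.
move=> /AS_sum H; apply: (is_sum_uniq H); rewrite -rmorphD.
apply/is_sumP => e e0; have /is_sumP/(_ e e0)[K KP] := is_sum_frob 1 H.
exists K.+1 => -[//|m] Km; rewrite big_ord_recl rmorphD opprD addrACA subrr add0r.
have := KP m Km; congr (N (_ - _) < e); apply: eq_bigr => i _.
exact: esym (frobD 1 i.+1 y).
Qed.

Lemma AS_le y : N y < 1 -> N (AS y) <= N y ^+ q.
Proof.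
move=> y1; apply: (is_sum_le (AS_sum y1)) => k; rewrite cabs_frob.
by apply: ler_wiXn2l; rewrite ?cabs_ge0 ?ltW // expnS leq_pmulr ?qX_gt0.
Qed.

(** Solved for [frob M (AS y)], this is the functional equation of Mahler's method. *)
Lemma AS_iter M y : N y < 1 ->
  AS y = frob M (AS y) + \sum_(i < M) frob i.+1 y.
Proof.
move=> y1; elim: M => [|M IH]; first by rewrite frob0 big_ord0 addr0.
rewrite big_ord_recr /= [LHS]IH {1}AS_step // rmorphD /= -!frobD addn1.
by ring.
Qed.

Lemma laurent_const (c : F) : iota c \in laurent_pred iota th N.
Proof.
apply/asboolP; exists 0%N, (fun i => if i is 0%N then c else 0).
have := @is_sum_finite _ _ C
  (fun i => iota (if i is 0%N then c else 0) * th ^+ 0 / th ^+ i) 1.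
rewrite big_ord1 expr0 mulr1 divr1; apply=> -[//|k] _.
by rewrite rmorph0 !mul0r.
Qed.

Lemma laurent_alg_const (c : F) : iota c \in laurent_alg_pred iota th N.
Proof.
apply/asboolP; exists ('X - (iota c)%:P).
rewrite polyXsubC_eq0 root_XsubC eqxx; split=> //.
apply/allP => x /(nthP 0)[i _ <-]; rewrite coefB coefX coefC.
case: i => [|[|i]] /=.
- by rewrite sub0r -rmorphN laurent_const.
- by rewrite subr0 -[X in X \in _](rmorph1 iota) laurent_const.
by rewrite subr0 -[X in X \in _](rmorph0 iota) laurent_const.
Qed.

Lemma laurent_alg_bool (b : bool) : b%:R \in laurent_alg_pred iota th N.
Proof. by rewrite -(rmorph_nat iota) laurent_alg_const. Qed.

(** Roots are available only for polynomials over the algebraic closure inside [C]. So [c] is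
    approximated by some [y] there with [|c - y| < 1]; a root of [X^q - X + y] handles [y], and the
    series [AS] handles [c - y]. *)
Lemma AS_surj c : exists z, z = frob 1 (z + c).
Proof.
have [y yL cy] := laurent_alg_dense (CinftyP C) c (ltr01 : 0 < 1 :> R).
have q1 := q_gt1 F.
pose p : {poly C} := 'X^q - 'X + y%:P.
have pE i : p`_i = (i == q)%:R - (i == 1%N)%:R + (if i == 0%N then y else 0).
  by rewrite coefD coefB coefXn coefX coefC.
have [| |x xL rx] := laurent_alg_closed (CinftyP C) (p := p).
- apply/allP => x /(nthP 0)[i _ <-]; rewrite pE.
  case: i => [|[|i]] /=; rewrite ?subr0 ?addr0.
  + by rewrite eq_sym (gtn_eqF (ltnW q1)) add0r.
  + by rewrite eq_sym (gtn_eqF q1) sub0r -(rmorph1 iota) -rmorphN laurent_alg_const.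
  exact: laurent_alg_bool.
- have : p`_q != 0 by rewrite pE eqxx !gtn_eqF ?(ltnW q1) // subr0 addr0 oner_eq0.
  by apply: contraNltn => sp; rewrite nth_default // (leq_trans sp) // ltnW.
have xq : x ^+ q = x - y.
  move: rx; rewrite rootE !hornerE => /eqP rx.
  by rewrite -[LHS]subr0 -rx; ring.
have zE := AS_step cy; set z := AS _ in zE.
exists (z + (x - y)).
have -> : z + (x - y) + c = z + (c - y) + x by ring.
transitivity (frob 1 z + frob 1 (c - y) + frob 1 x).
  by rewrite [in LHS]zE [frob 1 x]frob1 xq; ring.
by rewrite -!rmorphD.
Qed.

(** Approximations of [x] have roots [z k], and these converge because
    [|z i - z j|^q = |z i^q - z j^q|]. *)
Lemma perfect x : exists y, y ^+ q = x.
Proof.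
have q1 := q_gt1 F.
have root_alg y : y \in laurent_alg_pred iota th N -> exists z, frob 1 z = y.
  (* The sign is positive and the root is negated afterwards, so that only [y], not [- y], must lie
     in [laurent_alg_pred]. *)
  move=> yL; pose p : {poly C} := 'X^q + y%:P.
  have pE i : p`_i = (i == q)%:R + (if i == 0%N then y else 0).
    by rewrite coefD coefXn coefC.
  have [| |z zL rz] := laurent_alg_closed (CinftyP C) (p := p).
  - apply/allP => z /(nthP 0)[i _ <-]; rewrite pE.
    case: i => [|i] /=; first by rewrite eq_sym (gtn_eqF (ltnW q1)) add0r.
    by rewrite addr0 laurent_alg_bool.
  - have : p`_q != 0 by rewrite pE eqxx gtn_eqF ?(ltnW q1) // addr0 oner_eq0.
    by apply: contraNltn => sp; rewrite nth_default // (leq_trans sp) // ltnW.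
  exists (- z); move: rz; rewrite rootE !hornerE => /eqP rz.
  by rewrite rmorphN /= frob1 -[RHS]subr0 -rz; ring.
have qz k : exists z, N (x - frob 1 z) < (k.+1%:R)^-1.
  have k0 : 0 < (k.+1%:R)^-1 :> R by rewrite invr_gt0 ltr0n.
  have [y yL xy] := laurent_alg_dense (CinftyP C) x k0.
  by have [z zE] := root_alg y yL; exists z; rewrite zE.
have [z zP] := choice qz.
have inv_small (e : R) : 0 < e -> exists K, forall k, (K <= k)%N -> (k.+1%:R)^-1 < e.
  move=> e0; pose K := Num.bound e^-1; exists K => k Kk.
  have e1 : 0 < e^-1 by rewrite invr_gt0.
  rewrite -[e]invrK ltf_pV2 ?posrE ?ltr0n //.
  apply: lt_le_trans (archi_boundP (ltW e1)) _; rewrite ler_nat.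
  exact: leq_trans Kk (leqnSn _).
have zC : cauchy_sequence N z.
  move=> e e0; have [K KP] := inv_small (e ^+ q) (exprn_gt0 _ e0).
  exists K => i j Ki Kj; rewrite -(@ltr_pXn2r _ q) ?nnegrE ?cabs_ge0 ?ltW ?q_gt0 //.
  rewrite -cabsX -frob1 rmorphB.
  have -> : frob 1 (z i) - frob 1 (z j) = - (x - frob 1 (z i)) + (x - frob 1 (z j)) by ring.
  by apply: cabsD_lt; rewrite ?cabsN; apply: lt_trans (zP _) _; apply: KP.
have [y /converges_toP zy] := abs_complete (CinftyP C) zC.
exists y; apply/eqP; rewrite -frob1 -subr_eq0; apply/eqP; apply: cabs_small0 => e e0.
have e1 : 0 < Num.min e 1 by rewrite lt_min e0 ltr01.
have [K1 P1] := zy _ e1; have [K2 P2] := inv_small _ e0.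
pose k := maxn K1 K2.
have -> : frob 1 y - x = - frob 1 (z k - y) - (x - frob 1 (z k)) by rewrite rmorphB; ring.
apply: cabsD_lt; rewrite cabsN; last by apply: lt_trans (zP _) _; apply: P2; rewrite leq_maxr.
have := P1 k (leq_maxl _ _); rewrite lt_min => /andP[h1 h2].
rewrite cabs_frob; apply: le_lt_trans h1; rewrite -[leRHS]expr1.
by apply: ler_wiXn2l; rewrite ?cabs_ge0 ?ltW ?qX_gt0.
Qed.

Lemma q_rootK x : frob 1 (q_root x) = x.
Proof. by have [y yx] := perfect x; rewrite (q_root_uniq yx) frob1. Qed.

(* [sol Y f] says [wp f = Y], twisted once so that no q-th root appears. *)
Definition sol Y f : Prop := f = ps_map (frob 1) (f + Y).

Lemma wp_sol f Y : wp f = Y <-> sol Y f.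
Proof.
rewrite /sol; split=> [<-|E].
  by apply/funext => j; rewrite /ps_map psD /wp addrC subrK /= q_rootK.
apply/funext => j; rewrite /wp {1}E /ps_map psD.
by rewrite /= (@q_root_uniq _ _ _ _ (f j + Y j)) -?frob1 // addrC addKr.
Qed.

Lemma solD Y Z f g : sol Y f -> sol Z g -> sol (Y + Z) (f + g).
Proof. by move=> E1 E2; rewrite /sol {1}E1 {1}E2 -rmorphD addrACA. Qed.

Lemma sol0 : sol 0 0.
Proof. by rewrite /sol addr0 rmorph0. Qed.

Lemma sol_sum (I : Type) (r : seq I) (P : pred I) (Y f : I -> ps C) :
  (forall i, P i -> sol (Y i) (f i)) ->
  sol (\sum_(i <- r | P i) Y i) (\sum_(i <- r | P i) f i).
Proof. by move=> H; apply: big_ind2 => // [|*]; [exact: sol0|exact: solD]. Qed.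

(** Here the indeterminate of [{poly F}] stands for [t], whereas in [A_to_C] it stands for [theta];
    evaluation at [theta] links the two. *)
Definition A_ps (a : {poly F}) : ps C := poly_ps (map_poly iota a).

Lemma frob_A_ps M a : ps_map (frob M) (A_ps a) = A_ps a.
Proof.
rewrite /A_ps ps_map_poly -map_poly_comp; congr poly_ps.
by apply: eq_map_poly => c; rewrite /= frob_Fq.
Qed.

Lemma solMA a Y f : sol Y f -> sol (A_ps a * Y) (A_ps a * f).
Proof. by move=> E; rewrite /sol -mulrDr rmorphM /= frob_A_ps -E. Qed.

Lemma sol_fixed Y f g : sol Y f -> sol Y g -> forall j, exists c, f j - g j = iota c.
Proof.
move=> E1 E2 j; apply: frob1_fixed; rewrite -frob1 rmorphB.
have H (h : ps C) : sol Y h -> h j = frob 1 (h j) + frob 1 (Y j).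
  by move=> E; rewrite {1}E /ps_map psD rmorphD.
by rewrite [f j in RHS]H // [g j in RHS]H //; ring.
Qed.

(** The coefficients of [f - g] lie in [F]. Since [f - g] converges at [theta] and nonzero constants
    have absolute value 1, almost all of them vanish, and [f - g] belongs to [F[t]]. *)
Lemma sol_uniq Y f g s s' : sol Y f -> sol Y g ->
  evalto th f s -> evalto th g s' -> exists a, s - s' = A_to_C C a.
Proof.
move=> E1 E2 H1 H2; have [c cE] := choice (sol_fixed E1 E2).
have H := evaltoB H1 H2.
have [K KP] := is_sum_tends0 H ltr01.
exists (\poly_(i < K) c i).
apply: (evalto_uniq H).
have -> : f - g = A_ps (\poly_(i < K) c i).
  apply/funext => j; rewrite /A_ps /poly_ps coef_map coef_poly psB cE.
  case: ltnP => [//|Kj]; have := KP j Kj; rewrite psB cE cabsM cabs_thX.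
  have [-> //|/(cabs_Fq C)->] := eqVneq (c j) 0.
  by rewrite mul1r ltNge QX_ge1.
exact: evalto_poly.
Qed.

Lemma evalto_A a : evalto th (A_ps a) (A_to_C C a).
Proof. exact: evalto_poly. Qed.

End ArtinSchreier.

(** * Gauss norms of power series *)

Section WeightedBounds.
Variables (F : finFieldType) (R : realType) (C : Cinfty F R).
Local Notation q := #|F|.
Local Notation Q := (#|F|%:R : R).
Local Notation N := (abs C).
Local Notation th := (theta C).
Local Notation iota := (Fq_to_C C).
Implicit Types (x y z s : C) (f g Y : ps C) (r A B : R).

(** A bound for the Gauss norm on the disc [|t| <= r]. The radius 1 measures coefficients, and the
    radius [q = |theta|] governs values at [theta]. *)
Definition gauss_bd r A f := forall j, N (f j) * r ^+ j <= A.

Lemma gauss_bd_ge0 r A f : gauss_bd r A f -> 0 <= A.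
Proof. by move=> /(_ 0%N); rewrite mulr1; apply: le_trans; apply: cabs_ge0. Qed.

Lemma gauss_bdM r A B f g : 0 < r -> gauss_bd r A f -> gauss_bd r B g -> gauss_bd r (A * B) (f * g).
Proof.
move=> r0 fA gB k; have rk m : 0 < r ^+ m by apply: exprn_gt0.
rewrite -ler_pdivlMr // psM; apply: cabs_sum_le => [|i _].
  by rewrite divr_ge0 ?(ltW (rk k)) // mulr_ge0 ?(gauss_bd_ge0 fA) ?(gauss_bd_ge0 gB).
rewrite ler_pdivlMr // cabsM.
have -> : r ^+ k = r ^+ i * r ^+ (k - i) by rewrite -exprD subnKC // -ltnS.
rewrite mulrACA; apply: ler_pM; [| |exact: fA|exact: gB];
  by rewrite mulr_ge0 ?cabs_ge0 ?(ltW (rk _)).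
Qed.

Lemma gauss_bd1 r : gauss_bd r 1 1.
Proof.
move=> [|k]; first by rewrite ps1 cabs1 mulr1.
by rewrite ps1 cabs0 mul0r ler01.
Qed.

Lemma gauss_bdX r A f k : 0 < r -> gauss_bd r A f -> gauss_bd r (A ^+ k) (f ^+ k).
Proof.
move=> r0 fA; elim: k => [|k IH]; first exact: gauss_bd1.
by rewrite !exprS; apply: gauss_bdM.
Qed.

Lemma gauss_bd_sum r A (I : Type) (s : seq I) (P : pred I) (f : I -> ps C) :
  0 < r -> 0 <= A -> (forall i, P i -> gauss_bd r A (f i)) ->
  gauss_bd r A (\sum_(i <- s | P i) f i).
Proof.
move=> r0 A0 fA k; have rk : 0 < r ^+ k by apply: exprn_gt0.
rewrite -ler_pdivlMr // ps_sum; apply: cabs_sum_le => [|i Pi].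
  by rewrite divr_ge0 ?(ltW rk).
by rewrite ler_pdivlMr //; apply: fA.
Qed.

Lemma gauss_bd_le r A B f : A <= B -> gauss_bd r A f -> gauss_bd r B f.
Proof. by move=> AB fA k; apply: le_trans (fA k) AB. Qed.

Lemma gauss_bd_poly r (p : {poly C}) : 0 < r -> exists2 B, 0 < B & gauss_bd r B (poly_ps p).
Proof.
move=> r0; exists (1 + \sum_(i < size p) N p`_i * r ^+ i).
  by rewrite ltr_pwDl // sumr_ge0 // => i _; rewrite mulr_ge0 ?cabs_ge0 ?exprn_ge0 ?ltW.
have pos (P : pred 'I_(size p)) : 0 <= \sum_(i < size p | P i) N p`_i * r ^+ i.
  by rewrite sumr_ge0 // => i _; rewrite mulr_ge0 ?cabs_ge0 ?exprn_ge0 ?ltW.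
move=> k; rewrite /poly_ps; have [pk|kp] := leqP (size p) k.
  by rewrite nth_default // cabs0 mul0r addr_ge0 ?ler01 ?pos.
by rewrite (bigD1 (Ordinal kp)) //= addrCA lerDl addr_ge0 ?ler01 ?pos.
Qed.

Lemma gauss_bd_inv_lin (a : C) : a != 0 -> gauss_bd (N a) (N a)^-1 (inv_lin a).
Proof.
move=> a0 k; rewrite /inv_lin cabsN cabsX cabsV exprS -mulrA -exprMn mulVf ?expr1n ?mulr1 //.
by rewrite gt_eqF // cabs_gt0.
Qed.

Lemma gauss_bd_inv_linX (a : C) n : a != 0 -> gauss_bd (N a) ((N a)^-1 ^+ n) (inv_lin a ^+ n).
Proof. by move=> a0; apply: gauss_bdX; [rewrite cabs_gt0|apply: gauss_bd_inv_lin]. Qed.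

End WeightedBounds.

(** * Solutions for a small right-hand side *)

Section SmallSolutions.
Variables (F : finFieldType) (R : realType) (C : Cinfty F R).
Local Notation q := #|F|.
Local Notation Q := (#|F|%:R : R).
Local Notation N := (abs C).
Local Notation th := (theta C).
Local Notation iota := (Fq_to_C C).
Implicit Types (x y z s : C) (f g Y : ps C).

Lemma th_frob_neq0 M : frob M th != 0.
Proof. by rewrite expf_neq0 // th_neq0. Qed.

Lemma cabs_frob_th M : N (frob M th) = Q ^+ (q ^ M).
Proof. by rewrite cabs_frob cabs_th. Qed.

Lemma cabs_th_lt_frob i : N th < N (frob i.+1 th).
Proof.
rewrite cabs_frob_th cabs_th -[ltLHS]expr1 ltr_eXn2l ?Q_gt1 //.
by apply: leq_trans (ltn_qX F i.+1).
Qed.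

(** The expansion of [h / (t - theta)^n] at [t = 0]. *)
Definition quot_ps (h : {poly C}) n : ps C := poly_ps h * inv_lin th ^+ n.

Lemma quot_ps_frob M h n : ps_map (frob M) (quot_ps h n) =
  poly_ps (map_poly (frob M) h) * inv_lin (frob M th) ^+ n.
Proof. by rewrite rmorphM rmorphXn /= ps_map_poly inv_lin_map. Qed.

Lemma quot_ps_gauss_bd h n : exists2 B, 0 < B & gauss_bd Q B (quot_ps h n).
Proof.
have [B B0 hB] := gauss_bd_poly h (Q_gt0 F R).
exists (B * Q^-1 ^+ n); first by rewrite mulr_gt0 ?exprn_gt0 ?invr_gt0 ?Q_gt0.
by apply: gauss_bdM; rewrite ?Q_gt0 // -(cabs_th C); apply: gauss_bd_inv_linX; apply: th_neq0.
Qed.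

(** The value at [theta] of the first [M] twists of [h / (t - theta)^n]; subtracted from [g(theta)]
    it leaves [g^(M)(theta)]. *)
Definition partial_sum (h : {poly C}) n M : C :=
  \sum_(i < M) (map_poly (frob i.+1) h).[th] * (th - frob i.+1 th)^-1 ^+ n.

Definition AS_ps Y : ps C := fun j => AS (Y j).

Lemma sol_AS Y : (forall j, N (Y j) < 1) -> sol Y (AS_ps Y).
Proof.
move=> Y1; apply/funext => j; rewrite /ps_map psD /AS_ps rmorphD addrC.
exact: AS_step.
Qed.

Lemma AS_ps_le Y j : N (Y j) < 1 -> N (AS_ps Y j) <= N (Y j) ^+ 2.
Proof.
move=> Y1; apply: le_trans (AS_le Y1) _.
by apply: ler_wiXn2l; rewrite ?cabs_ge0 ?ltW ?q_gt1.
Qed.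

(** On [|t| = q] the series [Y] is merely bounded by [B]. As [AS] at least squares small absolute
    values, the terms of [AS_ps Y] at [theta] are at most [B^2 q^(-k)]. *)
Lemma AS_ps_eval Y : (forall j, N (Y j) < 1) -> (exists B, gauss_bd Q B Y) ->
  exists s, evalto th (AS_ps Y) s.
Proof.
move=> Y1 [B YB]; apply: tends0_is_sum => e e0.
have r01 : 0 <= Q^-1 < 1 by rewrite invr_ge0 ltW ?Q_gt0 //= invf_lt1 ?Q_gt1 ?Q_gt0.
have B2 : 0 < B ^+ 2 + 1 by rewrite ltr_wpDl ?exprn_ge0 // (gauss_bd_ge0 YB).
have [K KP] := expr_small r01 (divr_gt0 e0 B2).
exists K => k /KP; rewrite ltr_pdivlMr //; apply: le_lt_trans.
rewrite cabsM cabs_thX; apply: (@le_trans _ _ (Q^-1 ^+ k * B ^+ 2)); last first.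
  by rewrite ler_wpM2l ?lerDl ?ler01 // exprn_ge0 // invr_ge0 ltW ?Q_gt0.
apply: (@le_trans _ _ (N (Y k) ^+ 2 * Q ^+ k)).
  by rewrite ler_wpM2r ?AS_ps_le // ltW // QX_gt0.
have -> : N (Y k) ^+ 2 * Q ^+ k = Q^-1 ^+ k * (N (Y k) * Q ^+ k) ^+ 2.
  have Qk : Q ^+ k != 0 by rewrite gt_eqF // QX_gt0.
  by rewrite exprVn; field.
rewrite ler_wpM2l ?exprn_ge0 ?invr_ge0 ?ler0n // lerXn2r ?nnegrE //.
  by rewrite mulr_ge0 ?cabs_ge0 ?(ltW (QX_gt0 _ _ _)).
exact: gauss_bd_ge0 YB.
Qed.

Lemma AS_ps_frob Y M : (forall j, N (Y j) < 1) ->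
  ps_map (frob M) (AS_ps Y) = AS_ps Y - \sum_(i < M) ps_map (frob i.+1) Y.
Proof.
move=> Y1; apply/funext => j; rewrite psB ps_sum {2}/AS_ps (AS_iter M) // addrK.
by [].
Qed.

(** A twist moves the pole from [theta] to [theta^(q^(i+1))], outside the disc [|t| <= q]. *)
Lemma evalto_quot_frob h n i : evalto th (ps_map (frob i.+1) (quot_ps h n))
  ((map_poly (frob i.+1) h).[th] * (th - frob i.+1 th)^-1 ^+ n).
Proof.
rewrite quot_ps_frob; apply: evaltoM; first exact: evalto_poly.
by apply: evalto_inv_lin; [exact: th_frob_neq0|exact: cabs_th_lt_frob].
Qed.

Lemma evalto_AS_frob h n s M : (forall j, N (quot_ps h n j) < 1) ->
  evalto th (AS_ps (quot_ps h n)) s ->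
  evalto th (ps_map (frob M) (AS_ps (quot_ps h n))) (s - partial_sum h n M).
Proof.
move=> Y1 H; rewrite AS_ps_frob //; apply: evaltoB => //.
by apply: evalto_sum => i _; apply: evalto_quot_frob.
Qed.

Lemma quot_const_le x n j : N (quot_ps x%:P n j) * Q ^+ j <= N x * Q^-1 ^+ n.
Proof.
have H : gauss_bd Q (N x) (poly_ps x%:P).
  move=> [|k]; rewrite /poly_ps coefC ?mulr1 //=.
  by rewrite cabs0 mul0r cabs_ge0.
apply: gauss_bdM; rewrite ?Q_gt0 // -(cabs_th C).
by apply: gauss_bd_inv_linX; apply: th_neq0.
Qed.

Lemma quot_const_lt1 x n j : N x < Q ^+ n -> N (quot_ps x%:P n j) < 1.
Proof.
move=> xn; have := quot_const_le x n j; rewrite exprVn => H.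
apply: (@le_lt_trans _ _ (N x / Q ^+ n)); last by rewrite ltr_pdivrMr ?QX_gt0 ?mul1r.
by apply: le_trans H; rewrite ler_peMr ?cabs_ge0 ?QX_ge1.
Qed.

(** The remainder after [M] terms is [g^(M)(theta)], of absolute value at most [lam ^+ (q ^ M)]. The
    sign [(-1)^n] turns [theta - theta^(q^i)] into [theta^(q^i) - theta]. *)
Lemma kochubei_sum x n s : N x < Q ^+ n ->
  evalto th (AS_ps (quot_ps ((-1) ^+ n * x)%:P n)) s ->
  is_sum (fun i => x ^+ (q ^ i.+1) / (th ^+ (q ^ i.+1) - th) ^+ n) s.
Proof.
move=> xn; set y := (-1) ^+ n * x => H.
have yE : N y = N x by rewrite cabsM cabsX cabsN cabs1 expr1n mul1r.
have yn : N y < Q ^+ n by rewrite yE.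
have Y1 j := quot_const_lt1 j yn.
pose lam := N y / Q ^+ n.
have lam01 : 0 <= lam < 1.
  by rewrite divr_ge0 ?cabs_ge0 ?(ltW (QX_gt0 F R n)) //= ltr_pdivrMr ?QX_gt0 ?mul1r.
apply/is_sumP => e e0; have [K KP] := expr_small lam01 e0; exists K => M KM.
have termE i : x ^+ (q ^ i.+1) / (th ^+ (q ^ i.+1) - th) ^+ n =
    (map_poly (frob i.+1) y%:P).[th] * (th - frob i.+1 th)^-1 ^+ n.
  rewrite map_polyC hornerC /= /y rmorphM rmorphXn rmorphN rmorph1 mulrC [X in _ = X]mulrAC.
  by rewrite -exprMn mulN1r -invrN opprB exprVn mulrC.
under eq_bigr do rewrite termE.
rewrite cabsB -[\sum_(i < M) _]/(partial_sum y%:P n M).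
apply: le_lt_trans (KP (q ^ M)%N _); last by rewrite (leq_trans KM) // ltnW // ltn_qX.
apply: (is_sum_le (evalto_AS_frob M Y1 H)) => k.
rewrite cabsM cabs_thX /ps_map cabs_frob.
have yk : N (quot_ps y%:P n k) <= lam / Q ^+ k.
  by rewrite ler_pdivlMr ?QX_gt0 // /lam -exprVn quot_const_le.
have /andP[lam0 _] := lam01.
have Y0 := cabs_ge0 (quot_ps y%:P n k).
have gk : N (AS_ps (quot_ps y%:P n) k) <= lam / Q ^+ k.
  apply: le_trans (AS_ps_le (Y1 k)) _; rewrite expr2; apply: le_trans yk.
  by rewrite ler_piMr // ltW.
apply: (@le_trans _ _ ((lam / Q ^+ k) ^+ (q ^ M) * Q ^+ k)).
  rewrite ler_wpM2r ?(ltW (QX_gt0 F R k)) // lerXn2r ?nnegrE ?cabs_ge0 //.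
  by rewrite divr_ge0 ?(ltW (QX_gt0 F R k)).
rewrite exprMn -mulrA ler_piMr ?exprn_ge0 // -[X in _ * X <= _]expr1 exprVn.
rewrite mulrC ler_pdivrMr ?exprn_gt0 ?QX_gt0 ?Q_gt0 //.
by rewrite mul1r ler_weXn2l ?qX_gt0 ?QX_ge1.
Qed.

End SmallSolutions.

(** The binomial expansion of [(X - t)^n] solved for its last term [t^n]; it is applied with [X] the
    indeterminate and [t] the scalar [theta]. *)
Lemma expr_mod_lin (S : comNzRingType) (X t c : S) n :
  t ^+ n * c = (-1) ^+ n * ((X - t) ^+ n * c) -
    \sum_(i < n) (X ^+ (n - i) * (-1) ^+ (n + i) *+ 'C(n, i)) * (t ^+ i * c).
Proof.
rewrite exprDn big_ord_recr /= subnn expr0 mul1r binn mulr1n mulrDl mulrDr.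
rewrite addrAC [X in _ = _ + X]mulrA -[X in _ = _ + X * c]exprMn mulN1r opprK.
rewrite -[LHS]add0r; congr (_ + _).
apply/esym/eqP; rewrite subr_eq0 mulr_suml mulr_sumr; apply/eqP/eq_bigr => i _.
rewrite (exprNn t i) exprD !(mulrnAl, mulrnAr); congr (_ *+ _).
move: (X ^+ _) ((-1) ^+ n) ((-1) ^+ i) (t ^+ i) => Y s e d.
by ring.
Qed.

(** * Values of the polylogarithm through arbitrary solutions *)

Section PolylogarithmValues.
Variables (F : finFieldType) (R : realType) (C : Cinfty F R).
Local Notation q := #|F|.
Local Notation Q := (#|F|%:R : R).
Local Notation N := (abs C).
Local Notation th := (theta C).
Local Notation iota := (Fq_to_C C).
Implicit Types (x y z u s : C) (f g Y : ps C).

Lemma cvg_tends0 (a : nat -> C) :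
  ((fun i => N (a i)) @ \oo --> (0 : R))%classic <-> tends0 a.
Proof.
split=> [/cvgrPdist_lt H e e0|H].
  have [K _ KP] := H e e0; exists K => k /KP /=.
  by rewrite sub0r normrN ger0_norm ?cabs_ge0.
apply/cvgrPdist_lt => e /H[K KP]; exists K => // k /= /KP.
by rewrite sub0r normrN ger0_norm ?cabs_ge0.
Qed.

Lemma tate_thetaP f : tate_theta f <-> exists s, evalto th f s.
Proof.
split=> [/cvg_tends0/tends0_is_sum//|[s H]].
exact/cvg_tends0/(is_sum_tends0 H).
Qed.

Lemma evalto_tate f s : evalto th f s -> tate f.
Proof.
move=> /is_sum_tends0 H; apply/cvg_tends0 => e /H[K KP]; exists K => k /KP.
by apply: le_lt_trans; rewrite cabsM cabs_thX ler_peMr ?cabs_ge0 ?QX_ge1.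
Qed.

Lemma eval_thetaE f s : evalto th f s -> eval_theta f = s.
Proof.
move=> H; rewrite /eval_theta; case: xgetP => [s' -> H'|/(_ s)//].
exact: evalto_uniq H' H.
Qed.

Lemma ps_constE (c : C) : ps_const c = poly_ps c%:P.
Proof. by apply/funext => i; rewrite /poly_ps coefC. Qed.

Lemma ps_exp_t_minus_theta n :
  ps_exp (t_minus_theta C) n = poly_ps (('X - th%:P) ^+ n).
Proof.
have tE : t_minus_theta C = poly_ps ('X - th%:P).
  apply/funext => -[|[|i]]; rewrite /t_minus_theta /poly_ps coefB coefX coefC /=.
  - by rewrite sub0r.
  - by rewrite subr0.
  by rewrite subr0.
rewrite rmorphXn /= -tE; elim: n => [|n IH].
  by rewrite expr0 /ps_exp /= ps_constE rmorph1.
by rewrite exprS -IH.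
Qed.

(** [ps_inv] picks some inverse; inverses in a commutative ring are unique, so it is this one. *)
Lemma ps_inv_t_minus_theta n :
  ps_inv (ps_exp (t_minus_theta C) n) = inv_lin th ^+ n.
Proof.
have th0 := th_neq0 C.
have inv1 : poly_ps (('X - th%:P) ^+ n) * inv_lin th ^+ n = 1 := mul_inv_linX n th0.
rewrite ps_exp_t_minus_theta /ps_inv; case: xgetP => [g _ gE|/(_ (inv_lin th ^+ n))[]].
  have {}gE : poly_ps (('X - th%:P) ^+ n) * (g : ps C) = 1.
    by rewrite -[LHS]/(ps_mul _ _) gE ps_constE rmorph1.
  have -> : g = inv_lin th ^+ n * (poly_ps (('X - th%:P) ^+ n) * (g : ps C)).
    by rewrite mulrA [X in X * _]mulrC inv1 mul1r.
  by rewrite gE mulr1.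
by rewrite /= ps_constE rmorph1.
Qed.

Lemma L_classE n u f :
  L_class n u f <-> tate f /\ sol (quot_ps ((-1) ^+ n * u)%:P n) f.
Proof.
rewrite /L_class /wp_inv /= ps_inv_t_minus_theta ps_constE.
by rewrite -[ps_mul _ _]/(quot_ps _ _) wp_sol.
Qed.

(** [Li] evaluates one chosen representative. By [sol_uniq] every solution that converges at [theta]
    has the same value modulo [A]. *)
Lemma LiE n u f s : sol (quot_ps ((-1) ^+ n * u)%:P n) f -> evalto th f s ->
  Li n u = mod_A s.
Proof.
move=> E H; rewrite /Li; set g := xget _ _.
have [/L_classE[_ gE] /tate_thetaP[s' gs']] : (L_class n u `&` @tate_theta F R C)%classic g.
  apply: (@xgetPex _ _ (L_class n u `&` @tate_theta F R C)%classic); exists f; split.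
    by apply/L_classE; split=> //; apply: evalto_tate H.
  by apply/tate_thetaP; exists s.
rewrite (eval_thetaE gs'); apply/mod_A_eq/asboolP.
exact: sol_uniq gE E gs' H.
Qed.

Lemma mod_A_scaleE (a : {poly F}) x : a *: mod_A x = mod_A (A_to_C C a * x).
Proof. by symmetry; apply: mod_A_scale. Qed.

Lemma mod_A_sum (I : Type) (r : seq I) (f : I -> C) :
  mod_A (\sum_(i <- r) f i) = \sum_(i <- r) mod_A (f i).
Proof.
by elim/big_rec2: _ => [|i x y _ <-]; [exact: raddf0|rewrite mod_A_D].
Qed.

End PolylogarithmValues.

(** * Algebraic solutions and reduction modulo [(t - theta)^n] *)

Section AlgebraicSolutions.
Variables (F : finFieldType) (R : realType) (C : Cinfty F R).
Local Notation q := #|F|.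
Local Notation Q := (#|F|%:R : R).
Local Notation N := (abs C).
Local Notation th := (theta C).
Local Notation iota := (Fq_to_C C).
Local Notation Kb := (Kbar C).
Local Notation vK := (@Kbar_val F R C).
Local Notation mapK := (map_poly (@Kbar_val F R C)).

Lemma Kbar_algebraic (x : C) : x \in @Kbar_pred F R C <->
  algebraicOver (@K_val F R C) x.
Proof. by rewrite -algebraic_over_KE; split=> [/asboolP|] // ?; apply/asboolP. Qed.

(** Transitivity of algebraicity, obtained from that of integrality. *)
Lemma Kbar_root (p : {poly C}) x : p != 0 -> (forall i, p`_i \in @Kbar_pred F R C) ->
  root p x -> x \in @Kbar_pred F R C.
Proof.
move=> p0 pK rx; apply/Kbar_algebraic/integral_algebraic.
apply: integral_root p0 rx _ => y /(nthP 0)[i _ <-].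
exact/integral_algebraic/Kbar_algebraic.
Qed.

Lemma AS_Kbar (c : Kb) : exists z : Kb, vK z = frob 1 (vK (z + c)).
Proof.
have [z zE] := AS_surj (vK c); have q1 := q_gt1 F.
have zK : z \in @Kbar_pred F R C.
  pose p : {poly C} := 'X^q - 'X + (frob 1 (vK c))%:P.
  have pE i : p`_i = (i == q)%:R - (i == 1%N)%:R + (if i == 0%N then frob 1 (vK c) else 0).
    by rewrite coefD coefB coefXn coefX coefC.
  apply: (@Kbar_root p).
  - apply/eqP => p0; have := pE q; rewrite p0 coef0 eqxx !gtn_eqF ?(ltnW q1) //.
    by rewrite subr0 addr0 => /eqP; rewrite eq_sym oner_eq0.
  - move=> i; rewrite pE rpredD ?rpredB ?rpredMn ?rpred1 //.
    by case: ifP => _; rewrite ?rpred0 // rpredX // Kbar_valP.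
  have E : z = frob 1 z + frob 1 (vK c) by rewrite {1}zE rmorphD.
  by rewrite rootE !hornerE -frob1 addrAC -E subrr.
by exists (MkKbar zK); apply: etrans zE _; congr (frob 1 _).
Qed.

(** Multiples of [(t - theta)^n] leave a polynomial right-hand side; their solutions are polynomials
    over [Kbar] and contribute only elements of [Kbar] at [theta]. *)
Lemma poly_sol (p : {poly Kb}) :
  exists z : {poly Kb}, sol (poly_ps (mapK p)) (poly_ps (mapK z)).
Proof.
have [z zP] := choice AS_Kbar.
(* The truncation matters: the root chosen for the coefficient 0 may be any element of [F]. *)
exists (\poly_(i < size p) z p`_i); apply/funext => i.
rewrite /ps_map psD /poly_ps !coef_map coef_poly /=.
case: ltnP => ip; first by rewrite {1}zP.
by rewrite (nth_default 0 ip) /= addr0 [RHS](rmorph0 (frob 1)).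
Qed.

Definition thK : Kb := A_to_Kbar C 'X.
Lemma thKE : vK thK = th. Proof. by rewrite /= A_to_CX. Qed.

Definition iotaK (c : F) : Kb := A_to_Kbar C c%:P.
Fact iotaK_zmod_morphism : zmod_morphism iotaK.
Proof. by move=> a b; rewrite /iotaK polyCB rmorphB. Qed.
Fact iotaK_monoid_morphism : monoid_morphism iotaK.
Proof. by split=> [|a b]; rewrite /iotaK ?polyC1 ?rmorph1 // polyCM rmorphM. Qed.
HB.instance Definition _ := GRing.isZmodMorphism.Build F Kb iotaK iotaK_zmod_morphism.
HB.instance Definition _ := GRing.isMonoidMorphism.Build F Kb iotaK iotaK_monoid_morphism.

Lemma iotaKE c : vK (iotaK c) = iota c. Proof. exact: A_to_CC. Qed.

Lemma mapK_iotaK (a : {poly F}) : mapK (map_poly iotaK a) = map_poly iota a.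
Proof. by rewrite -map_poly_comp; apply: eq_map_poly => c; apply: iotaKE. Qed.

Definition lin_th n : {poly Kb} := ('X - thK%:P) ^+ n.
Lemma mapK_lin_th n : mapK (lin_th n) = ('X - th%:P) ^+ n.
Proof. by rewrite rmorphXn /= map_polyXsubC /= -/thK A_to_CX. Qed.

Lemma quot_ps_lin_th (p : {poly Kb}) n :
  quot_ps (mapK (lin_th n * p)) n = poly_ps (mapK p).
Proof.
rewrite /quot_ps rmorphM /= mapK_lin_th rmorphM mulrAC.
by rewrite (mul_inv_linX n (th_neq0 C)) mul1r.
Qed.

(** Modulo [(t - theta)^n], [h] is a combination over [F[t]] of constants of absolute value below
    [q^n]. *)
Definition reducible n (h : {poly Kb}) : Prop :=
  exists (s : seq ({poly F} * Kb)) (p : {poly Kb}),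
    (forall af, af \in s -> N (vK af.2) < Q ^+ n) /\
    h = \sum_(af <- s) map_poly iotaK af.1 * af.2%:P + lin_th n * p.

Lemma reducibleD n h h' : reducible n h -> reducible n h' -> reducible n (h + h').
Proof.
move=> [s [p [sn ->]]] [s' [p' [s'n ->]]]; exists (s ++ s'), (p + p'); split.
  by move=> af; rewrite mem_cat => /orP[/sn|/s'n].
by rewrite big_cat /= mulrDr addrACA.
Qed.

Lemma reducible_lin_th n p : reducible n (lin_th n * p).
Proof. by exists [::], p; split=> //; rewrite big_nil add0r. Qed.

Lemma reducible_sum n (I : Type) (r : seq I) (P : pred I) (h : I -> {poly Kb}) :
  (forall i, P i -> reducible n (h i)) -> reducible n (\sum_(i <- r | P i) h i).
Proof.
move=> H; elim/big_ind: _ => [|h1 h2|//]; last exact: reducibleD.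
by have := reducible_lin_th n 0; rewrite mulr0.
Qed.

Lemma reducibleMA n a h : reducible n h -> reducible n (map_poly iotaK a * h).
Proof.
move=> [s [p [sn ->]]]; exists [seq (a * af.1, af.2) | af <- s], (map_poly iotaK a * p).
split=> [_ /mapP[af /sn afn ->] //|].
rewrite big_map mulrDr [in RHS]mulrCA; congr (_ + _); rewrite mulr_sumr.
by apply: eq_bigr => af _; rewrite rmorphM mulrA.
Qed.

(* [(t - theta)^n = 0] expresses [theta^n] through [t^k theta^(n-k)], [k >= 1],
   which divides the absolute value by at least [q]. *)
Lemma reducible_const n x : reducible n x%:P.
Proof.
have [k xk] : exists k, N (vK x) < Q ^+ (n + k).
  have [k kP] := expr_unbounded (N (vK x)) (Q_gt1 F R).
  by exists k; apply: kP; rewrite leq_addl.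
elim: k x xk => [|k IH] x xk.
  exists [:: (1, x)], 0; rewrite addn0 in xk; split.
    by move=> af; rewrite inE => /eqP ->.
  by rewrite big_seq1 rmorph1 mul1r mulr0 addr0.
pose c := x / thK ^+ n.
have thK0 : thK != 0 by rewrite -(inj_eq val_inj) [val thK]thKE rmorph0 th_neq0.
have xE : x%:P = (-1) ^+ n * (lin_th n * c%:P) -
    \sum_(i < n) map_poly iotaK ('X ^+ (n - i) * (-1) ^+ (n + i) *+ 'C(n, i)) *
      (thK ^+ i * c)%:P.
  have -> : x%:P = thK%:P ^+ n * c%:P.
    by rewrite -polyC_exp -polyCM /c mulrCA mulfV ?mulr1 // expf_neq0.
  rewrite (expr_mod_lin 'X); congr (_ - _); apply: eq_bigr => i _.
  rewrite (polyCM (thK ^+ i)) (polyC_exp i thK); congr (_ * _).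
  by rewrite rmorphMn rmorphM !rmorphXn rmorphN rmorph1 /= map_polyX.
rewrite xE; apply: reducibleD.
  rewrite mulrCA; apply: reducible_lin_th.
rewrite -sumrN; apply: reducible_sum => i _; rewrite -mulNr -rmorphN.
apply: reducibleMA; apply: IH.
rewrite /c rmorphM rmorphXn rmorphM fmorphV rmorphXn /= A_to_CX !cabsM cabsV !cabs_thX.
rewrite mulrA ltr_pdivrMr ?QX_gt0 // mulrC -ltr_pdivlMr ?QX_gt0 //.
apply: lt_le_trans xk _; rewrite ler_pdivlMr ?QX_gt0 // -!exprD ler_QX //.
by have := ltn_ord i; lia.
Qed.

End AlgebraicSolutions.

(** * Expansion in convergent polylogarithms, and existence of solutions *)

Section FirstPart.
Variables (F : finFieldType) (R : realType) (C : Cinfty F R).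
Local Notation q := #|F|.
Local Notation Q := (#|F|%:R : R).
Local Notation N := (abs C).
Local Notation th := (theta C).
Local Notation iota := (Fq_to_C C).
Local Notation Kb := (Kbar C).
Local Notation vK := (@Kbar_val F R C).
Local Notation mapK := (map_poly (@Kbar_val F R C)).

Lemma reducible_all n (h : {poly Kb}) : reducible n h.
Proof.
rewrite -[h]coefK poly_def; apply: reducible_sum => i _.
rewrite -mul_polyC mulrC; have -> : 'X^i = map_poly (@iotaK F R C) 'X^i.
  by rewrite map_polyXn.
by apply: reducibleMA; apply: reducible_const.
Qed.

Lemma sol_small n (x : C) : N x < Q ^+ n -> exists g s,
  [/\ sol (quot_ps ((-1) ^+ n * x)%:P n) g, evalto th g s &
      is_sum (fun i => x ^+ (q ^ i.+1) / (th ^+ (q ^ i.+1) - th) ^+ n) s].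
Proof.
move=> xn; set Y := quot_ps _ _.
have yn : N ((-1) ^+ n * x) < Q ^+ n by rewrite cabsM cabsX cabsN cabs1 expr1n mul1r.
have Y1 j : N (Y j) < 1 by apply: quot_const_lt1.
have [B _ YB] := quot_ps_gauss_bd ((-1) ^+ n * x)%:P n.
have [s Hs] := AS_ps_eval Y1 (ex_intro _ B YB).
exists (AS_ps Y), s; split=> //; first exact: sol_AS.
exact: kochubei_sum xn Hs.
Qed.

Lemma mapK_horner (p : {poly Kb}) : (mapK p).[th] = vK p.[thK C].
Proof. by rewrite -(thKE C) horner_map. Qed.

Lemma quot_psD (h h' : {poly C}) n : quot_ps (h + h') n = quot_ps h n + quot_ps h' n.
Proof. by rewrite /quot_ps rmorphD mulrDl. Qed.

Lemma quot_psMA a (h : {poly C}) n :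
  quot_ps (map_poly iota a * h) n = A_ps C a * quot_ps h n.
Proof. by rewrite /quot_ps rmorphM mulrA. Qed.

Lemma quot_ps_sum (I : Type) (r : seq I) (P : pred I) (h : I -> {poly C}) n :
  quot_ps (\sum_(i <- r | P i) h i) n = \sum_(i <- r | P i) quot_ps (h i) n.
Proof. by rewrite /quot_ps rmorph_sum mulr_suml. Qed.

(** The decomposition of the constant polynomial [x] is carried over to solutions: each small [f j]
    gives a Kochubei series, and the multiple of [(t - theta)^n] gives a polynomial solution whose
    value at [theta] is [c]. *)
Theorem Li_small_expansion n (x : Kb) :
  exists (m : nat) (c : Kb) (a : 'I_m -> {poly F}) (f : 'I_m -> Kb) (s : 'I_m -> C),
    [/\ (0 < m)%N,
        forall j, N (vK (f j)) < Q ^+ n,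
        forall j, is_sum (fun i => vK (f j) ^+ (q ^ i.+1)
                    / (th ^+ (q ^ i.+1) - th) ^+ n) (s j),
        Li n (vK x) = mod_A (vK c) + \sum_(j < m) a j *: Li n (vK (f j))
      & Li n (vK x) = mod_A (vK c) + \sum_(j < m) a j *: mod_A (s j)].
Proof.
have [r [p [rn xE]]] := reducible_all n x%:P.
(* The added zero pair makes [m] positive even if [r] is empty. *)
pose r' := (0, 0) :: r; pose m := size r'.
pose a (j : 'I_m) := (r'`_j).1; pose f (j : 'I_m) := (r'`_j).2.
have fn j : N (vK (f j)) < Q ^+ n.
  have : r'`_j \in r' by apply: mem_nth.
  rewrite /f inE => /predU1P[->|/rn//].
  by rewrite (rmorph0 vK) cabs0 QX_gt0.
have {}xE : x%:P = \sum_(j < m) map_poly (@iotaK F R C) (a j) * (f j)%:P + lin_th C n * p.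
  rewrite xE; congr (_ + _).
  rewrite /m /= big_ord_recl /a /f /= map_poly0 mul0r add0r.
  by rewrite (big_nth 0) big_mkord.
have [g gP] := choice (fun j => sol_small (fn j)).
have [s {}gP] := choice gP.
have [z zE] := poly_sol ((-1) ^+ n * p).
pose G := \sum_(j < m) A_ps C (a j) * g j + poly_ps (mapK z).
have GE : sol (quot_ps ((-1) ^+ n * vK x)%:P n) G.
  have -> : quot_ps ((-1) ^+ n * vK x)%:P n =
      \sum_(j < m) A_ps C (a j) * quot_ps ((-1) ^+ n * vK (f j))%:P n
      + poly_ps (mapK ((-1) ^+ n * p)).
    have -> : ((-1) ^+ n * vK x)%:P = (-1) ^+ n * mapK x%:P.
      by rewrite map_polyC polyCM polyC_exp polyCN.
    rewrite xE rmorphD mulrDr quot_psD; congr (_ + _); last first.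
      rewrite -(quot_ps_lin_th _ n); congr (quot_ps _ _).
      by rewrite !rmorphM !rmorphXn rmorphN rmorph1 /= mulrCA.
    rewrite rmorph_sum mulr_sumr quot_ps_sum; apply: eq_bigr => j _.
    rewrite -quot_psMA; congr (quot_ps _ _).
    rewrite rmorphM /= mapK_iotaK map_polyC mulrCA; congr (_ * _).
    by rewrite polyCM polyC_exp polyCN.
  apply: solD => //; apply: sol_sum => j _; apply: solMA.
  by have [] := gP j.
pose c := z.[thK C].
have GH : evalto th G (\sum_(j < m) A_to_C C (a j) * s j + vK c).
  apply: evaltoD; last by rewrite -mapK_horner; apply: evalto_poly.
  apply: evalto_sum => j _; apply: evaltoM; first exact: evalto_A.
  by have [] := gP j.
exists m, c, a, f, s; split=> //.
- by move=> j; have [] := gP j.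
- rewrite (LiE GE GH) mod_A_D addrC mod_A_sum; congr (_ + _).
  apply: eq_bigr => j _; have [gE gH _] := gP j.
  by rewrite (LiE gE gH) mod_A_scaleE.
rewrite (LiE GE GH) mod_A_D addrC mod_A_sum; congr (_ + _).
by apply: eq_bigr => j _; rewrite mod_A_scaleE.
Qed.

(** [(-1)^n h] is decomposed instead of [h], because [sol_small] supplies solutions for
    [(-1)^n f_j]; the sign squares to 1. *)
Lemma sol_exists n (h : {poly Kb}) :
  exists g s, sol (quot_ps (mapK h) n) g /\ evalto th g s.
Proof.
have [r [p [rn hE]]] := reducible_all n ((-1) ^+ n * h).
have fn (i : 'I_(size r)) : N (vK (r`_i).2) < Q ^+ n by apply/rn/mem_nth.
have [g gP] := choice (fun j => sol_small (fn j)).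
have [s {}gP] := choice gP.
have [z zE] := poly_sol ((-1) ^+ n * p).
exists (\sum_(j < size r) A_ps C (r`_j).1 * g j + poly_ps (mapK z)).
exists (\sum_(j < size r) A_to_C C (r`_j).1 * s j + (mapK z).[th]); split; last first.
  apply: evaltoD; last exact: evalto_poly.
  apply: evalto_sum => j _; apply: evaltoM; first exact: evalto_A.
  by have [] := gP j.
have -> : h = \sum_(j < size r) map_poly (@iotaK F R C) (r`_j).1 * ((-1) ^+ n * (r`_j).2)%:P
    + lin_th C n * ((-1) ^+ n * p).
  have hh : (-1) ^+ n * ((-1) ^+ n * h) = h by rewrite mulrA -expr2 sqrr_sign mul1r.
  rewrite -[LHS]hh hE mulrDr [X in _ + X = _]mulrCA; congr (_ + _).
  rewrite (big_nth 0) big_mkord mulr_sumr; apply: eq_bigr => j _.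
  by rewrite mulrCA polyCM polyC_exp polyCN.
rewrite rmorphD quot_psD quot_ps_lin_th rmorph_sum quot_ps_sum.
apply: solD => //; apply: sol_sum => j _.
rewrite rmorphM /= mapK_iotaK quot_psMA; apply: solMA; have [gE _ _] := gP j.
rewrite map_polyC [X in quot_ps X%:P]rmorphM rmorphXn rmorphN rmorph1.
exact: gE.
Qed.

End FirstPart.

(** * Finite extensions of [K] *)

Section FiniteAlgebras.
Variables (F : finFieldType) (R : realType) (C : Cinfty F R).
Local Notation q := #|F|.
Local Notation Q := (#|F|%:R : R).
Local Notation N := (abs C).
Local Notation th := (theta C).
Local Notation iota := (Fq_to_C C).
Local Notation CA := (restrict_scalars (@A_to_C F R C)).
Implicit Types (x y : C) (s t w : seq C).

(* The [K]-span of [s], described without denominators. *)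
Definition Kspan s x : Prop :=
  exists2 a : {poly F}, a != 0 & lin_span (s : seq CA) (a *: (x : CA)).

Lemma scaleAE (a : {poly F}) (x : CA) : a *: x = A_to_C C a * (x : C).
Proof. by []. Qed.

Lemma Kspan_mem s x : x \in s -> Kspan s x.
Proof.
move=> xs; exists 1; rewrite ?oner_eq0 // scale1r.
exact: (mem_lin_span (M := CA)).
Qed.

Lemma Kspan0 s : Kspan s 0.
Proof.
exists 1; rewrite ?oner_eq0 // scaler0; exact: (lin_span0 (M := CA)).
Qed.

Lemma KspanD s x y : Kspan s x -> Kspan s y -> Kspan s (x + y).
Proof.
move=> [a a0 xs] [b b0 ys]; exists (a * b); rewrite ?mulf_neq0 //.
rewrite -[x + y]/((x : CA) + (y : CA)) scalerDr; apply: (lin_spanD (M := CA)).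
  by rewrite mulrC -scalerA; apply: (lin_spanZ (M := CA)).
by rewrite -scalerA; apply: (lin_spanZ (M := CA)).
Qed.

Lemma Kspan_sum s (I : Type) (r : seq I) (P : pred I) (f : I -> C) :
  (forall i, P i -> Kspan s (f i)) -> Kspan s (\sum_(i <- r | P i) f i).
Proof. by move=> H; elim/big_ind: _ => [|x y|//]; [exact: Kspan0|exact: KspanD]. Qed.

Lemma KspanZ s (a : {poly F}) x : Kspan s x -> Kspan s (A_to_C C a * x).
Proof.
move=> [b b0 xs]; exists b => //.
have -> : b *: (A_to_C C a * x : CA) = a *: (b *: (x : CA)).
  by rewrite -[A_to_C C a * x]/(a *: (x : CA)) !scalerA mulrC.
exact: (lin_spanZ (M := CA)).
Qed.

Lemma Kspan_div s (a : {poly F}) x : a != 0 -> Kspan s (A_to_C C a * x) -> Kspan s x.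
Proof.
move=> a0 [b b0 xs]; exists (b * a); rewrite ?mulf_neq0 //.
by rewrite -scalerA.
Qed.

Lemma Kspan_sub s t x : {in s, forall y, Kspan t y} -> Kspan s x -> Kspan t x.
Proof.
move=> st [a a0 [c E]]; apply: (Kspan_div a0).
rewrite -[A_to_C C a * x]/(a *: (x : CA)) E /lin_comb.
apply: Kspan_sum => i _; apply: KspanZ; apply: st; exact: mem_nth.
Qed.

Lemma Kspan_mulr s y : {in s, forall x, Kspan s (x * y)} ->
  forall x, Kspan s x -> Kspan s (x * y).
Proof.
move=> sy x [a a0 [c E]]; apply: (Kspan_div a0).
rewrite mulrA -[A_to_C C a * x]/(a *: (x : CA)) E /lin_comb mulr_suml.
apply: Kspan_sum => i _; rewrite -[_ * y]mulrA; apply: KspanZ; apply: sy; exact: mem_nth.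
Qed.

(** The [K]-span of [s] is a subring of [C], hence a finite extension of [K], given by a spanning
    family. *)
Definition Kalg s : Prop :=
  Kspan s 1 /\ forall x y, Kspan s x -> Kspan s y -> Kspan s (x * y).

Lemma KalgP s : Kspan s 1 -> {in s &, forall x y, Kspan s (x * y)} -> Kalg s.
Proof.
move=> s1 sM; split=> // x y xs ys; rewrite mulrC.
apply: Kspan_mulr ys => z zs; rewrite mulrC.
by apply: Kspan_mulr xs => u us; apply: sM.
Qed.

Lemma Kalg_exp s x n : Kalg s -> Kspan s x -> Kspan s (x ^+ n).
Proof.
by move=> [s1 sM] xs; elim: n => [//|n IH]; rewrite exprS; apply: sM.
Qed.

Lemma Kspan_A s (a : {poly F}) : Kalg s -> Kspan s (A_to_C C a).
Proof. by move=> [s1 _]; rewrite -[A_to_C C a]mulr1; apply: KspanZ. Qed.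

(** Denominators are cleared and the top term isolated: in this form [x ^+ e] reduces to lower
    powers when [x] is adjoined. *)
Lemma algebraic_relation x : x \in @Kbar_pred F R C ->
  exists e (c : nat -> {poly F}),
    [/\ (0 < e)%N, c e != 0 & A_to_C C (c e) * x ^+ e = \sum_(i < e) A_to_C C (c i) * x ^+ i].
Proof.
move=> /asboolP[p [p0 /allP pK rx]].
have [a a0 aP] : exists2 a : {poly F}, a != 0 &
    {in (p : seq C), forall y, exists b, A_to_C C a * y = A_to_C C b}.
  apply: (common_multiplier (P := fun y a => exists b, A_to_C C a * y = A_to_C C b)).
    by move=> y a b [c E]; exists (b * c); rewrite !rmorphM -mulrA E.
  move=> y yp; have /asboolP[b [c [c0 ->]]] := pK y yp.
  exists c; first by rewrite -(A_to_C_eq0 C).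
  by exists b; rewrite mulrCA mulfV ?mulr1.
have aP' i : exists b, A_to_C C a * p`_i = A_to_C C b.
  have [ip|pi] := ltnP i (size p); first by apply: aP; rewrite mem_nth.
  by exists 0; rewrite nth_default // mulr0 rmorph0.
have [b bE] := choice aP'; have sp : (0 < size p)%N by rewrite size_poly_gt0.
have aC : A_to_C C a != 0 by rewrite A_to_C_eq0.
have lead0 : A_to_C C (b (size p).-1) != 0.
  by rewrite -bE mulf_neq0 // -lead_coefE lead_coef_eq0.
have E : \sum_(i < (size p).-1.+1) A_to_C C (b i) * x ^+ i = 0.
  rewrite prednK //.
  move: rx; rewrite rootE horner_coef => /eqP /(congr1 ( *%R (A_to_C C a))).
  rewrite mulr0 mulr_sumr => rx; rewrite -[RHS]rx.
  by apply: eq_bigr => i _; rewrite -bE mulrA.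
move: E lead0; rewrite big_ord_recr /=.
set e := (size p).-1 => E lead0.
have e0 : (0 < e)%N.
  rewrite lt0n; apply: contra_neq lead0 => e0; move: E.
  by rewrite e0 big_ord0 add0r expr0 mulr1.
exists e, (fun i => if i == e then b e else - b i); rewrite eqxx; split=> //.
  by rewrite -(A_to_C_eq0 C).
apply/eqP; rewrite -subr_eq0 -sumrN addrC; apply/eqP; rewrite -[RHS]E.
congr (_ + _); apply: eq_bigr => i _.
by rewrite (ltn_eqF (ltn_ord i)) rmorphN mulNr opprK.
Qed.

Lemma Kalg_adjoin s x : Kalg s -> x \in @Kbar_pred F R C ->
  exists t, [/\ Kalg t, Kspan t x & {in s, forall y, Kspan t y}].
Proof.
move=> [s1 sM] /algebraic_relation[e [c [e0 ce0 xe]]].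
pose t := [seq y * x ^+ i | y <- s, i <- index_iota 0 e].
have memt y i : y \in s -> (i < e)%N -> Kspan t (y * x ^+ i).
  move=> ys ie; apply: Kspan_mem; apply/allpairsP; exists (y, i).
  by rewrite mem_index_iota.
have st : {in s, forall y, Kspan t y}.
  by move=> y ys; rewrite -[y]mulr1 -(expr0 x); apply: memt.
have st' y : Kspan s y -> Kspan t y by apply: Kspan_sub.
have tx : {in t, forall y, Kspan t (y * x)}.
  move=> _ /allpairsP[[y i] [ys ii ->]] /=.
  have ie : (i < e)%N by move: ii; rewrite mem_index_iota.
  rewrite -mulrA -exprSr; have [ie'|ei] := ltnP i.+1 e; first exact: memt.
  have -> : i.+1 = e by apply/eqP; rewrite eqn_leq ie.
  apply: (Kspan_div ce0); rewrite mulrCA xe mulr_sumr; apply: Kspan_sum => j _.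
  by rewrite mulrCA; apply: KspanZ; apply: memt.
have tX y i : Kspan t y -> Kspan t (y * x ^+ i).
  move=> ty; elim: i => [|i IH]; first by rewrite mulr1.
  by rewrite exprSr mulrA; apply: Kspan_mulr.
have ts y z : y \in s -> Kspan t z -> Kspan t (z * y).
  move=> ys; apply: Kspan_mulr => _ /allpairsP[[u i] [us ii ->]] /=.
  rewrite mulrAC; apply: tX; apply: st'; apply: sM; exact: Kspan_mem.
exists t; split=> //.
- apply: KalgP; first exact: st'.
  move=> y _ yt /allpairsP[[u i] [us ii ->]] /=.
  rewrite mulrA; apply: tX; apply: ts => //; exact: Kspan_mem.
- have := tX 1 1%N (st' _ s1); by rewrite mul1r expr1.
Qed.

Lemma Kalg_exists (xs : seq C) : {in xs, forall x, x \in @Kbar_pred F R C} ->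
  exists t, Kalg t /\ {in xs, forall x, Kspan t x}.
Proof.
elim: xs => [|x xs IH] H.
  exists [:: 1]; split=> //; apply: KalgP.
    by apply: Kspan_mem; rewrite inE.
  by move=> x y; rewrite !inE => /eqP-> /eqP->; rewrite mulr1; apply: Kspan_mem; rewrite inE.
have [|s [sA sxs]] := IH; first by move=> y yxs; apply: H; rewrite inE yxs orbT.
have [t [tA tx st]] := Kalg_adjoin sA (H x (mem_head _ _)).
exists t; split=> // y; rewrite inE => /predU1P[->//|/sxs].
exact: Kspan_sub.
Qed.

Lemma Kalg_eq s t : {in s, forall y, Kspan t y} -> {in t, forall y, Kspan s y} ->
  Kalg s -> Kalg t.
Proof.
move=> st ts [s1 sM]; split; first exact: Kspan_sub s1.
move=> x y xt yt; apply: (Kspan_sub st); apply: sM; exact: Kspan_sub ts _.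
Qed.

(** Dividing a spanning family by a power of [theta] makes its elements at most 1 in absolute value
    without changing the [K]-span; a maximal independent subfamily is then the basis. *)
Lemma Kalg_basis (xs : seq C) : {in xs, forall x, x \in @Kbar_pred F R C} ->
  exists w, [/\ lin_indep (w : seq CA), {in w, forall y, N y <= 1}, Kalg w &
                {in xs, forall x, Kspan w x}].
Proof.
move=> /Kalg_exists[s [sA sxs]].
have [k kP] : exists k, {in s, forall y, N y <= Q ^+ k}.
  elim: {sA sxs} s => [|y s [k kP]]; first by exists 0%N.
  have [k' k'P] := expr_unbounded (N y) (Q_gt1 F R).
  exists (k + k')%N => z; rewrite inE => /predU1P[->|/kP zk].
    by apply/ltW/k'P; rewrite leq_addl.
  by apply: le_trans zk _; apply: ler_QX; rewrite leq_addr.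
pose s' := [seq y / th ^+ k | y <- s].
have thE : A_to_C C ('X ^+ k) = th ^+ k by rewrite rmorphXn /= A_to_CX.
have X0 : 'X ^+ k != 0 :> {poly F} by rewrite expf_neq0 // polyX_eq0.
have thk0 : th ^+ k != 0 by rewrite -thE A_to_C_eq0.
have ss' : {in s, forall y, Kspan s' y}.
  move=> y ys; have -> : y = A_to_C C ('X ^+ k) * (y / th ^+ k).
    by rewrite thE mulrCA mulfV ?mulr1.
  by apply/KspanZ/Kspan_mem/map_f.
have s's : {in s', forall y, Kspan s y}.
  move=> _ /mapP[y ys ->]; apply: (Kspan_div X0).
  by rewrite thE mulrCA mulfV ?mulr1 //; apply: Kspan_mem.
have [w [ws' wi wt]] := max_indep (M := CA) (fun y : C => (y : CA)) s'.
rewrite map_id in wi wt.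
have s'w : {in s', forall y, Kspan w y}.
  by move=> y /wt[a a0 aw]; exists a.
have ws : {in w, forall y, Kspan s' y} by move=> y /ws' ys; apply: Kspan_mem.
exists w; split=> //.
- move=> y /ws' /mapP[z /kP zk ->].
  by rewrite cabsM cabsV cabs_thX ler_pdivrMr ?QX_gt0 // mul1r.
- by apply: (Kalg_eq s'w ws); apply: (Kalg_eq ss' s's).
by move=> x /sxs xs1; apply: (Kspan_sub s'w); apply: Kspan_sub xs1.
Qed.

End FiniteAlgebras.

(** * Heights and Liouville's inequality *)

Lemma size_det_leq (S : comNzRingType) (m H : nat) (M : 'M[{poly S}]_m) :
  (forall i j, (size (M i j) <= H.+1)%N) -> (size (\det M) <= (m * H).+1)%N.
Proof.
move=> MH; apply: leq_trans (size_sum _ _ _) _; apply/bigmax_leqP => s _.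
have -> : (-1) ^+ s = ((-1) ^+ s)%:P :> {poly S} by rewrite polyC_exp polyCN.
rewrite mul_polyC; apply: leq_trans (size_scale_leq _ _) _.
apply: leq_trans (size_poly_prod_leq _ _) _.
have : (\sum_i size (M i (s i)) <= m * H.+1)%N.
  by rewrite -[X in (_ <= X * _)%N]card_ord -sum_nat_const; apply: leq_sum.
rewrite mulnS card_ord; move: (\sum_i _)%N (m * H)%N => a b; lia.
Qed.

Section Liouville.
Variables (F : finFieldType) (R : realType) (C : Cinfty F R).
Local Notation q := #|F|.
Local Notation Q := (#|F|%:R : R).
Local Notation N := (abs C).
Local Notation th := (theta C).
Local Notation iota := (Fq_to_C C).
Local Notation CA := (restrict_scalars (@A_to_C F R C)).
Variable w : seq C.
Local Notation d := (size w).
Local Notation mapA := (map_mx (@A_to_C F R C)).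
Implicit Types (x y : C).

Definition wcol : 'cV[C]_d := \col_i w`_i.

(** A height: multiplication by [x] acts on [w] through a matrix over [F[theta]] of degree at most
    [H]. The bound adds up under products, and sums do not increase a common bound. *)
Definition rep (H : nat) x : Prop :=
  exists Y : 'M[{poly F}]_d, (forall i j, (size (Y i j) <= H.+1)%N) /\
    mapA Y *m wcol = x *: wcol.

Lemma rep_le H H' x : (H <= H')%N -> rep H x -> rep H' x.
Proof. by move=> HH' [Y [YH E]]; exists Y; split=> // i j; apply: leq_trans (YH i j) _. Qed.

Lemma repD H x y : rep H x -> rep H y -> rep H (x + y).
Proof.
move=> [Y [YH E]] [Z [ZH E']]; exists (Y + Z); split=> [i j|].
  by rewrite mxE (leq_trans (size_polyD _ _)) // geq_max YH ZH.
by rewrite map_mxD mulmxDl E E' scalerDl.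
Qed.

Lemma rep0 H : rep H 0.
Proof.
exists 0; split=> [i j|]; first by rewrite mxE size_poly0.
by rewrite map_mx0 mul0mx scale0r.
Qed.

Lemma rep_sum H (I : Type) (r : seq I) (P : pred I) (f : I -> C) :
  (forall i, P i -> rep H (f i)) -> rep H (\sum_(i <- r | P i) f i).
Proof. by move=> fH; elim/big_ind: _ => [|x y|//]; [exact: rep0|exact: repD]. Qed.

Lemma repM H H' x y : rep H x -> rep H' y -> rep (H + H') (x * y).
Proof.
move=> [Y [YH E]] [Z [ZH E']]; exists (Y *m Z); split=> [i j|]; last first.
  by rewrite map_mxM -mulmxA E' -scalemxAr E scalerA mulrC.
rewrite mxE; apply: leq_trans (size_sum _ _ _) _; apply/bigmax_leqP => k _.
apply: leq_trans (size_polyMleq _ _) _.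
by rewrite -subn1 leq_subLR (leq_trans (leq_add (YH i k) (ZH k j))) // addSn addnS add1n.
Qed.

Lemma rep_A H (a : {poly F}) : (size a <= H.+1)%N -> rep H (A_to_C C a).
Proof.
move=> aH; exists a%:M; split=> [i j|]; last by rewrite map_scalar_mx mul_scalar_mx.
by rewrite mxE; case: (_ == _); rewrite ?mulr1n ?mulr0n ?size_poly0.
Qed.

Lemma rep_Fq H c : rep H (iota c).
Proof.
rewrite -A_to_CC; apply: rep_A; apply: leq_trans (size_polyC_leq1 _) _.
exact: ltn0Sn.
Qed.

Lemma rep_th k : rep k (th ^+ k).
Proof.
have -> : th ^+ k = A_to_C C ('X ^+ k) by rewrite rmorphXn /= A_to_CX.
by apply: rep_A; rewrite size_polyXn.
Qed.

Lemma repX H x k : rep H x -> rep (H * k) (x ^+ k).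
Proof.
move=> xH; elim: k => [|k IH].
  by rewrite muln0 expr0 -(rmorph1 iota); apply: rep_Fq.
by rewrite exprS mulnS; apply: repM.
Qed.

Lemma repN H x : rep H x -> rep H (- x).
Proof.
move=> xH; rewrite -mulN1r -(rmorph1 iota) -rmorphN -[H]add0n.
by apply: repM => //; apply: rep_Fq.
Qed.

Lemma rep_frob H x M : rep H x -> rep (H * q ^ M) (frob M x).
Proof. exact: repX. Qed.

Lemma Kspan_rep x : Kalg w -> Kspan w x ->
  exists2 a : {poly F}, a != 0 & exists H, rep H (A_to_C C a * x).
Proof.
move=> [_ wM] xw.
have [a a0 aP] : exists2 a : {poly F}, a != 0 &
    {in w, forall y, lin_span (w : seq CA) (a *: (x * y : CA))}.
  apply: (common_multiplier (P := fun y a => lin_span (w : seq CA) (a *: (x * y : CA)))).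
    by move=> y a b /(lin_spanZ (M := CA) b); rewrite scalerA.
  move=> y yw; have [a a0 aP] := wM x y xw (Kspan_mem yw).
  by exists a.
have cP (i : 'I_d) : exists c : 'I_d -> {poly F},
    a *: (x * w`_i : CA) = lin_comb (c : 'I_(size (w : seq CA)) -> _).
  exact: aP (mem_nth 0 (ltn_ord i)).
have [c cE] := choice cP; exists a => //.
exists (\sum_i \sum_j size (c i j)), (\matrix_(i, j) c i j); split=> [i j|].
  rewrite mxE (bigD1 i) //= (bigD1 j) //=; lia.
apply/matrixP => i k; rewrite ord1 !mxE -mulrA.
rewrite -[RHS]/(a *: (x * w`_i : CA)) cE; apply: eq_bigr => j _.
by rewrite !mxE.
Qed.

Hypothesis w_ind : lin_indep (w : seq CA).

(* Multiplying [Y *m w = x *: w] by the adjugate of [Y] bounds [\det Y] by [x];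
   a nonzero element of [F[theta]] has absolute value at least [1]. *)
Lemma liouville H x : (0 < d)%N -> rep H x -> x != 0 -> 1 <= N x * Q ^+ (d.-1 * H).
Proof.
move=> d0 [Y [YH E]] x0.
(* A row killing [w] is a relation over [F[theta]], hence 0. A left kernel vector of [Y] would be
   such a row because [x <> 0]. *)
have kerw (c : 'rV[{poly F}]_d) : mapA c *m wcol = 0 -> c = 0.
  move=> /matrixP/(_ 0 0); rewrite !mxE => c0; apply/matrixP => i j; rewrite ord1 mxE.
  apply: (w_ind (c := fun j => c 0 j)); rewrite -[RHS]c0 /lin_comb.
  by apply: eq_bigr => k _; rewrite !mxE.
have det0 : \det Y != 0.
  apply/negP => /det0P[c c0 cY]; case/eqP: c0; apply: kerw.
  have : mapA c *m (mapA Y *m wcol) = 0 by rewrite mulmxA -map_mxM cY map_mx0 mul0mx.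
  rewrite E -scalemxAr => /eqP; rewrite scaler_eq0 (negPf x0) /= => /eqP //.
have adjH i j : (size (\adj Y i j) <= (d.-1 * H).+1)%N.
  rewrite mxE /cofactor.
  have -> : (-1) ^+ (j + i) = ((-1) ^+ (j + i))%:P :> {poly F} by rewrite polyC_exp polyCN.
  rewrite mul_polyC; apply: leq_trans (size_scale_leq _ _) _.
  by apply: size_det_leq => k l; rewrite !mxE.
have adjE : x *: (mapA (\adj Y) *m wcol) = A_to_C C (\det Y) *: wcol.
  by rewrite scalemxAr -E mulmxA -map_mxM mul_adj_mx map_scalar_mx mul_scalar_mx.
(* The coordinates of [adjE] are compared where [w] is largest, so that [|w_i0|] cancels. *)
have [i0 i0max] : exists i0 : 'I_d, forall j : 'I_d, N w`_j <= N w`_i0.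
  have [i _ iP] := @arg_maxP _ R _ (Ordinal d0) predT (fun i : 'I_d => N w`_i) erefl.
  by exists i => j; apply: iP.
have wi0 : 0 < N w`_i0.
  rewrite cabs_gt0; apply: contraTneq (oner_neq0 {poly F}) => w0.
  have wall (j : 'I_d) : w`_j = 0.
    by apply/cabs_eq0P/le_anti; rewrite cabs_ge0; have := i0max j; rewrite w0 cabs0 => ->.
  rewrite negbK; apply/eqP; apply: (w_ind (c := fun=> 1) _ (Ordinal d0)).
  by rewrite /lin_comb big1 // => j _; rewrite scale1r; apply: wall.
have := congr1 (fun M : 'cV[C]_d => N (M i0 0)) adjE; rewrite /= !mxE !cabsM => adjE0.
rewrite -(ler_pM2r wi0) mul1r; apply: (@le_trans _ _ (N (A_to_C C (\det Y)) * N w`_i0)).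
  by rewrite ler_peMl ?cabs_ge0 ?cabs_A_ge1.
rewrite -adjE0 -mulrA ler_wpM2l ?cabs_ge0 //; apply: cabs_sum_le => [|j _].
  by rewrite mulr_ge0 ?cabs_ge0 // ltW ?QX_gt0.
rewrite !mxE cabsM ler_pM ?cabs_ge0 //.
by have := adjH i0 j; rewrite mxE; apply: cabs_A_le.
Qed.

End Liouville.

(** * Siegel's lemma over [F] *)

Section SmallCombinations.
Variables (F : finFieldType) (R : realType) (C : Cinfty F R).
Local Notation q := #|F|.
Local Notation Q := (#|F|%:R : R).
Local Notation N := (abs C).
Local Notation th := (theta C).
Local Notation iota := (Fq_to_C C).
Local Notation CA := (restrict_scalars (@A_to_C F R C)).
Variables (w : seq C) (J : nat) (I : finType).
Implicit Types (z : I -> 'I_J -> C) (c : I -> F) (X Y : {set I}).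

(** Each [z i] is a vector of [J] elements of the [K]-span of [w], a space of dimension at most
    [size w * J] altogether. *)
Lemma A_dependent z X : (forall i j, i \in X -> Kspan w (z i j)) ->
  (size w * J < #|X|)%N ->
  exists a : I -> {poly F}, [/\ forall i, i \notin X -> a i = 0, exists i, a i != 0 &
    forall j, \sum_i A_to_C C (a i) * z i j = 0].
Proof.
move=> zw dX; pose P (ij : I * 'I_J) (a : {poly F}) :=
  lin_span (w : seq CA) (a *: (z ij.1 ij.2 : CA)).
have [b b0 bP] : exists2 b, b != 0 &
    {in [seq ij <- enum {: I * 'I_J} | ij.1 \in X], forall ij, P ij b}.
  apply: common_multiplier => [ij a b|[i j]].
    by rewrite /P -scalerA; apply: (lin_spanZ (M := CA)).
  by rewrite mem_filter => /andP[iX _]; apply: zw.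
have cP (kj : 'I_#|X| * 'I_J) : exists c : 'I_(size w) -> {poly F},
    A_to_C C b * z (enum_val kj.1) kj.2 = \sum_l A_to_C C (c l) * w`_l.
  have [|c cE] := bP (enum_val kj.1, kj.2).
    by rewrite mem_filter mem_enum andbT; apply: enum_valP.
  by exists c; apply: cE.
have [c cE] := choice cP.
pose M := \matrix_(k < #|X|) mxvec (\matrix_(l < size w, j < J) c (k, j) l).
have [e e0 eM] := row_kernel M dX.
have eM' l j : \sum_k e 0 k * c (k, j) l = 0.
  have := congr1 (fun A : 'rV_(size w * J) => A 0 (mxvec_index l j)) eM.
  rewrite !mxE => E; rewrite -[RHS]E; apply: eq_bigr => k _.
  by rewrite mxE mxvecE mxE.
pose a i := \sum_(k | enum_val k == i) e 0 k.
have aE k : a (enum_val k) = e 0 k.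
  by rewrite /a (big_pred1 k) // => k'; rewrite (inj_eq enum_val_inj).
exists a; split=> [i iX||j].
- rewrite /a big_pred0 // => k; apply: contraNF iX => /eqP <-; exact: enum_valP.
- have [k ek] : exists k, e 0 k != 0.
    apply/existsP; apply: contraNT e0 => /existsPn ek; apply/eqP/matrixP => i k.
    by rewrite ord1 mxE; apply/eqP; rewrite -[_ == _]negbK ek.
  by exists (enum_val k); rewrite aE.
have bC : A_to_C C b != 0 by rewrite A_to_C_eq0.
apply: (mulfI bC); rewrite mulr0 mulr_sumr (bigID (mem X)) /= [X in _ + X]big1 => [|i iX].
  rewrite addr0 big_enum_val /=.
  under eq_bigr => k _ do rewrite mulrCA (cE (k, j)) aE mulr_sumr.
  rewrite exchange_big big1 //= => l _.
  transitivity (A_to_C C (\sum_k e 0 k * c (k, j) l) * w`_l).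
    by rewrite rmorph_sum mulr_suml; apply: eq_bigr => k _; rewrite rmorphM mulrA.
  by rewrite eM' rmorph0 mul0r.
rewrite /a big_pred0 ?rmorph0 ?mul0r ?mulr0 // => k.
by apply: contraNF iX => /eqP <-; apply: enum_valP.
Qed.

Definition Fcomb c z j : C := \sum_i iota (c i) * z i j.

(* Take the leading coefficients of an [A]-linear dependence. *)
Lemma leading_combination z X (r : R) : 0 < r ->
  (forall i j, i \in X -> Kspan w (z i j)) -> (forall i j, i \in X -> N (z i j) < r) ->
  (size w * J < #|X|)%N ->
  exists c, [/\ forall i, i \notin X -> c i = 0, exists i, c i != 0 &
    forall j, N (Fcomb c z j) * Q < r].
Proof.
move=> r0 zw zr /(A_dependent zw)[a [aX [i0 ai0] aE]].
pose m := \max_i size (a i); pose e := m.-1.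
have m0 : (0 < m)%N by apply: leq_trans (leq_bigmax i0); rewrite size_poly_gt0.
have am i : (size (a i) <= e.+1)%N by rewrite /e prednK //; apply: leq_bigmax.
exists (fun i => (a i)`_e); split=> [i /aX ->||j]; first by rewrite coef0.
  have I0 : (0 < #|I|)%N by apply/card_gt0P; exists i0.
  have [i1 i1m] := bigop.eq_bigmax (fun i => size (a i)) I0.
  exists i1; have sE : size (a i1) = m by rewrite /m i1m.
  by rewrite /e -sE -lead_coefE lead_coef_eq0 -size_poly_gt0 sE.
(* Without the [X^e] term, [|b i| <= q^(e-1)]. By the dependence, [theta^e] times the new
   combination is [- \sum_i b_i z_i], which gains the factor [q]. *)
pose b i := a i - (a i)`_e *: 'X^e.
have bs i : (size (b i) <= e)%N.
  apply/leq_sizeP => k; rewrite leq_eqVlt => /predU1P[<-|ek].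
    by rewrite coefB coefZ coefXn eqxx mulr1 subrr.
  by rewrite coefB coefZ coefXn gtn_eqF // mulr0 subr0 nth_default // (leq_trans (am i)).
have bN i : N (A_to_C C (b i)) * Q <= Q ^+ e.
  have [->|bi0] := eqVneq (b i) 0.
    by rewrite rmorph0 cabs0 mul0r ltW ?QX_gt0.
  by rewrite cabs_A // -exprSr prednK ?size_poly_gt0 // ler_QX.
have E : th ^+ e * Fcomb (fun i => (a i)`_e) z j = - \sum_i A_to_C C (b i) * z i j.
  apply/eqP; rewrite -addr_eq0; apply/eqP; rewrite -[RHS](aE j) mulr_sumr -big_split /=.
  apply: eq_bigr => i _; rewrite mulrA -mulrDl; congr (_ * _).
  rewrite /b rmorphB /= -mul_polyC rmorphM /= A_to_CC rmorphXn /= A_to_CX.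
  by ring.
have Qe0 := QX_gt0 F R e.
rewrite -(ltr_pM2l Qe0) mulrA -(cabs_thX C) -cabsM E cabsN (cabs_thX C).
rewrite -ltr_pdivlMr ?Q_gt0 //; apply: cabs_sum_lt => [|i _].
  by rewrite divr_gt0 ?mulr_gt0 ?Q_gt0.
rewrite ltr_pdivlMr ?Q_gt0 // cabsM mulrAC.
have [iX|iX] := boolP (i \in X); last first.
  by rewrite /b aX // coef0 scale0r subr0 rmorph0 cabs0 !mul0r mulr_gt0.
apply: (@le_lt_trans _ _ (Q ^+ e * N (z i j))); first by rewrite ler_wpM2r ?cabs_ge0.
by rewrite ltr_pM2l // zr.
Qed.

(** Linear independence over [F] of the [z i], [i] in [X], modulo the vectors whose coordinates are
    all smaller than [r / q^k]. *)
Definition indep_mod z k (r : R) X := forall c, (forall i, i \notin X -> c i = 0) ->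
  (forall j, N (Fcomb c z j) * Q ^+ k < r) -> forall i, c i = 0.

Lemma Fcomb_Kspan c z j X : (forall i, i \notin X -> c i = 0) ->
  (forall i j, i \in X -> Kspan w (z i j)) -> Kspan w (Fcomb c z j).
Proof.
move=> cX zw; apply: Kspan_sum => i _; have [iX|/cX ->] := boolP (i \in X).
  by rewrite -A_to_CC; apply: KspanZ; apply: zw.
by rewrite rmorph0 mul0r; apply: Kspan0.
Qed.

(* A maximal subfamily [Y] independent at the first level has at most
   [size w * J] elements; corrected by [Y], the other elements become smaller by
   a factor [q], and the induction hypothesis applies to them. *)
Lemma indep_mod_card k z (r : R) X : 0 < r ->
  (forall i j, i \in X -> Kspan w (z i j)) -> (forall i j, i \in X -> N (z i j) < r) ->
  indep_mod z k r X -> (#|X| <= size w * J * k)%N.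
Proof.
elim: k z r X => [|k IH] z r X r0 zw zr ind.
  rewrite muln0 leqn0 cards_eq0; apply/eqP/setP => i; rewrite inE; apply/negP => iX.
  have := ind (fun l => (l == i)%:R) _ _ i; rewrite eqxx => H.
  case/eqP: (oner_neq0 F); apply: H => [l lX|j].
    by rewrite (_ : l == i = false) //; apply: contraNF lX => /eqP ->.
  rewrite mulr1 /Fcomb (bigD1 i) //= eqxx rmorph1 mul1r big1 ?addr0 ?zr // => l /negPf ->.
  by rewrite rmorph0 mul0r.
have [Y /maxsetP[/andP[YX /asboolP indY] Ymax]] : {Y | maxset
    (fun Y : {set I} => (Y \subset X) && `[< indep_mod z 1 r Y >]) Y}.
  apply: ex_maxset; exists finset.set0; rewrite finset.sub0set; apply/asboolP => c cX _ i.
  by apply: cX; rewrite inE.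
have Yd : (#|Y| <= size w * J)%N.
  rewrite leqNgt; apply/negP => dY.
  have zwY i j : i \in Y -> Kspan w (z i j) by move/(fintype.subsetP YX); apply: zw.
  have zrY i j : i \in Y -> N (z i j) < r by move/(fintype.subsetP YX); apply: zr.
  have [c [cY [i /eqP ci] cE]] := leading_combination r0 zwY zrY dY.
  by apply: ci; apply: indY i => // j; rewrite expr1; apply: cE.
(* By maximality of [Y], adding [i] creates a small combination. Its coefficient at [i] is nonzero,
   otherwise it would contradict [indY], and is normalised to 1. *)
have CP (i : I) : exists c : I -> F, i \in X :\: Y ->
    [/\ forall l, l \notin i |: Y -> c l = 0, c i = 1 & forall j, N (Fcomb c z j) * Q < r].
  have [iXY|] := boolP (i \in X :\: Y); last by exists (fun=> 0).
  move: (iXY); rewrite inE => /andP[iY iX].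
  have [c [cY cE cn0]] : exists c : I -> F, [/\ forall l, l \notin i |: Y -> c l = 0,
      forall j, N (Fcomb c z j) * Q ^+ 1 < r & ~ forall l, c l = 0].
    apply: contrapT => nc; case/negP: iY.
    rewrite -(Ymax (i |: Y)) ?finset.setU11 ?finset.subsetU1 //.
      rewrite finset.subUset finset.sub1set iX YX /=; apply/asboolP => c cY cE.
      by apply: contrapT => cn0; apply: nc; exists c.
  have ci : c i != 0.
    apply/negP => /eqP ci; apply: cn0; apply: indY => // l lY.
    have [->//|li] := eqVneq l i; apply: cY; by rewrite !inE negb_or li.
  exists (fun l => c l / c i) => _; split=> [l /cY ->||j]; rewrite ?mul0r ?divff //.
  have -> : Fcomb (fun l => c l / c i) z j = iota (c i)^-1 * Fcomb c z j.
    by rewrite /Fcomb mulr_sumr; apply: eq_bigr => l _; rewrite rmorphM; ring.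
  by rewrite cabsM cabs_Fq ?invr_eq0 // mul1r -[Q]expr1.
have [c cP] := choice CP.
have XY : (#|X :\: Y| <= size w * J * k)%N.
  apply: (IH (fun i => Fcomb (c i) z) (r / Q)); first by rewrite divr_gt0 ?Q_gt0.
  - move=> i j iXY; have [cY _ _] := cP i iXY.
    apply: (@Fcomb_Kspan _ _ _ X) => // l lX; apply: cY; apply: contraNN lX.
    by rewrite !inE => /orP[/eqP->|/(fintype.subsetP YX)//]; move: iXY; rewrite inE => /andP[].
  - by move=> i j iXY; have [_ _ cE] := cP i iXY; rewrite ltr_pdivlMr ?Q_gt0.
  (* [c i] is 1 at [i] and 0 elsewhere outside [Y], so [f] and [e] agree on [X :\: Y]; independence
     of [X] at level [k.+1] gives [f = 0]. *)
  move=> e eXY eE; pose f l := \sum_i e i * c i l.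
  have fE j : Fcomb e (fun i => Fcomb (c i) z) j = Fcomb f z j.
    rewrite /Fcomb /f; under eq_bigr do rewrite mulr_sumr.
    rewrite exchange_big; apply: eq_bigr => l _ /=.
    by rewrite rmorph_sum mulr_suml; apply: eq_bigr => i _; rewrite rmorphM mulrA.
  have f0 l : f l = 0.
    apply: ind => [i iX|j]; last first.
      by rewrite -fE exprSr mulrA -ltr_pdivlMr ?Q_gt0.
    rewrite /f big1 // => l' _.
    have [lXY|/eXY->] := boolP (l' \in X :\: Y); last by rewrite mul0r.
    have [cY _ _] := cP l' lXY; rewrite cY ?mulr0 //; apply: contraNN iX.
    by rewrite !inE => /orP[/eqP->|/(fintype.subsetP YX)//]; move: lXY; rewrite inE => /andP[].
  move=> i; have [iXY|/eXY//] := boolP (i \in X :\: Y).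
  have := f0 i; rewrite /f (bigD1 i) //= big1 ?addr0 => [|l li].
    by have [_ -> _] := cP i iXY; rewrite mulr1.
  have [lXY|/eXY->] := boolP (l \in X :\: Y); last by rewrite mul0r.
  have [cY _ _] := cP l lXY; rewrite cY ?mulr0 // !inE negb_or eq_sym li /=.
  by move: iXY; rewrite inE => /andP[].
by rewrite -(cardsID Y X) (finset.setIidPr YX) mulnS leq_add.
Qed.

Lemma small_combination k z (r : R) : 0 < r ->
  (forall i j, Kspan w (z i j)) -> (forall i j, N (z i j) < r) ->
  (size w * J * k < #|I|)%N ->
  exists2 c, exists i, c i != 0 & forall j, N (Fcomb c z j) * Q ^+ k < r.
Proof.
move=> r0 zw zr; rewrite -cardsT ltnNge => /negP dI.
apply: contrapT => nc; apply: dI; apply: (indep_mod_card (z := z) (r := r)) => //.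
move=> c _ cE i; apply/eqP/negPn/negP => ci; apply: nc.
by exists c => //; exists i.
Qed.

End SmallCombinations.

(** * Nonvanishing of the auxiliary function and of its values *)

Section PowerIndependence.
Variables (F : finFieldType) (R : realType) (C : Cinfty F R).
Local Notation q := #|F|.
Local Notation Q := (#|F|%:R : R).
Local Notation N := (abs C).
Local Notation th := (theta C).
Local Notation iota := (Fq_to_C C).
Implicit Types (x y s : C) (g E : ps C).

Lemma cabs_frob_th_inj i j : frob i th = frob j th :> C -> i = j.
Proof.
move=> /(congr1 N); rewrite !cabs_frob_th => E.
have := ieexprIn (Q_gt0 F R) (negbT (gt_eqF (Q_gt1 F R))) E.
by move/eqP; rewrite eqn_exp2l ?q_gt1 // => /eqP.
Qed.

(* [g] has poles at the points [theta^(q^i)], [i >= 1], hence is transcendental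
   over [C(t)]. *)
Lemma powers_independent (h : {poly C}) n s (P : nat -> {poly C}) m : (0 < n)%N ->
  h.[th] != 0 -> (forall j, N (quot_ps h n j) < 1) ->
  evalto th (AS_ps (quot_ps h n)) s ->
  \sum_(k < m) poly_ps (P k) * AS_ps (quot_ps h n) ^+ k = 0 ->
  forall k, (k < m)%N -> P k = 0.
Proof.
move=> n0 hth Y1 Hs; set Y := quot_ps h n; set g := AS_ps Y.
elim: m => [//|m IH] E0.
suff Pm : P m = 0.
  move=> k; rewrite ltnS leq_eqVlt => /predU1P[->//|]; apply: IH.
  by move: E0; rewrite big_ord_recr /= Pm rmorph0 mul0r addr0.
(* The relation is multiplied by [D ^+ m], where [D] clears the poles at the first [i.+1] twists of
   [theta]. At [x], [D] vanishes but [D * g] has the nonzero value [v], so only the top term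
   survives. *)
have rootP i : (P m).[frob i.+1 th] = 0.
  set x := frob i.+1 th; pose fac (j : 'I_i.+1) : {poly C} := ('X - (frob j.+1 th)%:P) ^+ n.
  pose D := \prod_j fac j; pose D' j := \prod_(j' | j' != j) fac j'.
  have DE j : D = fac j * D' j by rewrite /D (bigD1 j).
  have facx : (fac ord_max).[x] = 0.
    by rewrite /fac horner_exp hornerXsubC /= subrr expr0n gtn_eqF.
  have Dx : D.[x] = 0 by rewrite (DE ord_max) hornerM facx mul0r.
  have D'x j : j != ord_max -> (D' j).[x] = 0.
    by move=> jm; rewrite /D' (bigD1 ord_max) 1?eq_sym //= hornerM facx mul0r.
  have D'm : (D' ord_max).[x] != 0.
    rewrite horner_prod prodf_seq_neq0; apply/allP => j _; apply/implyP => jm.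
    rewrite /fac horner_exp expf_neq0 // hornerXsubC subr_eq0.
    apply: contraNneq jm => /cabs_frob_th_inj [ij]; apply/eqP/val_inj => /=.
    exact: esym ij.
  pose hx j := (map_poly (frob j.+1) h).
  (* Since [g] converges at [theta], its twist converges at [x]; the rest of [D * g] is a
     polynomial. *)
  have GE : poly_ps D * g = poly_ps D * ps_map (frob i.+1) g +
      \sum_(j < i.+1) poly_ps (hx j * D' j).
    rewrite (AS_ps_frob i.+1 Y1) mulrBr -/g -/Y -[LHS]addr0 -addrA; congr (_ + _).
    apply/esym/eqP; rewrite addrC subr_eq0 mulr_sumr; apply/eqP/eq_bigr => j _.
    rewrite quot_ps_frob (DE j) !rmorphM /=.
    have F1 : poly_ps (fac j) * inv_lin (frob j.+1 th) ^+ n = 1.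
      exact: mul_inv_linX n (th_frob_neq0 C j.+1).
    rewrite -[LHS]mul1r -F1 /hx; move: (poly_ps _) (poly_ps _) (poly_ps _) (_ ^+ n) => a b e f.
    by ring.
  pose v := (hx i).[x] * (D' ord_max).[x].
  have Gv : evalto x (poly_ps D * g) v.
    have H1 : evalto x (poly_ps D * ps_map (frob i.+1) g) (D.[x] * frob i.+1 s).
      by apply: evaltoM; [exact: evalto_poly|exact: evalto_frob].
    have H2 : evalto x (\sum_(j < i.+1) poly_ps (hx j * D' j))
        (\sum_(j < i.+1) (hx j * D' j).[x]).
      by apply: evalto_sum => j _; apply: evalto_poly.
    have -> : v = D.[x] * frob i.+1 s + \sum_(j < i.+1) (hx j * D' j).[x].
      rewrite Dx mul0r add0r (bigD1 ord_max) //= big1 ?addr0 ?hornerM // => j jm.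
      by rewrite hornerM D'x ?mulr0.
    by rewrite GE; apply: evaltoD.
  have v0 : v != 0.
    by rewrite mulf_neq0 // /hx /x horner_map fmorph_eq0.
  have : evalto x (poly_ps (D ^+ m) * \sum_(k < m.+1) poly_ps (P k) * g ^+ k)
      (\sum_(k < m.+1) (P k * D ^+ (m - k)).[x] * v ^+ k).
    have -> : poly_ps (D ^+ m) * \sum_(k < m.+1) poly_ps (P k) * g ^+ k =
        \sum_(k < m.+1) poly_ps (P k * D ^+ (m - k)) * (poly_ps D * g) ^+ k.
      rewrite mulr_sumr; apply: eq_bigr => k _.
      have -> : D ^+ m = D ^+ (m - k) * D ^+ k by rewrite -exprD subnK ?leq_ord.
      rewrite !rmorphM !rmorphXn exprMn /=.
      move: (poly_ps D ^+ _) (poly_ps D ^+ k) (g ^+ k) (poly_ps (P k)) => a b e f.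
      by ring.
    by apply: evalto_sum => k _; apply: evaltoM; [exact: evalto_poly|exact: evaltoX].
  rewrite E0 mulr0 big_ord_recr /= big1 ?add0r => [H|k _]; last first.
    by rewrite hornerM horner_exp Dx expr0n subn_eq0 leqNgt ltn_ord mulr0 mul0r.
  have /eqP := evalto_uniq H (evalto0 x); rewrite subnn expr0 mulr1.
  by rewrite mulf_eq0 expf_eq0 (negPf v0) andbF orbF => /eqP.
apply/eqP/negPn/negP => Pm0.
pose rs := [seq frob i.+1 th | i <- index_iota 0 (size (P m))].
have : (size rs < size (P m))%N.
  apply: max_poly_roots => //.
    by apply/allP => _ /mapP[i _ ->]; rewrite rootE rootP.
  by rewrite map_inj_uniq ?iota_uniq // => i j /cabs_frob_th_inj [].
by rewrite size_map size_iota subn0 ltnn.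
Qed.

Lemma finite_eventually (P : nat -> nat -> Prop) K :
  (forall j, (j < K)%N -> exists M0, forall M, (M0 <= M)%N -> P j M) ->
  exists M0, forall M, (M0 <= M)%N -> forall j, (j < K)%N -> P j M.
Proof.
elim: K => [|K IH] H; first by exists 0%N.
have [|M1 P1] := IH; first by move=> j jK; apply: H; apply: ltnW.
have [M2 P2] := H K (leqnn _).
exists (maxn M1 M2) => M; rewrite geq_max => /andP[/P1 H1 /P2 H2] j.
by rewrite ltnS leq_eqVlt => /predU1P[->//|]; apply: H1.
Qed.

Lemma QX_bound (B : R) : exists b, B <= Q ^+ b.
Proof. by have [b bP] := expr_unbounded B (Q_gt1 F R); exists b; apply/ltW/bP. Qed.

(* The term of maximal absolute value and largest index dominates after
   sufficiently many Frobenius twists. *)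
Lemma frob_eval_neq0 E (B : R) : gauss_bd Q B E -> E != 0 ->
  exists M0, forall M, (M0 <= M)%N ->
    forall y, evalto th (ps_map (frob M) E) y -> y != 0.
Proof.
move=> EB En0.
have [j1 Ej1] : exists j, E j != 0.
  apply: contrapT => H; case/eqP: En0; apply/funext => j.
  by apply/eqP/negPn/negP => Ej; apply: H; exists j.
have r1 : 0 < N (E j1) by rewrite cabs_gt0.
have [K KP] := expr_unbounded (B / N (E j1)) (Q_gt1 F R).
have tail j : (K <= j)%N -> N (E j) < N (E j1).
  move=> Kj; have Qj := QX_gt0 F R j.
  have := KP j Kj; rewrite ltr_pdivrMr // => H; rewrite -(ltr_pM2l Qj) mulrC.
  exact: le_lt_trans (EB j) H.
have j1K : (j1 < K)%N by rewrite ltnNge; apply/negP => /tail; rewrite ltxx.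
have [j0 [j0max j0last]] : exists j0, (forall j, N (E j) <= N (E j0)) /\
    (forall j, (j0 < j)%N -> N (E j) < N (E j0)).
  have [i _ iP] := @arg_maxP _ R _ (Ordinal j1K) predT (fun i : 'I_K => N (E i)) erefl.
  pose A (i' : 'I_K) := N (E i') == N (E i).
  have Ai : A i by rewrite /A.
  have [i0 /eqP i0A i0P] := @arg_maxnP _ i A (fun i' : 'I_K => i' : nat) Ai.
  exists i0; rewrite i0A.
  have ub j : N (E j) <= N (E i).
    have [jK|Kj] := ltnP j K; first exact: (iP (Ordinal jK)).
    by apply: le_trans (ltW (tail j Kj)) _; apply: (iP (Ordinal j1K)).
  split=> // j ij; rewrite lt_neqAle ub andbT; apply/negP => Ej.
  have [jK|Kj] := ltnP j K.
    by have := i0P (Ordinal jK) Ej; rewrite /= leqNgt ij.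
  have := tail j Kj; rewrite (eqP Ej) ltNge; case/negP.
  exact: (iP (Ordinal j1K)).
set r := N (E j0) in j0max j0last; have r0 : 0 < r by apply: lt_le_trans r1 (j0max _).
have [b bP] := QX_bound (B / r).
pose rat j := N (E j) / r.
have rat0 j : 0 <= rat j by rewrite divr_ge0 ?cabs_ge0 ?ltW.
have ratB j : rat j * Q ^+ j <= Q ^+ b.
  by apply: le_trans bP; rewrite mulrAC ler_pM2r ?invr_gt0.
(* The finitely many [j < 2 b + 2] each require [M] large. For the others [rat j <= q^(b - j)]
   suffices once [q^M >= 2], as then [2 (b - j) + j + 1 <= 0]. *)
have [M1 M1P] : exists M0, forall M, (M0 <= M)%N -> forall j, (j < b.*2.+2)%N ->
    (j0 < j)%N -> rat j ^+ (q ^ M) * Q ^+ j.+1 <= 1.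
  apply: (finite_eventually (P := fun j M => (j0 < j)%N ->
    rat j ^+ (q ^ M) * Q ^+ j.+1 <= 1)) => j jb.
  have [j0j|] := ltnP j0 j; last by exists 0%N.
  have ratj : 0 <= rat j < 1 by rewrite rat0 ltr_pdivrMr // mul1r j0last.
  have Qj : 0 < (Q ^+ j.+1)^-1 by rewrite invr_gt0 QX_gt0.
  have [M1 M1P] := expr_small ratj Qj; exists M1 => M M1M _.
  rewrite -ler_pdivlMr ?QX_gt0 // mul1r ltW // M1P // (leq_trans M1M) //.
  exact/ltnW/ltn_qX.
exists M1.+1 => M M1M y Hy.
have qM2 : (2 <= q ^ M)%N by apply: leq_trans (ltn_qX F M); rewrite ltnS (leq_trans _ M1M).
have qM0 := qX_gt0 F M.
have small j : (j0 < j)%N -> rat j ^+ (q ^ M) * Q ^+ j.+1 <= 1.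
  have [jb|bj] := ltnP j b.*2.+2; first by apply: M1P => //; apply: ltnW.
  move=> _; have Qj := QX_gt0 F R.
  have rj : rat j <= Q ^+ b / Q ^+ j by rewrite ler_pdivlMr.
  apply: (@le_trans _ _ ((Q ^+ b / Q ^+ j) ^+ 2 * Q ^+ j.+1)).
    rewrite ler_pM2r //; apply: (@le_trans _ _ ((Q ^+ b / Q ^+ j) ^+ (q ^ M))).
      by apply: lerXn2r; rewrite ?nnegrE // divr_ge0 // ltW.
    apply: ler_wiXn2l => //; first by rewrite divr_ge0 // ltW.
    by rewrite ler_pdivrMr // mul1r ler_QX //; lia.
  have -> : (Q ^+ b / Q ^+ j) ^+ 2 * Q ^+ j.+1 = Q ^+ (b.*2).+1 / Q ^+ j.
    have Qj0 : Q ^+ j != 0 by rewrite gt_eqF.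
    by rewrite -addnn !exprS exprD; field.
  by rewrite ler_pdivrMr // mul1r ler_QX //; lia.
pose m := (q ^ M)%N.
pose L := r ^+ m * Q ^+ j0.
have L0 : 0 < L by rewrite mulr_gt0 ?(exprn_gt0 _ r0) ?QX_gt0.
have termE j : N (ps_map (frob M) E j * th ^+ j) = N (E j) ^+ m * Q ^+ j.
  by rewrite cabsM cabs_thX /ps_map cabs_frob.
have EjE j : N (E j) ^+ m = rat j ^+ m * r ^+ m.
  by rewrite -exprMn /rat divfK // gt_eqF.
have other j : j != j0 -> N (ps_map (frob M) E j * th ^+ j) <= L / Q.
  rewrite termE neq_ltn => /orP[jj0|j0j].
    rewrite ler_pdivlMr ?Q_gt0 // -mulrA -exprSr ler_pM ?exprn_ge0 ?cabs_ge0 ?ler0n //.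
      by apply: lerXn2r; rewrite ?nnegrE ?cabs_ge0 // ltW.
    exact: ler_QX.
  rewrite EjE ler_pdivlMr ?Q_gt0 // -[X in X <= _]mulrA -[Q ^+ j * Q]exprSr.
  rewrite [rat j ^+ m * _]mulrC -mulrA /L ler_pM2l ?exprn_gt0 //.
  by apply: le_trans (small j j0j) _; apply: QX_ge1.
(* Without its dominant term the series has value at most [L / Q], less than the size [L] of that
   term. *)
have H : evalto th (ps_map (frob M) E - poly_ps ((frob M (E j0))%:P * 'X^j0))
    (y - frob M (E j0) * th ^+ j0).
  by apply: evaltoB Hy _; have := evalto_poly th ((frob M (E j0))%:P * 'X^j0);
     rewrite hornerM hornerC hornerXn.
have yle : N (y - frob M (E j0) * th ^+ j0) <= L / Q.
  apply: (is_sum_le H) => j; rewrite psB /poly_ps coefCM coefXn.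
  have [->|jj0] := eqVneq j j0.
    by rewrite mulr1 subrr mul0r cabs0 divr_ge0 ?ltW ?Q_gt0.
  by rewrite mulr0 subr0; apply: other.
apply/negP => /eqP y0; move: yle; rewrite y0 sub0r cabsN.
have := termE j0; rewrite /ps_map => ->; rewrite -/r -/L leNgt; case/negP.
by rewrite ltr_pdivrMr ?Q_gt0 // ltr_pMr // Q_gt1.
Qed.

End PowerIndependence.

(** * Construction of the auxiliary function *)

Lemma sum_pair (V : nmodType) (A B : finType) (f : A * B -> V) :
  \sum_i f i = \sum_a \sum_b f (a, b).
Proof. by rewrite pair_bigA; apply: eq_bigr => -[a b]. Qed.

Section AuxiliaryFunction.
Variables (F : finFieldType) (R : realType) (C : Cinfty F R).
Local Notation q := #|F|.
Local Notation Q := (#|F|%:R : R).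
Local Notation N := (abs C).
Local Notation th := (theta C).
Local Notation iota := (Fq_to_C C).
Local Notation CA := (restrict_scalars (@A_to_C F R C)).
Implicit Types (x y s : C) (g Y G : ps C).

(** Boundedness on [|t| <= q] makes the coefficients decay, so only finitely many can come close to
    1 and the bound is uniform. *)
Lemma sup_lt1 Y (B : R) : (forall j, N (Y j) < 1) -> gauss_bd Q B Y ->
  exists2 lam, 0 <= lam < 1 & forall j, N (Y j) <= lam.
Proof.
move=> Y1 YB; have [K KP] := expr_unbounded (B * Q) (Q_gt1 F R).
have tail j : (K <= j)%N -> N (Y j) <= Q^-1.
  move=> /KP BQ; rewrite -[Q^-1]mul1r ler_pdivlMr ?Q_gt0 //.
  have Qj := QX_gt0 F R j; rewrite -(ler_pM2r Qj) mul1r mulrAC.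
  by apply: le_trans (ltW BQ); rewrite ler_wpM2r ?ler0n // YB.
have Q1 : 0 <= Q^-1 < 1 by rewrite invr_ge0 ler0n invf_lt1 ?Q_gt0 ?Q_gt1.
have [lam lam01 lamP] : exists2 lam, Q^-1 <= lam < 1 & forall j, (j < K)%N -> N (Y j) <= lam.
  elim: K {KP tail} => [|K [lam /andP[l0 l1] lP]].
    by exists Q^-1 => //; rewrite lexx; case/andP: Q1.
  exists (Num.max lam (N (Y K))); first by rewrite le_max l0 gt_max l1 Y1.
  move=> j; rewrite ltnS leq_eqVlt le_max => /predU1P[->|/lP->//].
  by rewrite lexx orbT.
case/andP: lam01 => l0 l1; case/andP: Q1 => Q0 _; exists lam; first by rewrite (le_trans Q0).
by move=> j; have [/lamP//|/tail Yj] := ltnP j K; apply: le_trans Yj l0.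
Qed.

Definition ps_Kspan w (f : ps C) := forall k, Kspan w (f k).

Lemma ps_KspanM w f g : Kalg w -> ps_Kspan w f -> ps_Kspan w g -> ps_Kspan w (f * g).
Proof. by move=> [_ wM] fw gw k; rewrite psM; apply: Kspan_sum => i _; apply: wM. Qed.

Lemma ps_KspanX w f k : Kalg w -> ps_Kspan w f -> ps_Kspan w (f ^+ k).
Proof.
move=> wA fw; elim: k => [|k IH]; last by rewrite exprS; apply: ps_KspanM.
move=> [|k]; rewrite expr0 ps1; [by case: wA|exact: Kspan0].
Qed.

Lemma ps_Kspan_inv_lin w : Kalg w -> ps_Kspan w (inv_lin th).
Proof.
move=> wA k; have X0 : 'X ^+ k.+1 != 0 :> {poly F} by rewrite expf_neq0 // polyX_eq0.
apply: (Kspan_div X0); rewrite rmorphXn /= A_to_CX /inv_lin mulrN -exprMn.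
rewrite mulfV ?th_neq0 // expr1n -(rmorph1 (@A_to_C F R C)) -rmorphN; exact: Kspan_A.
Qed.

Lemma quot_ps_Kspan w (h : {poly C}) n : Kalg w ->
  (forall l, Kspan w h`_l) -> ps_Kspan w (quot_ps h n).
Proof.
by move=> wA hw; apply: ps_KspanM => //; apply: ps_KspanX => //; apply: ps_Kspan_inv_lin.
Qed.

(** [AS_ps Y] without its [M]-th twist. Unlike those of [AS_ps Y], its coefficients stay in the
    extension that contains those of [Y]. *)
Definition approx Y M : ps C := \sum_(i < M) ps_map (frob i.+1) Y.

Lemma approx_Kspan w Y M : Kalg w -> ps_Kspan w Y -> ps_Kspan w (approx Y M).
Proof.
by move=> wA Yw k; rewrite /approx ps_sum; apply: Kspan_sum => i _; apply: Kalg_exp.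
Qed.

Lemma gauss_bd1P A (f : ps C) : gauss_bd 1 A f <-> forall j, N (f j) <= A.
Proof. by split=> H j; have := H j; rewrite expr1n mulr1. Qed.

Lemma approx_gauss_bd Y M : (forall j, N (Y j) < 1) -> gauss_bd 1 1 (approx Y M).
Proof.
move=> Y1; apply/gauss_bd1P => j; rewrite /approx ps_sum; apply: cabs_sum_le => // i _.
by rewrite /ps_map cabs_frob exprn_ile1 ?cabs_ge0 // ltW.
Qed.

Lemma AS_ps_gauss_bd1 Y : (forall j, N (Y j) < 1) -> gauss_bd 1 1 (AS_ps Y).
Proof.
move=> Y1; apply/gauss_bd1P => j; apply: le_trans (AS_ps_le (Y1 j)) _.
by rewrite exprn_ile1 ?cabs_ge0 // ltW.
Qed.

Lemma AS_ps_gauss_bd Y (B : R) : (forall j, N (Y j) < 1) -> gauss_bd Q B Y -> gauss_bd Q B (AS_ps Y).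
Proof.
move=> Y1 YB j; apply: le_trans (YB j); rewrite ler_wpM2r ?exprn_ge0 ?ler0n //.
apply: le_trans (AS_ps_le (Y1 j)) _; rewrite expr2 ler_piMr ?cabs_ge0 //; exact: ltW.
Qed.

(** The difference of powers has the factor [AS_ps Y - approx Y M], the [M]-th twist of [AS_ps Y],
    which is at most [lam ^+ (q ^ M)]; the cofactor is at most 1. *)
Lemma approx_close Y M (lam : R) k : (forall j, N (Y j) < 1) -> 0 <= lam < 1 ->
  (forall j, N (Y j) <= lam) ->
  gauss_bd 1 (lam ^+ (q ^ M)) (AS_ps Y ^+ k - approx Y M ^+ k).
Proof.
move=> Y1 /andP[l0 l1] Yl; rewrite subrXX -[lam ^+ _]mulr1; apply: gauss_bdM => //.
  rewrite -AS_ps_frob //; apply/gauss_bd1P => j; rewrite /ps_map cabs_frob.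
  apply: lerXn2r; rewrite ?nnegrE ?cabs_ge0 //; apply: le_trans (AS_ps_le (Y1 j)) _.
  by apply: le_trans (Yl j); rewrite expr2 ler_piMr ?cabs_ge0 // ltW.
apply: gauss_bd_sum => // i _.
have gX : gauss_bd 1 1 (AS_ps Y ^+ (k.-1 - i)).
  by have := gauss_bdX (k.-1 - i) ltr01 (AS_ps_gauss_bd1 Y1); rewrite expr1n.
have aX : gauss_bd 1 1 (approx Y M ^+ i).
  by have := gauss_bdX i ltr01 (approx_gauss_bd M Y1); rewrite expr1n.
by have := gauss_bdM ltr01 gX aX; rewrite mulr1.
Qed.

Section Box.
Variables (w : seq C) (kap D T V c0 : nat).
Local Notation d := (size w).
Local Notation J := (D + T + c0 * kap + V)%N.
Local Notation I := ('I_kap.+1 * ('I_T * ('I_D * 'I_d)))%type.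

(** The unknown polynomials [P_k], [k <= kap], are [F]-combinations of [theta^a w_i t^l] with
    [a < D] and [l < T]. [q^c0] bounds the Gauss norm of [Y] on [|t| <= q]; from index [J] on, the
    coefficients of the auxiliary function are then at most [q^(-V)] automatically. *)
Definition mono (m : 'I_T * ('I_D * 'I_d)) : {poly C} :=
  (th ^+ m.2.1 * w`_m.2.2)%:P * 'X^(m.1).

Definition cpoly (c : I -> F) (k : 'I_kap.+1) : {poly C} :=
  \sum_m (iota (c (k, m)))%:P * mono m.

Definition auxE (c : I -> F) G : ps C := \sum_k poly_ps (cpoly c k) * G ^+ k.

Definition auxterm G (i : I) : ps C := poly_ps (mono i.2) * G ^+ i.1.

Lemma auxE_Fcomb c G j : auxE c G j = \sum_i iota (c i) * auxterm G i j.
Proof.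
transitivity ((\sum_(i : I) poly_ps (iota (c i))%:P * auxterm G i) j).
  rewrite sum_pair.
  congr (_ j); apply: eq_bigr => k _; rewrite /cpoly rmorph_sum mulr_suml.
  by apply: eq_bigr => m _; rewrite rmorphM mulrA.
by rewrite ps_sum; apply: eq_bigr => i _; rewrite ps_CM.
Qed.

Lemma cpoly_coef c k (l : 'I_T) :
  (cpoly c k)`_l = \sum_(i < d) A_to_C C (\sum_(a < D) (c (k, (l, (a, i))))%:P * 'X^a) * w`_i.
Proof.
rewrite /cpoly coef_sum.
transitivity (\sum_(m : 'I_T * ('I_D * 'I_d) | m.1 == l)
    iota (c (k, m)) * (th ^+ m.2.1 * w`_m.2.2)).
  rewrite [RHS]big_mkcond /=; apply: eq_bigr => m _.
  rewrite coefCM /mono coefCM coefXn [_ == m.1 :> nat]eq_sym -val_eqE /=.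
  by case: (_ == _); rewrite ?mulr1 ?mulr0.
transitivity (\sum_(l' | l' == l) \sum_(m : 'I_D * 'I_d)
    iota (c (k, (l', m))) * (th ^+ m.1 * w`_m.2)).
  by rewrite pair_big_dep /=; apply: eq_big => [[l' m]|[l' m] _] //=; rewrite andbT.
rewrite big_pred1_eq sum_pair /=.
rewrite exchange_big; apply: eq_bigr => i _ /=.
rewrite rmorph_sum mulr_suml; apply: eq_bigr => a _.
by rewrite rmorphM rmorphXn /= A_to_CC A_to_CX mulrA.
Qed.

Lemma cpoly_neq0 c : lin_indep (w : seq CA) -> (exists i, c i != 0) ->
  exists k, cpoly c k != 0.
Proof.
move=> wi [[k [l [a i]]] ci]; exists k; apply: contra_neq ci => ck0.
have := cpoly_coef c k l; rewrite ck0 coef0 => /esym E.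
have := wi (fun i => \sum_(a < D) (c (k, (l, (a, i))))%:P * 'X^a) E i.
move/(congr1 (fun p : {poly F} => p`_a)); rewrite coef0 coef_sum (bigD1 a) //=.
rewrite coefCM coefXn eqxx mulr1 big1 ?addr0 // => a' a'a.
by rewrite coefCM coefXn val_eqE eq_sym (negPf a'a) mulr0.
Qed.

Hypothesis w1 : {in w, forall y, N y <= 1}.

Lemma cabs_mono_coef (a : 'I_D) (i : 'I_d) : N (th ^+ a * w`_i) <= Q ^+ D.-1.
Proof.
rewrite cabsM cabs_thX -[X in _ <= X]mulr1 ler_pM ?exprn_ge0 ?ler0n ?cabs_ge0 //.
  by apply: ler_QX; rewrite -ltnS (ltn_predK (ltn_ord a)) ltn_ord.
by apply: w1; rewrite mem_nth.
Qed.

Lemma mono_gauss_bd1 m : gauss_bd 1 (Q ^+ D.-1) (poly_ps (mono m)).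
Proof.
apply/gauss_bd1P => j; rewrite /poly_ps /mono coefCM coefXn.
by case: (_ == _); rewrite ?mulr1 ?mulr0 ?cabs0 ?exprn_ge0 ?ler0n ?cabs_mono_coef.
Qed.

Lemma mono_gauss_bdQ m : gauss_bd Q (Q ^+ (D.-1 + T)) (poly_ps (mono m)).
Proof.
move=> j; rewrite /poly_ps /mono coefCM coefXn; have [->|_] := eqVneq j m.1; last first.
  by rewrite mulr0 cabs0 mul0r exprn_ge0 ?ler0n.
rewrite mulr1 exprD ler_pM ?cabs_ge0 ?exprn_ge0 ?ler0n ?cabs_mono_coef //.
exact/ler_QX/ltnW.
Qed.

Lemma auxterm_gauss_bdQ G i : gauss_bd Q (Q ^+ c0) G ->
  gauss_bd Q (Q ^+ (D + T + c0 * kap)) (auxterm G i).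
Proof.
move=> GQ; apply: (gauss_bd_le (A := Q ^+ (D.-1 + T) * Q ^+ (c0 * i.1))).
  rewrite -exprD ler_QX // !leq_add ?leq_pred // leq_mul // -ltnS; exact: ltn_ord.
by apply: gauss_bdM; [exact: Q_gt0|exact: mono_gauss_bdQ|rewrite exprM; apply: gauss_bdX => //; exact: Q_gt0].
Qed.

Lemma auxE_gauss_bdQ c G : gauss_bd Q (Q ^+ c0) G ->
  gauss_bd Q (Q ^+ (D + T + c0 * kap)) (auxE c G).
Proof.
move=> GQ j; rewrite auxE_Fcomb -ler_pdivlMr ?QX_gt0 //; apply: cabs_sum_le => [|i _].
  by rewrite divr_ge0 ?exprn_ge0 ?ler0n.
rewrite ler_pdivlMr ?QX_gt0 //; apply: le_trans (auxterm_gauss_bdQ i GQ j).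
rewrite ler_wpM2r ?exprn_ge0 ?ler0n // cabsM ler_piMl ?cabs_ge0 //; exact: cabs_Fq_le.
Qed.

(* Pigeonhole on the approximants, whose coefficients lie in a space of finite
   dimension over [K]. *)
Lemma aux_exists Y : lin_indep (w : seq CA) -> Kalg w -> (0 < D)%N ->
  (d * J * (D + V) < kap.+1 * (T * (D * d)))%N ->
  (forall j, N (Y j) < 1) -> gauss_bd Q (Q ^+ c0) Y -> ps_Kspan w Y ->
  exists2 c, exists i, c i != 0 &
    (forall j, (j < J)%N -> N (auxE c (AS_ps Y) j) * Q ^+ V <= 1).
Proof.
move=> wi wA D0 count Y1 YQ Yw.
have [lam lam01 Yl] := sup_lt1 Y1 YQ.
have QDV : 0 < (Q ^+ (D + V))^-1 by rewrite invr_gt0 QX_gt0.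
(* The error [q^D * lam^(q^M)] of replacing [g] by its approximant must stay below [q^(-V)]. *)
have [M MP] := expr_small lam01 QDV.
have lamM : lam ^+ (q ^ M) * Q ^+ (D + V) < 1.
  by rewrite -ltr_pdivlMr ?QX_gt0 // mul1r MP // ltnW // ltn_qX.
pose G := approx Y M.
have mono_w m : ps_Kspan w (poly_ps (mono m)).
  move=> j; rewrite /poly_ps /mono coefCM coefXn.
  case: (_ == _); rewrite ?mulr1 ?mulr0; last exact: Kspan0.
  have -> : th ^+ m.2.1 = A_to_C C ('X ^+ m.2.1) by rewrite rmorphXn /= A_to_CX.
  by apply: KspanZ; apply: Kspan_mem; apply: mem_nth.
have zw (i : I) (j : 'I_J) : Kspan w (auxterm G i j).
  by apply: ps_KspanM => //; apply: ps_KspanX => //; apply: approx_Kspan.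
have zr (i : I) (j : 'I_J) : N (auxterm G i j) < Q ^+ D.
  apply: (@le_lt_trans _ _ (Q ^+ D.-1)); last by rewrite ltr_eXn2l ?Q_gt1 // prednK.
  have /gauss_bd1P := gauss_bdM ltr01 (mono_gauss_bd1 i.2) (gauss_bdX i.1 ltr01 (approx_gauss_bd M Y1)).
  by rewrite expr1n mulr1; apply.
have cI : (d * J * (D + V) < #|{: I}|)%N by rewrite !card_prod !card_ord.
(* The terms start below [q^D] and must end below [q^(-V)], hence [D + V] levels. *)
have [c cn0 cE] := small_combination (QX_gt0 F R D) zw zr cI.
exists c => // j jJ.
have Ej : N (auxE c G j) * Q ^+ V <= 1.
  have := cE (Ordinal jJ); rewrite /Fcomb -auxE_Fcomb exprD => H.
  have := QX_gt0 F R D => QD; rewrite -(ler_pM2l QD) mulr1 mulrCA; exact: ltW.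
have -> : auxE c (AS_ps Y) j = auxE c G j +
    \sum_k (poly_ps (cpoly c k) * (AS_ps Y ^+ k - G ^+ k)) j.
  rewrite -(ps_sum _ _ (fun k : 'I_kap.+1 => poly_ps (cpoly c k) * (AS_ps Y ^+ k - G ^+ k))).
  rewrite -psD; congr (_ j); rewrite -big_split /=.
  by apply: eq_bigr => k _; rewrite mulrBr addrC subrK.
rewrite -ler_pdivlMr ?QX_gt0 //; apply: cabsD_le; first by rewrite ler_pdivlMr ?QX_gt0.
apply: cabs_sum_le => [|k _]; first by rewrite divr_ge0 ?exprn_ge0 ?ler0n.
rewrite ler_pdivlMr ?QX_gt0 //.
have cpoly1 : gauss_bd 1 (Q ^+ D) (poly_ps (cpoly c k)).
  apply/gauss_bd1P => l; rewrite /poly_ps /cpoly coef_sum; apply: cabs_sum_le => [|m _].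
    by rewrite exprn_ge0 ?ler0n.
  rewrite coefCM cabsM -[Q ^+ D]mul1r ler_pM ?cabs_ge0 ?cabs_Fq_le //.
  have /gauss_bd1P/(_ l) := mono_gauss_bd1 m; move/le_trans; apply; apply: ler_QX.
  exact: leq_pred.
have /gauss_bd1P/(_ j) H := gauss_bdM ltr01 cpoly1 (approx_close M k Y1 lam01 Yl).
apply: (@le_trans _ _ (Q ^+ D * lam ^+ (q ^ M) * Q ^+ V)).
  by apply: ler_wpM2r; [rewrite exprn_ge0 ?ler0n|exact: H].
by rewrite mulrAC -exprD mulrC ltW.
Qed.

End Box.

End AuxiliaryFunction.

(** * Transcendence of the values *)

(** The final comparison of exponents: [X] comes from Liouville's inequality, [Y] from the
    denominators, and [A + Z] is the gain [V * q ^ M]. *)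
Lemma exponent_bound (A B X Y Z W m J : nat) : (X <= A + B)%N -> (B <= W)%N ->
  (Y + m <= Z)%N -> (J + W < m)%N -> (Y + X + J < A + Z)%N.
Proof. by lia. Qed.

Section Transcendence.
Variables (F : finFieldType) (R : realType) (C : Cinfty F R).
Local Notation q := #|F|.
Local Notation Q := (#|F|%:R : R).
Local Notation N := (abs C).
Local Notation th := (theta C).
Local Notation iota := (Fq_to_C C).
Local Notation CA := (restrict_scalars (@A_to_C F R C)).
Implicit Types (x y s : C).

(** For elements of [A] one degree bound controls both the height, over any [w], and the absolute
    value; denominators are kept in this form. *)
Definition A_bd (H : nat) x := exists2 a : {poly F}, (size a <= H.+1)%N & x = A_to_C C a.

Lemma A_bd_rep w H x : A_bd H x -> rep w H x.
Proof. by move=> [a aH ->]; apply: rep_A. Qed.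

Lemma A_bd_abs H x : A_bd H x -> N x <= Q ^+ H.
Proof. by move=> [a aH ->]; apply: cabs_A_le. Qed.

Lemma A_bd_le H H' x : (H <= H')%N -> A_bd H x -> A_bd H' x.
Proof. by move=> HH [a aH ->]; exists a => //; apply: leq_trans aH _. Qed.

Lemma A_bdM H H' x y : A_bd H x -> A_bd H' y -> A_bd (H + H') (x * y).
Proof.
move=> [a aH ->] [b bH ->]; exists (a * b); last by rewrite rmorphM.
apply: leq_trans (size_polyMleq _ _) _.
by rewrite -subn1 leq_subLR (leq_trans (leq_add aH bH)) // addSn addnS add1n.
Qed.

Lemma A_bd1 : A_bd 0 1.
Proof. by exists 1; rewrite ?size_poly1 ?rmorph1. Qed.

Lemma A_bdX H x k : A_bd H x -> A_bd (H * k) (x ^+ k).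
Proof.
by move=> xH; elim: k => [|k IH]; rewrite ?muln0 ?mulnS ?exprS; [exact: A_bd1|exact: A_bdM].
Qed.

Lemma A_bd_prod (I : Type) (r : seq I) (P : pred I) (e : I -> nat) (f : I -> C) :
  (forall i, P i -> A_bd (e i) (f i)) ->
  A_bd (\sum_(i <- r | P i) e i) (\prod_(i <- r | P i) f i).
Proof. by move=> H; apply: big_ind2 => // [|*]; [exact: A_bd1|exact: A_bdM]. Qed.

Lemma A_bd_th_frob i : A_bd (q ^ i.+1) (th - frob i.+1 th).
Proof.
exists ('X - 'X^(q ^ i.+1)); last by rewrite rmorphB rmorphXn /= A_to_CX.
apply: leq_trans (size_polyD _ _) _; rewrite size_polyN size_polyXn size_polyX geq_max leqnn.
by rewrite !ltnS qX_gt0.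
Qed.

(** The product of all denominators of [partial_sum] thus has degree of the same order [q ^ M] as
    the last one. *)
Lemma sum_qX M : (\sum_(i < M) q ^ i.+1 <= 2 * q ^ M)%N.
Proof.
elim: M => [|M IH]; first by rewrite big_ord0.
rewrite big_ord_recr /= mul2n -addnn leq_add2r; apply: leq_trans IH _.
by rewrite expnS leq_mul2r q_gt1 orbT.
Qed.

Section Denominators.
Variables (w : seq C) (h : {poly C}) (n : nat) (s dl : C) (H0 : nat).
Hypothesis dl_bd : A_bd H0 dl.
Hypothesis s_rep : rep w H0 (dl * s).
Hypothesis h_rep : forall l, rep w H0 (dl * h`_l).

Definition den M : C := \prod_(i < M) (th - frob i.+1 th) ^+ n.

(** The predicate allows one factor to be left out, as when [den M] clears a single term of
    [partial_sum]. *)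
Lemma den_bd M (P : pred 'I_M) :
  A_bd (2 * n * q ^ M) (\prod_(i < M | P i) (th - frob i.+1 th) ^+ n).
Proof.
have fac_bd (i : 'I_M) : P i -> A_bd (q ^ i.+1 * n) ((th - frob i.+1 th) ^+ n).
  by move=> _; apply: A_bdX; apply: A_bd_th_frob.
apply: A_bd_le (A_bd_prod (index_enum _) fac_bd).
apply: (@leq_trans (\sum_(i < M) q ^ i.+1 * n)).
  by rewrite big_mkcond leq_sum // => i _; case: (P i).
by rewrite -big_distrl /= [X in (_ <= X)%N]mulnAC leq_mul2r sum_qX orbT.
Qed.

Lemma rep_dlX_frob i M x : (i <= M)%N -> rep w H0 (dl * x) ->
  rep w (H0 * q ^ M) (dl ^+ (q ^ M) * frob i x).
Proof.
move=> iM xr; have qiM : (q ^ i <= q ^ M)%N by rewrite leq_exp2l ?q_gt1.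
have -> : dl ^+ (q ^ M) * frob i x = dl ^+ (q ^ M - q ^ i) * frob i (dl * x).
  by rewrite rmorphM /= [frob i dl]frobE mulrA -exprD subnK.
rewrite -[(q ^ M)%N](subnK qiM) mulnDr; apply: repM.
  by rewrite subnK //; apply: A_bd_rep; apply: A_bdX.
exact: rep_frob.
Qed.

Lemma th_frob_subr_neq0 i : th - frob i.+1 th != 0 :> C.
Proof.
rewrite subr_eq0 -{1}[th](frob0 th); apply/negP => /eqP.
by move/cabs_frob_th_inj.
Qed.

(** With [s = g(theta)] the last factor is [g^(M)(theta)]. The height is linear in [q ^ M]; the
    powers of [theta] from evaluating [h] are not twisted and add only [size h]. *)
Lemma rep_tau M : rep w ((2 * n + H0) * q ^ M + size h)
  (den M * dl ^+ (q ^ M) * (s - partial_sum h n M)).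
Proof.
rewrite mulrBr; apply: repD; last apply: repN.
  rewrite -mulrA mulnDl -addnA; apply: repM; first exact/A_bd_rep/den_bd.
  apply: (@rep_le _ _ _ _ (H0 * q ^ M)); first exact: leq_addr.
  by rewrite -[s](frob0 s); apply: rep_dlX_frob; rewrite // frob0.
rewrite /partial_sum mulr_sumr; apply: rep_sum => i _.
have -> : den M * dl ^+ (q ^ M) * ((map_poly (frob i.+1) h).[th] * (th - frob i.+1 th)^-1 ^+ n)
  = (\prod_(i' < M | i' != i) (th - frob i'.+1 th) ^+ n) *
    (dl ^+ (q ^ M) * (map_poly (frob i.+1) h).[th]).
  rewrite /den (bigD1 i) //=; move: (\prod_(_ | _) _) => D.
  have fn : (th - frob i.+1 th) ^+ n != 0 by rewrite expf_neq0 // th_frob_subr_neq0.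
  rewrite exprVn; set f := _ ^+ n in fn *; move: (dl ^+ _) (_.[th]) => a b.
  by field.
rewrite mulnDl -addnA; apply: repM; first exact/A_bd_rep/den_bd.
rewrite horner_coef size_map_poly mulr_sumr; apply: rep_sum => l _.
rewrite coef_map mulrA; apply: repM; first exact: rep_dlX_frob.
by apply: rep_le (rep_th w l); apply: ltnW.
Qed.

Lemma rep_cpoly kap D T c (k : 'I_kap.+1) M : (forall i, rep w H0 (dl * w`_i)) ->
  rep w ((D + H0) * q ^ M + T)
    (dl ^+ (q ^ M) *
     (map_poly (frob M) (cpoly (w := w) (kap := kap) (D := D) (T := T) c k)).[th]).
Proof.
move=> w_rep; rewrite /cpoly rmorph_sum horner_sum mulr_sumr; apply: rep_sum => m _.
have -> : dl ^+ (q ^ M) * (map_poly (frob M) ((iota (c (k, m)))%:P * mono m)).[th] =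
    iota (c (k, m)) *
    (th ^+ (m.2.1 * q ^ M) * (dl ^+ (q ^ M) * frob M w`_(m.2.2)) * th ^+ m.1).
  rewrite /mono !rmorphM rmorphXn /= !map_polyC map_polyX !hornerM !hornerC horner_exp hornerX.
  rewrite /= frob_Fq [frob M (_ ^+ _)]frobE -exprM.
  move: (iota _) (dl ^+ _) (frob M _) (th ^+ _) (th ^+ _) => a b e f g.
  by ring.
rewrite -[X in rep w X]add0n; apply: repM; first exact: rep_Fq.
apply: repM; last by apply: rep_le (rep_th w m.1); apply: ltnW.
rewrite mulnDl; apply: repM; last exact: rep_dlX_frob.
apply: rep_le (rep_th w _); rewrite leq_mul2r; apply/orP; right; exact: ltnW.
Qed.

End Denominators.

Lemma uniform_rep w (u : seq C) : Kalg w -> {in u, forall y, Kspan w y} ->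
  exists (dl : {poly F}) (H0 : nat), [/\ dl != 0, (size dl <= H0.+1)%N &
    {in u, forall y, rep w H0 (A_to_C C dl * y)}].
Proof.
move=> wA uw.
have [dl dl0 dlP] : exists2 dl : {poly F}, dl != 0 &
    {in u, forall y, exists H, rep w H (A_to_C C dl * y)}.
  apply: (common_multiplier (P := fun y a => exists H, rep w H (A_to_C C a * y))).
    move=> y a b [H yH]; exists (size b + H)%N; rewrite rmorphM -mulrA.
    by apply: repM => //; apply: rep_A.
  by move=> y /uw yw; apply: Kspan_rep.
have [H1 H1P] : exists H1, {in u, forall y, rep w H1 (A_to_C C dl * y)}.
  elim: u {uw} dlP => [|y u IH] dlP; first by exists 0%N.
  have [H yH] := dlP y (mem_head _ _).
  have [|H' H'P] := IH; first by move=> z zu; apply: dlP; rewrite inE zu orbT.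
  exists (H + H')%N => z; rewrite inE => /predU1P[->|/H'P].
    by apply: rep_le yH; rewrite leq_addr.
  by apply: rep_le; rewrite leq_addl.
exists dl, (size dl + H1)%N; split=> //; first by rewrite ltnW // ltnS leq_addr.
by move=> y /H1P; apply: rep_le; rewrite leq_addl.
Qed.

Theorem transcendence (h : {poly C}) n s : (0 < n)%N -> h.[th] != 0 ->
  (forall l, h`_l \in @Kbar_pred F R C) ->
  (forall j, N (quot_ps h n j) < 1) ->
  evalto th (AS_ps (quot_ps h n)) s -> s \notin @Kbar_pred F R C.
Proof.
move=> n0 hth hK Y1 Hs; apply/negP => sK; set Y := quot_ps h n; set g := AS_ps Y.
have [w [wi w1 wA wxs]] : exists w, [/\ lin_indep (w : seq CA), {in w, forall y, N y <= 1},
    Kalg w & {in s :: (h : seq C), forall x, Kspan w x}].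
  by apply: Kalg_basis => x; rewrite inE => /predU1P[->//|/(nthP 0)[i _ <-]].
have [dlp [H0 [dlp0 dlpH dl_rep]]] := uniform_rep (u := w ++ s :: h) wA (ltac:(
  by move=> y; rewrite mem_cat => /orP[/Kspan_mem//|/wxs])).
pose dl := A_to_C C dlp; pose d := size w.
have d0 : (0 < d)%N.
  rewrite lt0n; apply/negP => /eqP/size0nil w0; case: wA => -[a a0 [c E]] _; move: E.
  rewrite /lin_comb big1 => [/eqP|[i Hi] _]; last by exfalso; move: Hi; rewrite w0.
  by rewrite scaleAE mulr1 A_to_C_eq0 (negPf a0).
have dl_bd : A_bd H0 dl by exists dlp.
have s_rep : rep w H0 (dl * s) by apply: dl_rep; rewrite mem_cat mem_head orbT.
have rep_nth (u : seq C) l : {subset u <= w ++ s :: h} -> rep w H0 (dl * u`_l).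
  move=> uw; have [lu|ul] := ltnP l (size u); first by apply/dl_rep/uw/mem_nth.
  by rewrite nth_default // mulr0; apply: rep0.
have h_rep l : rep w H0 (dl * h`_l).
  by apply: rep_nth => x xh; rewrite mem_cat inE xh !orbT.
have w_rep l : rep w H0 (dl * w`_l).
  by apply: rep_nth => x xh; rewrite mem_cat xh.
have hw l : Kspan w h`_l.
  have [lh|hl] := ltnP l (size h); last by rewrite nth_default //; apply: Kspan0.
  by apply: wxs; rewrite inE mem_nth ?orbT.
have [B B0 YB] := quot_ps_gauss_bd h n.
have [c0 c0P] := QX_bound F B.
have YQ : gauss_bd Q (Q ^+ c0) Y := gauss_bd_le c0P YB.
have gQ : gauss_bd Q (Q ^+ c0) g := AS_ps_gauss_bd Y1 YQ.
(* [kap > 2 * d] leaves room in [count] for [V] to exceed the Liouville exponent,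
   about [2 * d * D] after division by [q ^ M]; the degree [T] in [t] is not
   multiplied by [q ^ M], so it may be large. *)
pose H1 := (2 * n + H0 + size h)%N.
pose kap := (2 * d + 1)%N.
(* [D - 1] is the exponent, per [q ^ M], of the multiplier [dl ^+ m * r ^+ kap] below. The height
   will be at most [2 * D] per [q ^ M], so [V] covers [d - 1] times the height and leaves [2 * D]
   for the multiplier. *)
pose D := (H0 + kap * H1 + 1)%N.
pose V := (2 * d * D)%N.
(* [X] is [J - T], so that [count] amounts to [X * (2 * d + 1) < T]. *)
pose X := ((2 * d + 1) * D + c0 * kap)%N.
pose T := ((2 * d + 1) * X + 1)%N.
pose J := (D + T + c0 * kap + V)%N.
have count : (d * J * (D + V) < kap.+1 * (T * (D * d)))%N.
  have -> : (d * J * (D + V) = d * D * (J * (2 * d + 1)))%N by rewrite /V; ring.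
  have -> : (kap.+1 * (T * (D * d)) = d * D * (T * (2 * d + 2)))%N by rewrite /kap; ring.
  rewrite ltn_mul2l muln_gt0 d0 /= /D addn1 /=.
  have -> : J = (T + X)%N by rewrite /J /X /V /D; ring.
  have : (X * (2 * d + 1) < T)%N by rewrite /T; lia.
  by lia.
have D0 : (0 < D)%N by rewrite /D addn1.
have [c cn0 Esmall] := aux_exists w1 wi wA D0 count Y1 YQ (quot_ps_Kspan n wA hw).
pose E := auxE c g.
have EQ : gauss_bd Q (Q ^+ (D + T + c0 * kap)) E := auxE_gauss_bdQ w1 c gQ.
have E0 : E != 0.
  have [k /eqP ck] := cpoly_neq0 wi cn0; apply/eqP => E0; apply: ck.
  pose P k' := if insub k' is Some k then cpoly c k else 0.
  have PE (k' : 'I_kap.+1) : P k' = cpoly c k' by rewrite /P valK.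
  rewrite -PE; apply: (powers_independent n0 hth Y1 Hs) (ltn_ord k).
  by rewrite -[RHS]E0; apply: eq_bigr => k' _; rewrite PE.
have [M0 M0P] := frob_eval_neq0 EQ E0.
(* [M0] secures [y <> 0]; the other summands give [J + d * T < q ^ M], which absorbs the terms free
   of [q ^ M]. *)
pose M := (M0 + J + d * T)%N; pose m := (q ^ M)%N.
pose tau := s - partial_sum h n M.
pose y := \sum_(k < kap.+1) (map_poly (frob M) (cpoly c k)).[th] * tau ^+ k.
have Ey : evalto th (ps_map (frob M) E) y.
  rewrite /E /auxE rmorph_sum; apply: evalto_sum => k _.
  rewrite rmorphM rmorphXn /= ps_map_poly; apply: evaltoM; first exact: evalto_poly.
  by apply: evaltoX; apply: evalto_AS_frob.
have y0 : y != 0 by apply: M0P Ey; rewrite /M -addnA leq_addr.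
have m0 : (0 < m)%N := qX_gt0 F M.
have yle : N y * Q ^+ (V * m) <= Q ^+ J.
  rewrite -ler_pdivlMr ?QX_gt0 //; apply: (is_sum_le Ey) => j.
  rewrite ler_pdivlMr ?QX_gt0 // cabsM cabs_thX /ps_map cabs_frob mulrAC exprM -exprMn.
  have EV0 : 0 <= N (E j) * Q ^+ V by rewrite mulr_ge0 ?cabs_ge0 ?exprn_ge0 ?ler0n.
  (* Below [J] the construction gives [|E_j| q^V <= 1], and [q^j <= q^J]. From [J] on the Gauss norm
     gives [q^(J - j) <= 1]; the power [m] does not increase it, and [q^j] cancels. *)
  have [jJ|Jj] := ltnP j J.
    apply: (@le_trans _ _ (Q ^+ j)); last exact/ler_QX/ltnW.
    rewrite ler_piMl ?exprn_ge0 ?ler0n // exprn_ile1 //; exact: Esmall.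
  rewrite -ler_pdivlMr ?QX_gt0 //.
  have EJ : N (E j) * Q ^+ V <= Q ^+ J / Q ^+ j.
    have -> : Q ^+ J = Q ^+ (D + T + c0 * kap) * Q ^+ V by rewrite -exprD.
    rewrite ler_pdivlMr ?QX_gt0 // mulrAC.
    by apply: ler_wpM2r; [rewrite exprn_ge0 ?ler0n|exact: EQ].
  apply: (le_trans _ EJ); rewrite -[leRHS]expr1; apply: ler_wiXn2l => //.
  apply: (le_trans EJ); rewrite ler_pdivrMr ?QX_gt0 // mul1r; exact: ler_QX.
pose r := den n M * dl ^+ m.
have r_bd : A_bd (H1 * m) r.
  apply: (@A_bd_le (2 * n * m + H0 * m)); first by rewrite /H1 !mulnDl leq_addr.
  by apply: A_bdM; [exact: den_bd|exact: A_bdX].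
have dlm0 : dl ^+ m != 0 by rewrite expf_neq0 // A_to_C_eq0.
have r0 : r != 0.
  rewrite mulf_neq0 // /den prodf_seq_neq0; apply/allP => i _; apply/implyP => _.
  by rewrite expf_neq0 // th_frob_subr_neq0.
(* [dl ^+ m] clears the values [P_k^(M)(theta)], and [r ^+ kap] the powers of [tau]. *)
pose yt := dl ^+ m * r ^+ kap * y.
have yt0 : yt != 0 by rewrite !mulf_neq0 // expf_neq0.
pose H := ((D + H0) * m + T + kap * (H1 * m))%N.
have yt_rep : rep w H yt.
  rewrite /yt /y mulr_sumr; apply: rep_sum => k _.
  have -> : dl ^+ m * r ^+ kap * ((map_poly (frob M) (cpoly c k)).[th] * tau ^+ k) =
      dl ^+ m * (map_poly (frob M) (cpoly c k)).[th] * (r ^+ (kap - k) * (r * tau) ^+ k).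
    have -> : r ^+ kap = r ^+ (kap - k) * r ^+ k by rewrite -exprD subnK // -ltnS.
    rewrite (exprMn k r tau).
    move: (_.[th]) (dl ^+ m) (r ^+ (kap - k)%N) (r ^+ k) (tau ^+ k) => a b e f v.
    by ring.
  apply: repM; first exact: rep_cpoly.
  have -> : (kap * (H1 * m) = H1 * m * (kap - k) + H1 * m * k)%N.
    by rewrite -mulnDr subnK 1?mulnC // -ltnS.
  apply: repM; first by apply: A_bd_rep; apply: A_bdX.
  apply: repX; apply: rep_le (rep_tau n dl_bd s_rep h_rep M).
  by rewrite /H1 [X in (_ <= X)%N]mulnDl leq_add2l leq_pmulr.
have yt_le : N yt <= Q ^+ ((H0 + kap * H1) * m) * N y.
  rewrite /yt cabsM ler_wpM2r ?cabs_ge0 //.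
  have -> : ((H0 + kap * H1) * m = H0 * m + H1 * m * kap)%N by ring.
  by apply: A_bd_abs; apply: A_bdM; apply: A_bdX.
have := liouville wi d0 yt_rep yt0; apply/negP; rewrite -ltNge.
apply: (@le_lt_trans _ _ (Q ^+ ((H0 + kap * H1) * m + d.-1 * H) * N y)).
  by rewrite exprD mulrAC ler_wpM2r ?exprn_ge0 ?ler0n.
rewrite -(ltr_pM2r (QX_gt0 F R (V * m))) mul1r -mulrA.
apply: (@le_lt_trans _ _ (Q ^+ ((H0 + kap * H1) * m + d.-1 * H + J))).
  by rewrite [leRHS]exprD ler_wpM2l ?exprn_ge0 ?ler0n.
rewrite ltr_eXn2l ?Q_gt1 //.
have mM : (J + d * T < m)%N.
  by apply: leq_ltn_trans (ltn_qX F M); rewrite /M -addnA leq_addl.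
have DE : (H0 + kap * H1 = D.-1)%N by rewrite /D addn1.
have HE : (H <= (2 * D) * m + T)%N.
  rewrite /H addnAC leq_add2r mulnA -mulnDl leq_mul2r; apply/orP; right.
  by rewrite mul2n -addnn -addnA leq_add2l leq_addr.
have dH : (d.-1 * H <= d.-1 * ((2 * D) * m + T))%N by rewrite leq_mul2l HE orbT.
have V2 : (V * m = d.-1 * (2 * D * m) + 2 * D * m)%N.
  by rewrite -{1}(prednK d0) /V; case: (d) d0 => //= d' _; ring.
have dT : (d.-1 * T <= d * T)%N by rewrite leq_mul2r leq_pred orbT.
have D1m : (D.-1 * m + m <= 2 * D * m)%N.
  by rewrite -mulSnr prednK // -mulnA leq_pmull.
rewrite DE V2; rewrite mulnDr in dH.
exact: exponent_bound dH dT D1m mM.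
Qed.

End Transcendence.

(** * Algebraic values, divisibility by [(t - theta)^n], and Taylor coefficients *)

Section Relations.
Variables (F : finFieldType) (R : realType) (C : Cinfty F R).
Local Notation q := #|F|.
Local Notation Q := (#|F|%:R : R).
Local Notation N := (abs C).
Local Notation th := (theta C).
Local Notation iota := (Fq_to_C C).
Local Notation Kb := (Kbar C).
Local Notation vK := (@Kbar_val F R C).
Local Notation mapK := (map_poly (@Kbar_val F R C)).
Local Notation iK := (@iotaK F R C).

Lemma quot_ps_lt1 (h : {poly C}) n : (forall l, N h`_l < Q ^+ n) ->
  forall j, N (quot_ps h n j) < 1.
Proof.
move=> hn j; rewrite /quot_ps psM; apply: cabs_sum_lt => // i _.
have := gauss_bd_inv_linX n (th_neq0 C) (j - i)%N; rewrite cabs_th => H.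
have I1 : N ((inv_lin th ^+ n) (j - i)%N) <= Q^-1 ^+ n.
  by apply: le_trans H; rewrite ler_peMr ?cabs_ge0 ?QX_ge1.
rewrite cabsM; apply: (@le_lt_trans _ _ (N h`_i * Q^-1 ^+ n)).
  by rewrite ler_wpM2l ?cabs_ge0.
by rewrite exprVn ltr_pdivrMr ?QX_gt0 // mul1r.
Qed.

Lemma A_Kbar (a : {poly F}) : A_to_C C a \in @Kbar_pred F R C.
Proof. exact: A_to_C_Kbar. Qed.

(** [h] is replaced by a small [h'] modulo [(t - theta)^n]. If [h'] is not divisible, cancelling its
    exact power of [t - theta] leaves a numerator nonzero at [theta] over a positive power, and
    [transcendence] contradicts the algebraicity of the value. *)
Lemma Kbar_divides n (h : {poly Kb}) g s : (0 < n)%N ->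
  sol (quot_ps (mapK h) n) g -> evalto th g s -> s \in @Kbar_pred F R C ->
  exists p, h = lin_th C n * p.
Proof.
move=> n0 gE gs sK; have [r [p [rn hE]]] := reducible_all n h.
set h' := \sum_(af <- r) _ in hE.
have h'n l : N (mapK h')`_l < Q ^+ n.
  rewrite coef_map /= /h' coef_sum rmorph_sum; rewrite big_seq.
  apply: cabs_sum_lt => [|af afr]; first exact: QX_gt0.
  rewrite /= coefMC coef_map rmorphM cabsM /= A_to_CC.
  apply: le_lt_trans (rn af afr); rewrite ler_piMl ?cabs_ge0 //; exact: cabs_Fq_le.
have [h'0|h'0] := eqVneq h' 0.
  by exists p; rewrite hE h'0 add0r.
have [m [k]] := multiplicity_XsubC h' (thK C); rewrite h'0 /= => rk h'E.
have [nm|mn] := leqP n m.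
  exists (k * ('X - (thK C)%:P) ^+ (m - n) + p); rewrite hE mulrDr; congr (_ + _).
  by rewrite h'E mulrCA /lin_th -exprD subnKC.
have YE : quot_ps (mapK h') n = quot_ps (mapK k) (n - m).
  rewrite h'E /quot_ps rmorphM rmorphXn /= map_polyXsubC /= A_to_CX rmorphM -mulrA.
  rewrite -{1}(subnKC (ltnW mn)) exprD; congr (_ * _).
  by rewrite mulrA (mul_inv_linX m (th_neq0 C)) mul1r.
have Y1 := quot_ps_lt1 h'n; have [B _ YB] := quot_ps_gauss_bd (mapK h') n.
have [s' Hs'] := AS_ps_eval Y1 (ex_intro _ B YB).
have [z zE] := poly_sol p.
have GE : sol (quot_ps (mapK h) n) (AS_ps (quot_ps (mapK h') n) + poly_ps (mapK z)).
  by rewrite hE rmorphD quot_psD quot_ps_lin_th; apply: solD => //; apply: sol_AS.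
have [a aE] := sol_uniq gE GE gs (evaltoD Hs' (evalto_poly th (mapK z))).
have s'K : s' \in @Kbar_pred F R C.
  have -> : s' = s - A_to_C C a - (mapK z).[th] by rewrite -aE; ring.
  by rewrite !rpredB // ?A_Kbar // mapK_horner Kbar_valP.
suff /negP[] : s' \notin @Kbar_pred F R C by [].
apply: (@transcendence _ _ _ (mapK k) (n - m)); rewrite -?YE ?subn_gt0 //.
  by rewrite mapK_horner fmorph_eq0.
by move=> l; rewrite coef_map Kbar_valP.
Qed.

Lemma lin_th_Kbar n (p : {poly Kb}) g s :
  sol (quot_ps (mapK (lin_th C n * p)) n) g -> evalto th g s -> s \in @Kbar_pred F R C.
Proof.
rewrite quot_ps_lin_th => gE gs; have [z zE] := poly_sol p.
have [a aE] := sol_uniq gE zE gs (evalto_poly th (mapK z)).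
have -> : s = A_to_C C a + (mapK z).[th] by rewrite -aE subrK.
by rewrite rpredD ?A_Kbar // mapK_horner Kbar_valP.
Qed.

(* The isomorphism of [Kbar[t] / (t - theta)^n] with [Vn]: the entries are the
   Taylor coefficients at [theta], in decreasing order. *)
Definition taylor n (P : {poly Kb}) : Vn C n :=
  \col_(i < n) (P \Po ('X + (thK C)%:P))`_(n.-1 - i).

Lemma taylorE n P i j :
  (taylor n P : 'cV_n) i j = (P \Po ('X + (thK C)%:P))`_(n.-1 - i).
Proof. by rewrite mxE. Qed.

Lemma taylorD n P P' : taylor n (P + P') = taylor n P + taylor n P'.
Proof.
rewrite -[RHS]/((taylor n P : 'cV_n) + (taylor n P' : 'cV_n)).
apply/matrixP => i j; rewrite [RHS]mxE [LHS]taylorE comp_polyD coefD.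
by rewrite [X in _ = X + _]taylorE [X in _ = _ + X]taylorE.
Qed.

Lemma taylor0 n : taylor n 0 = 0.
Proof.
rewrite -[RHS]/(0 : 'cV_n).
by apply/matrixP => i j; rewrite !mxE comp_poly0 coef0.
Qed.

Lemma taylor_sum n (I : Type) (r : seq I) (p : pred I) (P : I -> {poly Kb}) :
  taylor n (\sum_(i <- r | p i) P i) = \sum_(i <- r | p i) taylor n (P i).
Proof. by elim/big_rec2: _ => [|i x y _ <-]; [exact: taylor0|rewrite taylorD]. Qed.

Lemma taylorC n x : taylor n x%:P = last_entry n x.
Proof.
apply/matrixP => i j; rewrite !mxE comp_polyC coefC subn_eq0.
case: n i => [[]//|n] i /=; have := ltn_ord i; rewrite ltnS eqSS eqn_leq => ->.
by [].
Qed.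

(** In [t = theta + (t - theta)] the second summand shifts the Taylor coefficients; in decreasing
    order this is the superdiagonal of [t_matrix]. *)
Lemma taylorMX n P : taylor n ('X * P) = t_matrix C n *m (taylor n P : 'cV_n).
Proof.
apply/matrixP => i j; rewrite !mxE comp_polyM comp_polyX.
rewrite mulrDl coefD coefXM coefCM (bigD1 i) //= !mxE eqxx addrC; congr (_ + _).
have n0 : (0 < n)%N := leq_ltn_trans (leq0n i) (ltn_ord i).
have [i1n|ni1] := ltnP i.+1 n; last first.
  have -> : (n.-1 - i)%N = 0%N by apply/eqP; rewrite subn_eq0 -ltnS prednK.
  rewrite eqxx big1 // => k ki; rewrite !mxE (negPf ki).
  by rewrite ltn_eqF ?mul0r // (leq_trans (ltn_ord k)).
rewrite (bigD1 (Ordinal i1n)) /=; last by rewrite -val_eqE /= gtn_eqF.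
have nk0 : (0 < n.-1 - i)%N by rewrite subn_gt0 -ltnS prednK.
rewrite !mxE -val_eqE /= (gtn_eqF nk0) (gtn_eqF (ltnSn i)) ?eqxx mul1r.
rewrite big1 ?addr0 => [|k /andP[ki kj]].
  by rewrite subnS.
rewrite !mxE (negPf ki); case: eqP => [E|]; last by rewrite mul0r.
by case/eqP: kj; apply: val_inj.
Qed.

Lemma taylorCM n c P : taylor n (c%:P * P) = c *: (taylor n P : 'cV_n).
Proof. by apply/matrixP => i j; rewrite !mxE comp_polyM comp_polyC coefCM. Qed.

Lemma taylorMA n (a : {poly F}) P : a *: taylor n P = taylor n (map_poly iK a * P).
Proof.
elim/poly_ind: a P => [|a c IH] P; first by rewrite scale0r rmorph0 mul0r taylor0.
rewrite scalerDl.
have -> : c%:P *: taylor n P = iK c *: (taylor n P : 'cV_n) by exact: Vn_scaleC.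
have -> : (a * 'X) *: taylor n P = a *: (t_matrix C n *m (taylor n P : 'cV_n) : Vn C n).
  exact: Vn_scaleMX.
rewrite -taylorMX IH -taylorCM -taylorD; congr taylor.
by rewrite rmorphD rmorphM /= map_polyX map_polyC mulrDl mulrA.
Qed.

Lemma taylor_eq0 n P : taylor n P = 0 <-> exists p, P = lin_th C n * p.
Proof.
split=> [P0|[p ->]]; last first.
  apply/matrixP => i j; rewrite !mxE /lin_th comp_polyM rmorphXn /= comp_polyB.
  rewrite comp_polyX comp_polyC addrK coefXnM ifT //.
  by have := ltn_ord i; case: n i {j} => // n i _; rewrite ltnS leq_subr.
pose P' := P \Po ('X + (thK C)%:P).
have P'0 k : (k < n)%N -> P'`_k = 0.
  move=> kn; have nk : (n.-1 - k < n)%N by case: n kn {P0} => // n kn; rewrite ltnS leq_subr.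
  have /matrixP/(_ (Ordinal nk) 0) := P0; rewrite !mxE /= subKn //.
  by case: n kn {P0 nk}.
have P'E : P' = drop_poly n P' * 'X^n.
  rewrite -[LHS](poly_take_drop n) -[RHS]add0r; congr (_ + _).
  apply/polyP => k; rewrite coef_take_poly coef0; case: ltnP => // kn; exact: P'0.
exists (drop_poly n P' \Po ('X - (thK C)%:P)).
have PE : P = P' \Po ('X - (thK C)%:P).
  by rewrite /P' comp_polyXaddC_K.
by rewrite [LHS]PE {1}P'E comp_polyM rmorphXn /= comp_polyX mulrC.
Qed.

End Relations.

(** * Comparison of ranks and dimensions *)

Section IndexedFamilies.
Variables (S : nzRingType) (M : lmodType S).

Lemma lin_indepP (s : seq M) : lin_indep s <->
  forall c : nat -> S, \sum_(i < size s) c i *: s`_i = 0 ->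
  forall i, (i < size s)%N -> c i = 0.
Proof.
split=> [ind c c0 i si|ind c c0 i].
  exact: (ind (fun i => c i) c0 (Ordinal si)).
pose c' i := if insub i is Some i' then c i' else 0.
have cE (j : 'I_(size s)) : c' j = c j by rewrite /c' valK.
rewrite -cE; apply: ind (ltn_ord i).
by rewrite -[RHS]c0; apply: eq_bigr => j _; rewrite cE.
Qed.

Lemma sum_map_nth (T : Type) (f : T -> M) (x0 : T) (u : seq T) (c : nat -> S) :
  \sum_(i < size (map f u)) c i *: (map f u)`_i = \sum_(i < size u) c i *: f (nth x0 u i).
Proof.
rewrite -(big_mkord predT (fun i => c i *: (map f u)`_i)) size_map big_mkord.
by apply: eq_bigr => i _; rewrite (nth_map x0).
Qed.

End IndexedFamilies.

Section MainTheorem.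
Variables (F : finFieldType) (R : realType) (C : Cinfty F R).
Local Notation q := #|F|.
Local Notation Q := (#|F|%:R : R).
Local Notation N := (abs C).
Local Notation th := (theta C).
Local Notation iota := (Fq_to_C C).
Local Notation Kb := (Kbar C).
Local Notation vK := (@Kbar_val F R C).
Local Notation mapK := (map_poly (@Kbar_val F R C)).
Local Notation iK := (@iotaK F R C).
Variables (n : nat) (n_gt0 : (0 < n)%N) (Lio : C -> C).
Hypothesis Lio_lift : is_lift Lio (Li n).

Local Notation vec x := (last_entry n ((-1) ^+ n * (x : Kb)) : Vn C n).

(** A solution may be changed by an element of [F[t]]; it is chosen so that the value at [theta]
    equals that of the lift, not merely modulo [A]. *)
Lemma lift_sol (x : Kb) : exists g,
  sol (quot_ps (mapK ((-1) ^+ n * x)%:P) n) g /\ evalto th g (Lio (vK x)).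
Proof.
have [g [s [gE gs]]] := sol_exists n ((-1) ^+ n * x)%:P.
have LE : Li n (vK x) = mod_A s.
  have xE : mapK ((-1) ^+ n * x)%:P = ((-1) ^+ n * vK x)%:P.
    by rewrite map_polyC; congr _%:P; rewrite [LHS]rmorphM rmorphXn rmorphN rmorph1.
  by apply: LiE gs; rewrite -xE.
have /mod_A_eq/asboolP[a aE] : mod_A (Lio (vK x)) = mod_A s by rewrite Lio_lift.
exists (g + A_ps C a); split; last first.
  have -> : Lio (vK x) = s + A_to_C C a by rewrite -aE addrC subrK.
  by apply: evaltoD => //; apply: evalto_A.
rewrite -[quot_ps _ _]addr0; apply: solD => //.
by rewrite /sol addr0 frob_A_ps.
Qed.

(** Both sides say that [h] is divisible by [(t - theta)^n]: the first because the sum is the value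
    at [theta] of a solution for [h], the second through [taylor]. *)
Lemma relationP (us : seq Kb) (c : nat -> {poly F}) :
  \sum_(i < size us) A_to_C C (c i) * Lio (vK us`_i) \in @Kbar_pred F R C <->
  \sum_(i < size us) c i *: vec us`_i = 0.
Proof.
have [g gP] := choice lift_sol.
pose h := \sum_(i < size us) map_poly iK (c i) * ((-1) ^+ n * us`_i)%:P.
pose G := \sum_(i < size us) A_ps C (c i) * g us`_i.
have GE : sol (quot_ps (mapK h) n) G.
  rewrite /h rmorph_sum quot_ps_sum; apply: sol_sum => i _.
  rewrite rmorphM /= mapK_iotaK quot_psMA; apply: solMA.
  by have [] := gP us`_i.
have Gs : evalto th G (\sum_(i < size us) A_to_C C (c i) * Lio (vK us`_i)).
  apply: evalto_sum => i _; apply: evaltoM; first exact: evalto_A.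
  by have [] := gP us`_i.
have -> : \sum_(i < size us) c i *: vec us`_i = taylor n h.
  rewrite /h taylor_sum; apply: eq_bigr => i _.
  by rewrite -taylorMA taylorC.
rewrite taylor_eq0; split=> [sK|[p pE]].
  exact: Kbar_divides n_gt0 GE Gs sK.
by move: GE; rewrite pE => GE; apply: lin_th_Kbar GE Gs.
Qed.

Variable u : seq Kb.
Let v : seq (Vn C n) := [seq vec x | x <- u].
Let w : seq C := 1 :: [seq Lio (vK x) | x <- u].

Lemma K_common_denominator (m : nat) (c : nat -> K C) :
  exists2 b : {poly F}, b != 0 &
    exists a : nat -> {poly F},
      forall i, (i < m)%N -> A_to_C C b * K_val (c i) = A_to_C C (a i).
Proof.
have [b b0 bP] : exists2 b : {poly F}, b != 0 & {in index_iota 0 m, forall i,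
    exists a, A_to_C C b * K_val (c i) = A_to_C C a}.
  apply: (common_multiplier (P := fun i b => exists a, A_to_C C b * K_val (c i) = A_to_C C a)).
    by move=> i a b [a' E]; exists (b * a'); rewrite !rmorphM -mulrA E.
  move=> i _; have /asboolP[a [b [b0 ->]]] := K_valP (c i).
  exists b; first by rewrite -(A_to_C_eq0 C).
  by exists a; rewrite mulrCA mulfV ?mulr1.
have aP i : exists a, (i < m)%N -> A_to_C C b * K_val (c i) = A_to_C C a.
  have [im|mi] := ltnP i m; last by exists 0.
  by have [|a aE] := bP i; [rewrite mem_index_iota|exists a].
by have [a aE] := choice aP; exists b => //; exists a => i; apply: aE.
Qed.

(** A maximal subfamily [us] with independent vectors serves both bounds. By [relationP] its values
    together with 1 are independent over [K]; and each remaining value is a combination of them over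
    [Kbar], since a nonzero multiple of its vector lies in the span. *)
Theorem rank_dim_bounds :
  (lin_rank (lin_span v) + 1 <= lin_dim (lin_span (w : seq (C_over_K C))))%N /\
  (lin_dim (lin_span (w : seq (C_over_Kbar C))) <= lin_rank (lin_span v) + 1)%N.
Proof.
have [us [usu ind tor]] := max_indep (fun x : Kb => vec x) u.
pose ws : seq C := 1 :: [seq Lio (vK x) | x <- us].
have rankE : lin_rank (lin_span v) = size us.
  rewrite (lin_rankE (t := [seq vec x | x <- us])) ?size_map //.
    by move=> _ /mapP[x /usu xu ->]; apply: mem_lin_span; apply: map_f.
  by move=> _ /mapP[x xu ->]; apply: tor.
have ws_size : size ws = (size us + 1)%N by rewrite /ws /= size_map addn1.
rewrite rankE -ws_size; split.
  have [b [[_ bspan] ->]] := lin_dimE (w : seq (C_over_K C)).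
  apply: (lin_indep_size (M := C_over_K C)) => [x xws|].
    rewrite bspan; apply: (mem_lin_span (M := C_over_K C)).
    move: xws; rewrite !inE => /predU1P[->|/mapP[y /usu yu ->]]; first by rewrite eqxx.
    by rewrite map_f ?orbT.
  apply/lin_indepP => c; rewrite [size _]/= big_ord_recl /= => c0.
  (* Cleared of denominators, the relation says that a combination of the values over [A] lies in
     [A], hence in [Kbar]. *)
  have [d d0 [a aE]] := K_common_denominator (size ws) c.
  have dC : A_to_C C d != 0 by rewrite A_to_C_eq0.
  have c0' : K_val (c 0%N) + \sum_(i < size us) K_val (c i.+1) * Lio (vK us`_i) = 0.
    rewrite -[RHS]c0; congr (_ + _); first by rewrite -[RHS]/(K_val (c 0%N) * 1) mulr1.
    rewrite -(big_mkord predT (fun i => K_val (c i.+1) * Lio (vK us`_i))).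
    rewrite -(size_map (fun x => Lio (vK x)) us) big_mkord; apply: eq_bigr => i _.
    rewrite -[RHS]/(K_val (c i.+1) * [seq Lio (vK x) | x <- us]`_i).
    by rewrite (nth_map 0) // -(size_map (fun x => Lio (vK x))).
  have rel : \sum_(i < size us) A_to_C C (a i.+1) * Lio (vK us`_i) = - A_to_C C (a 0%N).
    apply/eqP; rewrite -addr_eq0 addrC; apply/eqP.
    rewrite -[RHS](mulr0 (A_to_C C d)) -[in RHS]c0' mulrDr aE //; congr (_ + _).
    rewrite mulr_sumr; apply: eq_bigr => i _; rewrite mulrA aE //.
    by rewrite ws_size addn1 ltnS ltn_ord.
  have a0 i : (i < size us)%N -> a i.+1 = 0.
    have /lin_indepP/(_ (fun i => a i.+1)) ind' := ind.
    move=> iu; apply: ind'; last by rewrite size_map.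
    apply: etrans (sum_map_nth (fun x : Kb => vec x) 0 us (fun i => a i.+1)) _.
    by apply/(relationP us (fun i => a i.+1)); rewrite rel rpredN A_Kbar.
  have cS i : (i < size us)%N -> c i.+1 = 0.
    move=> iu; apply/val_inj; apply: (mulfI dC).
    by rewrite aE ?ws_size ?addn1 // a0 // rmorph0 mulr0.
  move=> [|i]; last by rewrite ltnS size_map; apply: cS.
  move=> _; apply/val_inj; rewrite -[RHS]c0' big1 ?addr0 // => i _.
  by rewrite cS // mul0r.
have [b [[bind bspan] ->]] := lin_dimE (w : seq (C_over_Kbar C)).
apply: (lin_indep_size (M := C_over_Kbar C)) => // x /(mem_lin_span (M := C_over_Kbar C)).
rewrite bspan; apply: (lin_span_sub (M := C_over_Kbar C)) => {}x.
have span1 : lin_span (ws : seq (C_over_Kbar C)) (1 : C).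
  by apply: (mem_lin_span (M := C_over_Kbar C)); rewrite mem_head.
have spanK (k : C) : k \in @Kbar_pred F R C -> lin_span (ws : seq (C_over_Kbar C)) k.
  move=> kK; rewrite -[k]mulr1.
  exact: (lin_spanZ (M := C_over_Kbar C) (MkKbar kK)) span1.
rewrite inE => /predU1P[-> //|/mapP[y yu ->]] {x}.
have [a a0 /lin_spanP[c cE]] := tor y yu.
(* These are the coefficients of the relation between [vec y] and the chosen vectors; the same
   combination of values therefore lies in [Kbar]. *)
pose c' i := if i is i'.+1 then - c i' else a.
have /(relationP (y :: us) c') : \sum_(i < size (y :: us)) c' i *: vec (y :: us)`_i = 0.
  rewrite [size _]/= big_ord_recl /= cE (sum_map_nth _ 0) -big_split big1 //= => i _.
  by rewrite scaleNr subrr.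
rewrite [size _]/= big_ord_recl /= => relK.
have aC : A_to_C C a != 0 by rewrite A_to_C_eq0.
have -> : Lio (vK y) = (A_to_C C a)^-1 * ((A_to_C C a * Lio (vK y) +
    \sum_(i < size us) A_to_C C (- c i) * Lio (vK us`_i)) +
    \sum_(i < size us) A_to_C C (c i) * Lio (vK us`_i)).
  rewrite -addrA -big_split big1 /= ?addr0 ?mulKf // => i _.
  by rewrite -mulrDl rmorphN addNr mul0r.
have ainv : (A_to_C C a)^-1 \in @Kbar_pred F R C by rewrite rpredV A_Kbar.
apply: (lin_spanZ (M := C_over_Kbar C) (MkKbar ainv)).
apply: (lin_spanD (M := C_over_Kbar C)); first exact: spanK.
apply: (lin_span_sum (M := C_over_Kbar C)) => i _.
apply: (lin_spanZ (M := C_over_Kbar C) (A_to_Kbar C (c i))).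
apply: (mem_lin_span (M := C_over_Kbar C)); rewrite inE; apply/orP; right.
by apply/mapP; exists us`_i => //; apply: mem_nth.
Qed.

End MainTheorem.

Theorem theorem1p2p9 (F : finFieldType) (R : realType) (C : Cinfty F R)
    (n l : nat) (n_gt0 : (0 < n)%N) (u : l.-tuple (Kbar C))
    (Lio : C -> C) (Lio_linear : Fq_linear Lio) (Lio_lift : is_lift Lio (Li n)) :
  let q := #|F| in
  let v : seq (Vn C n) := [seq last_entry n ((-1) ^+ n * x) | x <- u] in
  let w : seq C := 1 :: [seq Lio (Kbar_val x) | x <- u] in
  [/\ forall x : Kbar C,
        exists (m : nat) (c : Kbar C) (a : 'I_m -> {poly F})
               (f : 'I_m -> Kbar C) (s : 'I_m -> C),
        [/\ (0 < m)%N,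
            forall j, abs C (Kbar_val (f j)) < q%:R ^+ n,
            forall j, is_sum
              (fun i => Kbar_val (f j) ^+ (q ^ i.+1)
                        / (theta C ^+ (q ^ i.+1) - theta C) ^+ n) (s j),
            Li n (Kbar_val x)
              = mod_A (Kbar_val c) + \sum_(j < m) a j *: Li n (Kbar_val (f j))
          & Li n (Kbar_val x)
              = mod_A (Kbar_val c) + \sum_(j < m) a j *: mod_A (s j)],
      (lin_rank (lin_span v) + 1
         <= lin_dim (lin_span (w : seq (C_over_K C))))%N
    & (lin_dim (lin_span (w : seq (C_over_Kbar C)))
         <= lin_rank (lin_span v) + 1)%N].
Proof.
move=> q v w; have [lower upper] := rank_dim_bounds n_gt0 Lio_lift u.
split=> [x|//|//]; exact: Li_small_expansion.
Qed.
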